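(* Let $\Omega\subset\mathbb{R}^n$ be a compact set with $C^1$ boundary, let $\delta>0$, let $d\in\mathbb{N}$ and let $d'$ be an integer with $0\le d'\le d$. Let $\rho_0,\rho_1\in\mathcal{M}^+(\Omega)$, and let $H=(H_1,\dots,H_d):[0,1]\times\Omega\to(\mathbb{R}\times\mathbb{R}^n\times\mathbb{R})^d$, with $H_i=(H_i^\rho,H_i^\omega,H_i^\zeta)$, and $F=(F_1,\dots,F_d):[0,1]\to\mathbb{R}^d$ be continuous functions. Let $\mathcal{CE}_{H,F}(\rho_0,\rho_1)$ be the set of constrained paths with $d'$ inequality constraints and $d-d'$ equality constraints, and let $\mathcal{E}_\delta(\mu)$ denote the Wasserstein-Fisher-Rao cost of $\mu$ (both defined in the context). If the problem $$\inf\{\mathcal{E}_\delta(\mu)\;:\;\mu\in\mathcal{CE}_{H,F}(\rho_0,\rho_1)\}$$ is feasible, i.e. there exists $\mu\in\mathcal{CE}_{H,F}(\rho_0,\rho_1)$ with $\mathcal{E}_\delta(\mu)<+\infty$, then an optimal path exists, i.e. there exists $\mu^*\in\mathcal{CE}_{H,F}(\rho_0,\rho_1)$ attaining this infimum.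
   Context: Notation: $\mathcal{M}(X)$ denotes the finite signed Borel measures on $X$ and $\mathcal{M}^+(X)$ the nonnegative ones. Continuity equation. For $\rho_0,\rho_1\in\mathcal{M}^+(\Omega)$, $\mathcal{CE}(\rho_0,\rho_1)$ is the set of triples $\mu=(\rho,\omega,\zeta)\in\mathcal{M}^+([0,1]\times\Omega)\times\mathcal{M}([0,1]\times\Omega)^n\times\mathcal{M}([0,1]\times\Omega)$ such that for every $\phi\in C^1([0,1]\times\Omega)$, $$\int_{[0,1]\times\Omega}\partial_t\phi\,d\rho+\int_{[0,1]\times\Omega}\nabla\phi\cdot d\omega+\int_{[0,1]\times\Omega}\phi\,d\zeta=\int_\Omega\phi(1,\cdot)\,d\rho_1-\int_\Omega\phi(0,\cdot)\,d\rho_0 ,$$ where $\nabla$ is the gradient in the space variable. Cost. Define $f_\delta:\mathbb{R}\times\mathbb{R}^n\times\mathbb{R}\to[0,+\infty]$ by $f_\delta(r,w,z)=\frac{\|w\|^2+\delta^2z^2}{2r}$ if $r>0$, $f_\delta(0,0,0)=0$, and $f_\delta=+\infty$ otherwise. For $\mu=(\rho,\omega,\zeta)$ set $$\mathcal{E}_\delta(\mu)=\int_{[0,1]\times\Omega}f_\delta\left(\frac{d\rho}{d\lambda},\frac{d\omega}{d\lambda},\frac{d\zeta}{d\lambda}\right)d\lambda,$$ where $\lambda$ is any nonnegative Borel measure on $[0,1]\times\Omega$ with $\rho,\omega,\zeta\ll\lambda$; by 1-homogeneity of $f_\delta$ the value does not depend on $\lambda$. Disintegration. A measure $\nu$ on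 $[0,1]\times\Omega$ disintegrates in time, written $\nu=dt\otimes\nu_t$, if there is a Borel family of measures $\{\nu_t\}_{t\in[0,1]}$ on $\Omega$ with $d\nu(t,x)=dt\otimes d\nu_t(x)$, $dt$ being Lebesgue measure on $[0,1]$. Affine constraints. For $G=(G^\rho,G^\omega,G^\zeta):[0,1]\times\Omega\to\mathbb{R}\times\mathbb{R}^n\times\mathbb{R}$ and $f:[0,1]\to\mathbb{R}$, a triple $\mu=(\rho,\omega,\zeta)$ belongs to $\mathcal{A}^{\mathrm{eq}}(G,f)$ (resp. $\mathcal{A}^{\mathrm{ineq}}(G,f)$) if $\rho,\omega,\zeta$ all disintegrate in time and, for a.e. $t\in[0,1]$, $$\int_\Omega G^\rho(t,x)\,d\rho_t(x)+\int_\Omega G^\omega(t,x)\cdot d\omega_t(x)+\int_\Omega G^\zeta(t,x)\,d\zeta_t(x)$$ is equal to $f(t)$ (resp. is $\le f(t)$). Constrained paths. $\mathcal{CE}_{H,F}(\rho_0,\rho_1)$ is the set of $\mu\in\mathcal{CE}(\rho_0,\rho_1)$ such that $\mu\in\mathcal{A}^{\mathrm{ineq}}(H_i,F_i)$ for $i=1,\dots,d'$ and $\mu\in\mathcal{A}^{\mathrm{eq}}(H_i,F_i)$ for $i=d'+1,\dots,d$. *)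

(* Defs.v *)
From HB Require Import structures.
From mathcomp Require Import all_boot all_order all_algebra.
From mathcomp Require Import all_classical all_reals all_analysis.
From mathcomp Require Import measurable_realfun.

Set Implicit Arguments.
Unset Strict Implicit.
Unset Printing Implicit Defensive.
Import Order.TTheory GRing.Theory Num.Theory.
Import numFieldNormedType.Exports.
Local Open Scope classical_set_scope.
Local Open Scope ring_scope.
Local Open Scope charge_scope.

(* Borel sigma-algebra on matrices. On the product R * 'rV[R]_n the library's
   product sigma-algebra is then the Borel one, both factors being second
   countable. *)
Section borel_matrix.
Context (R : realType) (m n : nat).

HB.instance Definition _ :=
  @isMeasurable.Build (sigma_display (@open 'M[R]_(m, n)))
    'M[R]_(m, n) <<s @open 'M[R]_(m, n) >>
    (@sigma_algebra0 _ _ _) (@sigma_algebraC _ _) (@sigma_algebra_bigcup _ _ _).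

End borel_matrix.

(* In finite dimension this is the usual notion: all directional derivatives of
   a differentiable function depend continuously on the base point. *)
Definition is_C1 (R : realType) (V : normedModType R) (f : V -> R) : Prop :=
  (forall x, differentiable f x) /\ (forall v, continuous (fun x => 'D_v f x)).

(* Near each of its boundary points Omega is, up to relabelling and reorienting
   the coordinate axes, the epigraph of a C^1 function of the other n - 1
   coordinates; col' k y is y with its coordinate k removed. *)
Definition has_C1_boundary (R : realType) (n : nat) (Omega : set 'rV[R]_n)
    : Prop :=
  forall x, (closure Omega `\` interior Omega) x ->
  exists (k : 'I_n) (s : bool) (gamma : 'rV[R]_n.-1 -> R),
    is_C1 gamma /\
    \forall y \near x, Omega y <-> gamma (col' k y) <= (-1) ^+ s * y ord0 k.

Definition cylinder (R : realType) (n : nat) (Omega : set 'rV[R]_n)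
    : set (R * 'rV[R]_n) := `[0, 1] `*` Omega.

(* Measures on a subset K of a space are encoded as measures on the whole space
   that vanish on every measurable set disjoint from K. *)
Definition carried_by d (T : measurableType d) (R : realType)
    (K : set T) (nu : set T -> \bar R) : Prop := nu.-null_set (~` K).

Section signed_integral.
Context d (T : measurableType d) (R : realType).
Implicit Types nu : {charge set T -> \bar R}.

Definition hahn_choice nu :=
  svalP (cid (svalP (cid (Hahn_decomposition nu)))).

Definition total_variation nu : set T -> \bar R :=
  charge_variation (hahn_choice nu).

HB.instance Definition _ nu := Measure.on (total_variation nu).
HB.instance Definition _ nu :=
  @Measure_isFinite.Build _ _ _ (total_variation nu)
    (@fin_num_measure _ _ _ (charge_variation (hahn_choice nu))).

Definition cintegral nu (D : set T) (f : T -> R) : R :=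
  \int[jordan_pos (hahn_choice nu)]_(x in D) f x
  - \int[jordan_neg (hahn_choice nu)]_(x in D) f x.

End signed_integral.
Arguments total_variation {d T R}.

Record path_triple (R : realType) (n : nat) := PathTriple {
  rho : {finite_measure set (R * 'rV[R]_n)%type -> \bar R} ;
  omega : 'I_n -> {charge set (R * 'rV[R]_n)%type -> \bar R} ;
  zeta : {charge set (R * 'rV[R]_n)%type -> \bar R} }.

Section paths.
Context (R : realType) (n : nat).
Local Notation E := 'rV[R]_n.
Implicit Types (Omega : set E) (mu : path_triple R n).

Definition dt (phi : R * E -> R) (p : R * E) : R := 'D_(1, 0) phi p.
Definition dx (i : 'I_n) (phi : R * E -> R) (p : R * E) : R :=
  'D_(0, delta_mx ord0 i) phi p.

(* Elements of C^1([0,1] x Omega) are the restrictions of C^1 functions on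
   R x R^n. *)
Definition CE Omega (rho0 rho1 : {finite_measure set E -> \bar R}) mu : Prop :=
  let K := cylinder Omega in
  [/\ carried_by K (rho mu), (forall i, carried_by K (omega mu i)),
      carried_by K (zeta mu) &
      forall phi : R * E -> R, is_C1 phi ->
        \int[rho mu]_(p in K) dt phi p
        + \sum_(i < n) cintegral (omega mu i) K (dx i phi)
        + cintegral (zeta mu) K phi
        = \int[rho1]_(x in Omega) phi (1, x)
          - \int[rho0]_(x in Omega) phi (0, x)].

(* The square of the Euclidean norm is written out because the library's norm
   on 'rV[R]_n is the max norm. *)
Definition f_cost (delta : R) (r : R) (w : E) (z : R) : \bar R :=
  if 0 < r then
    ((\sum_(i < n) w ord0 i ^+ 2 + delta ^+ 2 * z ^+ 2) / (2 * r))%:E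
  else if [&& r == 0, w == 0 & z == 0] then 0%E else +oo%E.

Definition cost_wrt Omega (delta : R) mu
    (lambda : {sigma_finite_measure set (R * E)%type -> \bar R}) : \bar R :=
  (\int[lambda]_(p in cylinder Omega)
     f_cost delta (fine ('d (charge_of_finite_measure (rho mu)) '/d lambda p))
       (\row_i fine ('d (omega mu i) '/d lambda p))
       (fine ('d (zeta mu) '/d lambda p)))%E.

Definition dominant mu (A : set (R * E)) : \bar R :=
  (rho mu A + \sum_(i < n) total_variation (omega mu i) A
   + total_variation (zeta mu) A)%E.

Section dominant_measure.
Variable mu : path_triple R n.
Local Open Scope ereal_scope.

Let dominant0 : dominant mu set0 = 0.
Proof. by rewrite /dominant !measure0 big1 ?adde0. Qed.

Let dominant_ge0 A : 0 <= dominant mu A.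
Proof. by rewrite /dominant !adde_ge0// sume_ge0. Qed.

Let dominant_sigma_additive : semi_sigma_additive (dominant mu).
Proof.
move=> F mF tF mUF; rewrite /dominant.
under eq_fun do rewrite big_split /= big_split /=.
apply: cvgeD; [|apply: cvgeD|]; try exact: measure_semi_sigma_additive.
- by rewrite ge0_adde_def// inE adde_ge0// sume_ge0.
- by rewrite ge0_adde_def// inE ?sume_ge0 ?measure_ge0.
- rewrite [X in _ --> X](_ : _ = lim ((fun k => \sum_(0 <= j < k)
      \sum_(i < n) total_variation (omega mu i) (F j)) @ \oo)).
    by apply: is_cvg_ereal_nneg_natsum => k _; exact: sume_ge0.
  rewrite nneseries_sum//; apply: eq_bigr => /= i _.
  exact: measure_semi_bigcup.
Qed.

HB.instance Definition _ := isMeasure.Build _ _ _ (dominant mu)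
  dominant0 dominant_ge0 dominant_sigma_additive.

Let dominant_fin : fin_num_fun (dominant mu).
Proof.
move=> A mA; rewrite /dominant !fin_numD !fin_num_measure//= andbT.
by apply/sum_fin_numP => i _ _; rewrite fin_num_measure.
Qed.

HB.instance Definition _ :=
  @Measure_isFinite.Build _ _ _ (dominant mu) dominant_fin.

End dominant_measure.

(* The cost is computed with one particular dominating measure; by
   1-homogeneity of f_cost, any sigma-finite lambda dominating rho, all the
   omega_i and zeta gives the same value. *)
Definition wfr_cost Omega (delta : R) mu : \bar R :=
  cost_wrt Omega delta mu (dominant mu).

(* nu = dt (x) nu_t, tested on Borel subsets of R x R^n. Integrability follows
   from the other requirements, nu being finite; it is included so that the
   integral is visibly a genuine one. *)
Definition disintegrates Omega (nu : {charge set (R * E)%type -> \bar R})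
    (nut : R -> {charge set E -> \bar R}) : Prop :=
  [/\ (forall t, t \in `[0, 1] -> carried_by Omega (nut t)),
      (forall B : set E, measurable B ->
         measurable_fun `[0 : R, 1] (fun t : R => nut t B)) &
      forall A : set (R * E), measurable A ->
        lebesgue_measure.-integrable `[0 : R, 1]
          (fun t : R => nut t (xsection A t)) /\
        nu A = (\int[lebesgue_measure]_(t in `[0%R : R, 1%R])
                  nut t (xsection A t))%E].

(* Disintegrations are unique up to a null set of times, so that it does not
   matter which ones are used. *)
Definition affine_constraint (rel : R -> R -> Prop) Omega
    (G : R * E -> R * E * R) (f : R -> R) mu : Prop :=
  exists (rhot : R -> {charge set E -> \bar R})
         (omegat : 'I_n -> R -> {charge set E -> \bar R})
         (zetat : R -> {charge set E -> \bar R}),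
  [/\ disintegrates Omega (charge_of_finite_measure (rho mu)) rhot,
      (forall i, disintegrates Omega (omega mu i) (omegat i)),
      disintegrates Omega (zeta mu) zetat &
      {ae lebesgue_measure, forall t : R, t \in `[0, 1] ->
        rel (cintegral (rhot t) Omega (fun x => (G (t, x)).1.1)
             + \sum_(i < n)
                 cintegral (omegat i t) Omega (fun x => (G (t, x)).1.2 ord0 i)
             + cintegral (zetat t) Omega (fun x => (G (t, x)).2))
            (f t)}].

Definition affine_eq := affine_constraint (fun a b => a = b).
Definition affine_ineq := affine_constraint (fun a b => a <= b).

(* With indices starting at 0, the first d' constraints are inequalities. *)
Definition CE_constrained Omega (d d' : nat)
    (H : 'I_d -> R * E -> R * E * R) (F : 'I_d -> R -> R)
    (rho0 rho1 : {finite_measure set E -> \bar R}) mu : Prop :=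
  [/\ CE Omega rho0 rho1 mu,
      (forall i : 'I_d, (i < d')%N -> affine_ineq Omega (H i) (F i) mu) &
      (forall i : 'I_d, (d' <= i)%N -> affine_eq Omega (H i) (F i) mu)].

End paths.

(* Main.v *)
Require Import Defs.
From HB Require Import structures.
From mathcomp Require Import all_boot all_order all_algebra.
From mathcomp Require Import all_classical all_reals all_analysis.
From mathcomp Require Import measurable_realfun.
From mathcomp Require Import ring lra.

(** The theorem holds by the direct method: a minimizing sequence of paths has
    uniformly bounded masses, hence a weak limit; the cost is lower
    semicontinuous; and the continuity equation and the constraints survive the
    limit.

    Bounds. Tested with functions of time only, the continuity equation bounds
    the mass of rho by those of rho0 and zeta; finiteness of the cost bounds the
    masses of omega and zeta by a small multiple of the mass of rho plus a
    constant ([mass_bounds]). The same test functions show that the time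
    marginal of rho is absolutely continuous, and the cost transfers this to
    omega and zeta ([rho_null_in_time], [jordan_null_in_time]).

    Compactness. Measures on a compact set are encoded by the masses that they
    give to dyadic cells, indexed by words of bits. Limits of these masses along
    an ultrafilter are consistent, and a consistent family of masses is realised
    as the law of a random point: the interval [0, mass] is subdivided according
    to the masses, so that a uniform parameter selects a stream of bits
    ([weak_limit], [charge_weak_limit]).

    Lower semicontinuity. The integrand f_cost is a supremum of linear functions
    of (r, w, z), so that the cost is the supremum over bounded continuous fields
    (b, c) of dual values, each of which is weakly continuous
    ([dual_le_cost_fine], [wfr_cost_le]).

    Constraints. Any path of finite cost that solves the continuity equation
    disintegrates in time: apply the random point construction to the densities
    in time of the masses of the cells ([time_kernel_exists]). Disintegrations
    are unique up to null sets of times, since countably many cells determine a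
    measure ([disintegration_unique]). Hence a constraint at almost every time
    amounts to relations between integrals over space-time against continuous
    functions, one for each continuous psi of time with values in [0, 1]
    ([affine_ineqP], [affine_eqP]); these relations pass to the limit. *)


Set Implicit Arguments.
Unset Strict Implicit.
Unset Printing Implicit Defensive.
Import Order.TTheory GRing.Theory Num.Theory.
Import numFieldNormedType.Exports.
Local Open Scope classical_set_scope.
Local Open Scope ring_scope.


(** * Greedy binary expansions *)

Section greedy_digits.
Context {R : realType}.
Variable M : R.
Hypothesis M0 : 0 < M.

Definition digit_weight (j : nat) : R := M / 2 ^+ j.

Lemma digit_weight_gt0 j : 0 < digit_weight j.
Proof. by rewrite divr_gt0// exprn_gt0. Qed.

Lemma digit_weightS j : digit_weight j = digit_weight j.+1 + digit_weight j.+1.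
Proof.
have e : (2 : R) ^+ j != 0 by rewrite expf_neq0.
by rewrite /digit_weight exprS; field.
Qed.

Lemma digit_weight0 : digit_weight 0 = M.
Proof. by rewrite /digit_weight expr0 divr1. Qed.

Definition psum (b : nat -> bool) (J : nat) : R :=
  - M + \sum_(j < J) (b j)%:R * digit_weight j.

Lemma psumS b J : psum b J.+1 = psum b J + (b J)%:R * digit_weight J.
Proof. by rewrite /psum big_ord_recr /= addrA. Qed.

Lemma psum_le b J J' : (J <= J')%N ->
  psum b J <= psum b J' <= psum b J + 2 * digit_weight J - 2 * digit_weight J'.
Proof.
elim: J' => [|k IH]; first by rewrite leqn0 => /eqP ->; rewrite addrK lexx.
rewrite leq_eqVlt => /predU1P[->|]; first by rewrite addrK lexx.
rewrite ltnS => /IH /andP[h1 h2]; rewrite psumS.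
have := digit_weight_gt0 k.+1; have := digit_weightS k.
case: (b k); rewrite ?mul1r ?mul0r ?addr0 => e p; lra.
Qed.

(** Expansions start at - M, so that they cover all of [- M, M]. *)
Definition dec (b : nat -> bool) : R := limn (psum b).

Lemma psum_cvg b : psum b @ \oo --> dec b.
Proof.
apply: nondecreasing_is_cvgn.
  by move=> i j ij; have /andP[] := psum_le b ij.
exists (- M + 2 * M) => _ [J _ <-].
have /andP[_] := psum_le b (leq0n J).
have -> : psum b 0 = - M by rewrite /psum big_ord0 addr0.
by rewrite digit_weight0; have := digit_weight_gt0 J; lra.
Qed.

Lemma dec_bounds b J : psum b J <= dec b <= psum b J + 2 * digit_weight J.
Proof.
apply/andP; split.
  apply: limr_ge; first exact: psum_cvg.
  by exists J => //= k /= Jk; have /andP[] := psum_le b Jk.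
apply: limr_le; first exact: psum_cvg.
exists J => //= k /= Jk; have /andP[_] := psum_le b Jk.
by have := digit_weight_gt0 k; lra.
Qed.

Lemma dec_norm b : `|dec b| <= M.
Proof.
have := dec_bounds b 0; rewrite /psum big_ord0 addr0 digit_weight0.
by rewrite ler_norml; lra.
Qed.

(** What comes after J digits adds at most twice the weight of digit J. *)
Lemma dec_close b b' J : (forall j, (j < J)%N -> b j = b' j) ->
  `|dec b - dec b'| <= 2 * digit_weight J.
Proof.
move=> bb; have := dec_bounds b J; have := dec_bounds b' J.
have -> : psum b' J = psum b J.
  by congr (_ + _); apply: eq_bigr => i _; rewrite bb.
by rewrite ler_norml; lra.
Qed.

Lemma digit_weight_cvg0 : digit_weight @ \oo --> (0 : R).
Proof.
rewrite /digit_weight -(mulr0 M); apply: cvgMr.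
have -> : (fun j : nat => (2 ^+ j)^-1 : R) = (fun j => (2^-1) ^+ j).
  by apply/funext => j; rewrite exprVn.
by apply: cvg_expr; rewrite ger0_norm ?invr_ge0// invf_lt1// ltr1n.
Qed.

(** The partial sums of the greedy expansion of y: a digit is set whenever this does
    not overshoot y. Among all expansions of y, this one is measurable in y. *)
Fixpoint greedy (y : R) (j : nat) : R :=
  if j is k.+1 then
    if greedy y k + digit_weight k <= y then greedy y k + digit_weight k
    else greedy y k
  else - M.

Definition digit (y : R) (j : nat) : bool := greedy y j + digit_weight j <= y.

Lemma greedyE y j : greedy y j = psum (digit y) j.
Proof.
elim: j => [|j IH]; first by rewrite /psum big_ord0 addr0.
rewrite psumS -IH /= /digit; case: ifP => _; by rewrite ?mul1r ?mul0r ?addr0.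
Qed.

Lemma greedy_bounds y j : `|y| <= M ->
  greedy y j <= y <= greedy y j + 2 * digit_weight j.
Proof.
move=> yM; elim: j => [|j IH] /=.
  by move: yM; rewrite ler_norml digit_weight0; lra.
have e := digit_weightS j; move/andP: IH => [h1 h2].
by case: (leP (greedy y j + digit_weight j) y) => h; apply/andP; split; lra.
Qed.

Lemma dec_digit y : `|y| <= M -> dec (digit y) = y.
Proof.
move=> yM; apply/eqP; rewrite -subr_eq0 -normr_eq0 eq_le normr_ge0 andbT.
have c : (fun j => 2 * digit_weight j) @ \oo --> 2 * (0 : R).
  by apply: cvgMr; exact: digit_weight_cvg0.
rewrite mulr0 in c.
rewrite -(cvg_lim (@Rhausdorff R) c); apply: limr_ge; first by apply/cvg_ex; exists 0.
near=> j; have := dec_bounds (digit y) j; have := greedy_bounds j yM.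
by rewrite greedyE ler_norml; lra.
Unshelve. all: by end_near. Qed.

End greedy_digits.

(** * Borel sets and the distance to a closed set *)

Section borel.
Context {R : realType}.

Lemma measurable_open_mx m n (A : set 'M[R]_(m, n)) : open A -> measurable A.
Proof. by move=> oA; exact: sub_sigma_algebra. Qed.

Lemma measurable_preimage_open d (X : measurableType d) m n
    (f : X -> 'M[R]_(m, n)) :
  (forall A, open A -> measurable (f @^-1` A)) -> measurable_fun setT f.
Proof.
move=> fo; apply: (@measurability _ _ _ _ _ _ (@open 'M[R]_(m, n))) => //.
by move=> _ [A oA <-]; rewrite setTI; exact: fo.
Qed.


Lemma continuous_measurable_mx m n (f : 'M[R]_(m, n) -> R) :
  continuous f -> measurable_fun setT f.
Proof.
move=> cf; apply: (@measurability _ _ _ _ _ _ (@RGenOInfty.G R)).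
  exact: RGenOInfty.measurableE.
move=> _ [_ [a ->] <-]; rewrite setTI; apply: measurable_open_mx.
by apply: (continuousP f).1 => //; exact: interval_open.
Qed.

End borel.

Section clipped_distance.
Context {R : realType} {V : normedModType R}.
Variable C : set V.
Hypothesis clC : closed C.

Let S x : set R := 1 |` [set `|x - a| | a in C].

Let S_lb x : lbound (S x) 0.
Proof. by move=> _ [->//|[a _ <-]]. Qed.

Let S_hinf x : has_inf (S x).
Proof. by split; [exists 1; left|exists 0; exact: S_lb]. Qed.

(** Capped at 1, which also covers an empty set C. *)
Definition clipped_dist x : R := inf (S x).

Lemma clipped_dist_ge0 x : 0 <= clipped_dist x.
Proof. by apply: lb_le_inf; [exists 1; left|exact: S_lb]. Qed.

Lemma clipped_dist_le1 x : clipped_dist x <= 1.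
Proof. by apply: ge_inf; [exists 0; exact: S_lb|left]. Qed.

Let clipped_dist_lip x y : clipped_dist x <= clipped_dist y + `|x - y|.
Proof.
rewrite -lerBlDr; apply: lb_le_inf; first by exists 1; left.
move=> _ [->|[a Ca <-]]; rewrite lerBlDr.
  by rewrite (le_trans (clipped_dist_le1 x))// lerDl.
rewrite (@le_trans _ _ `|x - a|)//; last first.
  by rewrite [leRHS]addrC ler_distD.
by apply: ge_inf; [exists 0; exact: S_lb|right; exists a].
Qed.

Lemma clipped_dist_continuous : continuous clipped_dist.
Proof.
move=> x; apply/cvgrPdist_le => e e0; near=> y.
rewrite ler_norml; have := clipped_dist_lip x y; have := clipped_dist_lip y x.
have : `|x - y| <= e by near: y; apply: cvgr_dist_le => //; exact: cvg_id.
by rewrite (distrC y); lra.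
Unshelve. all: by end_near. Qed.

Lemma clipped_dist_eq0 x : clipped_dist x = 0 <-> C x.
Proof.
split=> [d0|Cx]; last first.
  apply/eqP; rewrite eq_le clipped_dist_ge0 andbT.
  apply: ge_inf; first by exists 0; exact: S_lb.
  by right; exists x => //; rewrite subrr normr0.
apply: clC => B /nbhs_ballP[e /= e0 eB].
have e10 : 0 < Num.min e 1 by rewrite lt_min e0 ltr01.
have : clipped_dist x < Num.min e 1 by rewrite d0.
move=> /(inf_lt (S_hinf x).1)[_ [->|[a Ca <-]]]; rewrite lt_min.
  by rewrite ltxx andbF.
move=> /andP[xae _]; exists a; split => //; apply: eB.
by rewrite -ball_normE /ball_ /=.
Qed.

End clipped_distance.

(** Open sets are positivity sets of continuous functions; this reduces measurability
    questions for vector-valued maps to real-valued ones. *)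
Lemma open_gt0 {R : realType} {V : normedModType R} (A : set V) : open A ->
  exists phi : V -> R, continuous phi /\ A = [set x | 0 < phi x].
Proof.
move=> oA; exists (clipped_dist (~` A)); split.
  exact: clipped_dist_continuous.
have cA : closed (~` A) by rewrite closedC.
apply/seteqP; split => x /=.
  move=> Ax; rewrite lt_neqAle clipped_dist_ge0 andbT eq_sym.
  by apply/eqP => /(clipped_dist_eq0 cA); exact.
move=> xp; apply: contrapT => nAx.
by have := (clipped_dist_eq0 cA x).2 nAx => /eqP; rewrite gt_eqF.
Qed.

Lemma measurable_fun_gt0 {R : realType} d (X : measurableType d) (f : X -> R) :
  measurable_fun setT f -> measurable [set x | 0 < f x].
Proof.
move=> mf; rewrite (_ : [set _ | _] = f @^-1` `]0, +oo[%classic).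
  by rewrite -[X in measurable X]setTI; exact: mf.
by apply/seteqP; split => x /=; rewrite in_itv/= andbT.
Qed.

(** Meant for approximations with countably many values, hence the quantification over
    arbitrary functions phi. *)
Lemma measurable_mx_cvg {R : realType} d (X : measurableType d) m n
    (f_ : nat -> X -> 'M[R]_(m, n)) (f : X -> 'M[R]_(m, n)) :
  (forall J (phi : 'M[R]_(m, n) -> R), measurable_fun setT (phi \o f_ J)) ->
  (forall x, f_ ^~ x @ \oo --> f x) -> measurable_fun setT f.
Proof.
move=> mf_ cf; apply: measurable_preimage_open => A /open_gt0[phi [cphi ->]].
apply: (@measurable_fun_gt0 _ _ _ (phi \o f)).
apply: (@measurable_fun_cvg _ _ _ _ (fun J => phi \o f_ J)) => //.
move=> x _; apply: continuous_cvg => //; exact: cphi.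
Qed.

(** * Coding points of space-time by streams of bits *)

Lemma row_norm_le {R : realType} n (v : 'rV[R]_n) (c : R) : 0 <= c ->
  (forall k, `|v ord0 k| <= c) -> `|v| <= c.
Proof.
move=> c0 vc; rewrite [leLHS]/Num.norm /= mx_normrE.
apply/bigmax_leP; split => // -[i k] _ /=; by rewrite (ord1 i).
Qed.

Lemma row_coord_le_norm {R : realType} n (v : 'rV[R]_n) k : `|v ord0 k| <= `|v|.
Proof.
by rewrite [leRHS]/Num.norm /= mx_normrE; apply/bigmax_geP; right; exists (ord0, k).
Qed.

Section finitely_valued.
Context d (X : measurableType d).

Lemma measurable_word (b : X -> nat -> bool) :
  (forall j, measurable [set x | b x j]) ->
  forall J w, measurable [set x | mkseq (b x) J = w].
Proof.
move=> mb; elim=> [|J IH] w.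
  rewrite (_ : [set _ | _] = [set x | [::] = w]); last by apply/seteqP; split.
  have [<-|nw] := pselect ([::] = w).
    by rewrite (_ : mkset _ = setT)//; apply/seteqP; split.
  by rewrite (_ : mkset _ = set0)//; apply/seteqP; split.
case/lastP: w => [|w c].
  rewrite (_ : mkset _ = set0)//; apply/seteqP; split => x //=.
rewrite (_ : mkset _ = [set x | mkseq (b x) J = w] `&` [set x | b x J = c]).
  apply: measurableI; first exact: IH.
  case: c; first exact: mb.
  rewrite (_ : mkset _ = ~` [set x | b x J]); first exact: measurableC.
  by apply/seteqP; split => x /=; [move=> ->|move/negP/negbTE].
apply/seteqP; split => x /=; rewrite mkseqS; last by move=> [-> ->].
by move=> /rcons_inj[].
Qed.

Lemma measurable_countably_valued (I : countType) d' (Y : measurableType d')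
    (c : X -> I) (F : I -> Y) :
  (forall i, measurable [set x | c x = i]) -> measurable_fun setT (F \o c).
Proof.
move=> mc _ A mA; rewrite setTI.
rewrite (_ : _ @^-1` _ = \bigcup_i (if F i \in A then [set x | c x = i] else set0)).
  apply: countable_bigcupT_measurable => // i.
  by case: ifP.
apply/seteqP; split => x /=.
  by move=> AF; exists (c x) => //; rewrite mem_set.
by move=> [i _]; case: ifP => //; rewrite inE => AFi /= xi; rewrite xi.
Qed.

End finitely_valued.

Section coding.
Context {R : realType} {n : nat}.
Local Notation T := (R * 'rV[R]_n)%type.
Variable M : R.
Hypothesis M0 : 0 < M.

(** Time is coordinate 0; beyond n the sequence is filled with zeros. *)
Definition coord (p : T) (i : nat) : R :=
  if i is k.+1 then (if insub k is Some k' then p.2 ord0 k' else 0) else p.1.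

Definition of_coords (y : nat -> R) : T := (y 0, \row_(k < n) y k.+1).

Definition box : set T := [set p : T | `|p.1| <= M /\ forall k, `|p.2 ord0 k| <= M].

(** The digits of the n + 1 coordinates are interleaved into one stream. *)
Definition bits_of_point (p : T) : nat -> bool :=
  fun j => digit M (coord p (j %% n.+1)) (j %/ n.+1).

Definition point_of_bits (S : nat -> bool) : T :=
  of_coords (fun i => dec M (fun l => S (l * n.+1 + i)%N)).

Lemma point_of_bits_box S : box (point_of_bits S).
Proof. by split => [|k]/=; rewrite ?mxE; exact: dec_norm. Qed.

Lemma bits_of_pointK p : box p -> point_of_bits (bits_of_point p) = p.
Proof.
move=> [p1 p2]; rewrite /point_of_bits /of_coords [RHS]surjective_pairing.
have cE i l : (i < n.+1)%N -> bits_of_point p (l * n.+1 + i) = digit M (coord p i) l.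
  by move=> iN; rewrite /bits_of_point modnMDl modn_small// divnMDl// divn_small// addn0.
congr pair.
  rewrite -[RHS](dec_digit M0 p1); congr dec; apply/funext => l.
  by rewrite cE.
apply/rowP => k; rewrite mxE -[RHS](dec_digit M0 (p2 k)); congr dec.
by apply/funext => l; rewrite cE ?ltnS// /coord valK.
Qed.

Lemma point_of_bits_close S S' J : (forall j, (j < J * n.+1)%N -> S j = S' j) ->
  `|point_of_bits S - point_of_bits S'| <= 2 * digit_weight M J.
Proof.
move=> SS; have c i : (i < n.+1)%N ->
    `|dec M (fun l => S (l * n.+1 + i)%N) - dec M (fun l => S' (l * n.+1 + i)%N)|
      <= 2 * digit_weight M J.
  move=> iN; apply: dec_close => // j jJ; apply: SS.
  by rewrite (@leq_trans (j.+1 * n.+1))// ?leq_mul2r// mulSn addnC ltn_add2r.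
rewrite prod_normE ge_max /= c//=; apply: row_norm_le.
  by rewrite mulr_ge0// ltW// digit_weight_gt0.
by move=> k; rewrite !mxE; apply: c; rewrite ltnS.
Qed.

Lemma box_compact : compact box.
Proof.
rewrite (_ : box = `[- M, M]%classic `*`
  [set v : 'rV[R]_n | forall k, `[- M, M]%classic (v ord0 k)]).
  apply: compact_setX; first exact: segment_compact.
  by apply: (@rV_compact R n (fun=> `[- M, M]%classic)) => _; exact: segment_compact.
apply/seteqP; split => p /= -[p1 p2].
  by split; [rewrite in_itv/= -ler_norml|move=> k; rewrite in_itv/= -ler_norml].
split; first by move: p1; rewrite in_itv/= -ler_norml.
by move=> k; have := p2 k; rewrite in_itv/= -ler_norml.
Qed.

(** A continuous function is uniformly continuous on the compact box, and a common
    prefix brings two decoded points close to each other. *)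
Lemma point_of_bits_uniform (phi : T -> R) (e : R) : continuous phi -> 0 < e ->
  exists J, forall S S', (forall j, (j < J)%N -> S j = S' j) ->
    `|phi (point_of_bits S) - phi (point_of_bits S')| <= e.
Proof.
move=> cphi e0.
have /compact_near_coveringP h := box_compact.
pose P (J : nat) (x : T) := forall y,
  `|x - y| <= 2 * digit_weight M J -> `|phi x - phi y| <= e.
have [x _|J _ hJ] := h nat \oo P _.
  have e20 : 0 < e / 2 by rewrite divr_gt0.
  have /cvgrPdist_le/(_ _ e20)/nbhs_ballP[r /= r0 hr] := cphi x.
  have r20 : 0 < r / 2 by rewrite divr_gt0.
  have /cvgrPdist_lt/(_ _ r20) : (fun j => 2 * digit_weight M j) @ \oo --> (0 : R).
    by rewrite -[X in _ --> X](mulr0 2); apply: cvgMr; exact: digit_weight_cvg0.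
  move=> [J0 _ hJ0].
  exists (ball x (r / 2), [set J | (J0 <= J)%N]).
    by split => /=; [exact: nbhsx_ballx|exists J0].
  move=> [x' J] [/= bx' /hJ0]; rewrite sub0r normrN => hJ y x'y.
  have bb z : `|x - z| < r -> `|phi x - phi z| <= e / 2.
    by move=> xz; apply: hr; rewrite -ball_normE.
  rewrite -ball_normE /= in bx'.
  have h1 : `|phi x - phi x'| <= e / 2 by apply: bb; rewrite (lt_le_trans bx')//; lra.
  have h2 : `|phi x - phi y| <= e / 2.
    apply: bb; rewrite (le_lt_trans (ler_distD x' _ _))//.
    have := le_lt_trans x'y (le_lt_trans (ler_norm _) hJ); lra.
  by rewrite (le_trans (ler_distD (phi x) _ _))// distrC; lra.
exists (J * n.+1)%N => S S' SS; apply: (hJ J) => /=.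
- by [].
- exact: point_of_bits_box.
- exact: point_of_bits_close.
Qed.

Definition word_point (w : seq bool) : T := point_of_bits (nth false w).

Lemma point_of_bits_word_uniform (phi : T -> R) (e : R) : continuous phi -> 0 < e ->
  exists J0, forall J S, (J0 <= J)%N ->
    `|phi (point_of_bits S) - phi (word_point (mkseq S J))| <= e.
Proof.
move=> cphi e0; have [J0 h] := point_of_bits_uniform cphi e0; exists J0 => J S JJ.
by apply: h => j jJ; rewrite nth_mkseq// (leq_trans jJ).
Qed.

Lemma measurable_coord i : measurable_fun setT (coord ^~ i).
Proof.
case: i => [|k]; first exact: measurable_fst.
rewrite /coord; case: insub => [k'|]; last exact: measurable_cst.
apply: (@measurableT_comp _ _ _ _ _ _ (fun v : 'rV[R]_n => v ord0 k')).
  by apply: continuous_measurable_mx; exact: coord_continuous.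
exact: measurable_snd.
Qed.

Lemma measurable_greedy j : measurable_fun setT (fun y => greedy M y j).
Proof.
elim: j => [|j IH] /=; first exact: measurable_cst.
apply: measurable_fun_ifT.
- apply: measurable_fun_ler; last exact: measurable_id.
  by apply: measurable_funD => //; exact: measurable_cst.
- by apply: measurable_funD => //; exact: measurable_cst.
- by [].
Qed.

Lemma measurable_bits_of_point j : measurable [set p | bits_of_point p j].
Proof.
have mc := measurable_coord (j %% n.+1).
rewrite /bits_of_point /digit.
have -> : [set p : T | greedy M (coord p (j %% n.+1)) (j %/ n.+1) + digit_weight M (j %/ n.+1) <= coord p (j %% n.+1)]
  = (fun p => greedy M (coord p (j %% n.+1)) (j %/ n.+1) + digit_weight M (j %/ n.+1) <= coord p (j %% n.+1)) @^-1` [set true].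
  by apply/seteqP; split.
rewrite -[X in measurable X]setTI; apply: measurable_fun_ler => //.
apply: measurable_funD; last exact: measurable_cst.
exact: (measurableT_comp (measurable_greedy _)).
Qed.

Lemma measurable_cell J w : measurable [set p | mkseq (bits_of_point p) J = w].
Proof. by apply: measurable_word; exact: measurable_bits_of_point. Qed.

Lemma measurable_box : measurable box.
Proof.
have mC i : measurable [set p | `|coord p i| <= M].
  rewrite (_ : mkset _ = (fun p => `|coord p i| <= M) @^-1` [set true]); last by apply/seteqP; split.
  rewrite -[X in measurable X]setTI; apply: measurable_fun_ler => //.
  apply: measurableT_comp => //; exact: measurable_coord.
rewrite (_ : box = \bigcap_i [set p | `|coord p i| <= M]).
  exact: bigcapT_measurable.
apply/seteqP; split => p /=.
  move=> [p1 p2] [|k] _ //=; case: insubP => //= _; by rewrite normr0 ltW.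
move=> h; split; first exact: (h 0%N).
by move=> k; have := h k.+1 I; rewrite /coord /= valK.
Qed.

(** Streams truncated at rank J take countably many values, and the points that they
    code converge. *)
Lemma measurable_point_of_bits d (X : measurableType d) (b : X -> nat -> bool) :
  (forall j, measurable [set x | b x j]) ->
  measurable_fun setT (fun x => point_of_bits (b x)).
Proof.
move=> mb.
have cv (phi : T -> R) x : continuous phi ->
    (fun J => phi (word_point (mkseq (b x) J))) @ \oo --> phi (point_of_bits (b x)).
  move=> cphi; apply/cvgrPdist_le => e e0.
  have [J0 h] := point_of_bits_word_uniform cphi e0.
  by exists J0 => // J /= JJ; exact: h.
have mr (Z : Type) d' (Y : measurableType d') (F : seq bool -> Y) J :
    measurable_fun setT (fun x => F (mkseq (b x) J)).
  apply: (@measurable_countably_valued _ _ _ _ _ (fun x => mkseq (b x) J) F).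
  exact: measurable_word.
apply: (@measurable_fun_pair _ _ _ _ _ _ (fun x => (point_of_bits (b x)).1)
  (fun x => (point_of_bits (b x)).2)).
- apply: (@measurable_fun_cvg _ _ _ _ (fun J x => (word_point (mkseq (b x) J)).1)).
    by move=> J; apply: (mr T _ _ (fun w => (word_point w).1)).
  by move=> x _; apply: cv => p; exact: cvg_fst.
- apply: (@measurable_mx_cvg _ _ _ _ _ (fun J x => (word_point (mkseq (b x) J)).2)).
    by move=> J phi; apply: (mr T _ _ (fun w => phi (word_point w).2)).
  move=> x; apply/cvgrPdist_le => e e0.
  have := cv (fun p => `|p.2 - (point_of_bits (b x)).2|) x.
  rewrite subrr normr0 => /(_ _)/cvgrPdist_le h.
  have {h}/h /(_ _ e0) : continuous (fun p : T => `|p.2 - (point_of_bits (b x)).2|).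
    move=> p; apply: cvg_norm; apply: cvgB; [exact: cvg_snd|exact: cvg_cst].
  by apply: filterS => J /=; rewrite sub0r normrN normr_id distrC.
Qed.

End coding.

(** * Bounded measurable functions *)

(** The integrands used throughout: a finite measure integrates all of them. *)
Definition bounded_mfun d (X : measurableType d) (R : realType) (D : set X)
    (f : X -> R) : Prop :=
  measurable_fun D f /\ exists C, forall x, D x -> `|f x| <= C.

Section bounded_mfun.
Context d (X : measurableType d) (R : realType) (D : set X).
Implicit Types f g : X -> R.
Local Notation bmf := (bounded_mfun D).

Lemma bmf_cst (c : R) : bmf (cst c).
Proof. by split; [exact: measurable_cst|exists `|c|]. Qed.

Lemma bmfD f g : bmf f -> bmf g -> bmf (fun x => f x + g x).
Proof.
move=> [mf [a fa]] [mg [b gb]]; split; first exact: measurable_funD.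
by exists (a + b) => x Dx; rewrite (le_trans (ler_normD _ _))// lerD// (fa, gb).
Qed.

Lemma bmfM f g : bmf f -> bmf g -> bmf (fun x => f x * g x).
Proof.
move=> [mf [a fa]] [mg [b gb]]; split; first exact: measurable_funM.
by exists (a * b) => x Dx; rewrite normrM ler_pM// (fa, gb).
Qed.

Lemma bmfZ (c : R) f : bmf f -> bmf (fun x => c * f x).
Proof. by move=> bf; apply: bmfM => //; exact: bmf_cst. Qed.

Lemma bmfN f : bmf f -> bmf (fun x => - f x).
Proof.
move=> [mf [a fa]]; split; first exact: measurableT_comp.
by exists a => x Dx; rewrite normrN fa.
Qed.

Lemma bmfB f g : bmf f -> bmf g -> bmf (fun x => f x - g x).
Proof. by move=> bf bg; apply: bmfD => //; exact: bmfN. Qed.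

Lemma bmf_norm f : bmf f -> bmf (fun x => `|f x|).
Proof.
move=> [mf [a fa]]; split; first exact: measurableT_comp.
by exists a => x Dx; rewrite normr_id fa.
Qed.

Lemma bmfX f k : bmf f -> bmf (fun x => f x ^+ k).
Proof.
move=> bf; elim: k => [|k IH].
  by under eq_fun do rewrite expr0; exact: bmf_cst.
by under eq_fun do rewrite exprS; exact: bmfM.
Qed.

Lemma bmf_sum (I : Type) (s : seq I) (P : pred I) (f : I -> X -> R) :
  (forall i, bmf (f i)) -> bmf (fun x => \sum_(i <- s | P i) f i x).
Proof.
move=> bf; elim: s => [|i s IH].
  by under eq_fun do rewrite big_nil; exact: bmf_cst.
under eq_fun do rewrite big_cons.
by case: (P i) => //; exact: bmfD.
Qed.

Lemma bmf_indic (A : set X) : measurable A -> bmf (\1_A : X -> R).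
Proof.
move=> mA; split; first exact: measurable_indic.
by exists 1 => x _; rewrite indicE; case: (_ \in _); rewrite ?normr1 ?normr0.
Qed.

Lemma eq_bmf f g : (forall x, D x -> f x = g x) -> bmf f -> bmf g.
Proof.
move=> fg [mf [a fa]]; split.
  by apply: eq_measurable_fun mf => x; rewrite inE => /fg.
by exists a => x Dx; rewrite -fg// fa.
Qed.

End bounded_mfun.

Lemma bmfS d (X : measurableType d) (R : realType) (D E : set X) (f : X -> R) :
  measurable E -> D `<=` E -> bounded_mfun E f -> bounded_mfun D f.
Proof.
move=> mE DE [mf [a fa]]; split; first exact: measurable_funS mf.
by exists a => x /DE /fa.
Qed.

Section Rintegral_complements.
Context d (X : measurableType d) (R : realType) (mu : {measure set X -> \bar R}).
Variable D : set X.
Hypotheses (mD : measurable D) (muD : (mu D < +oo)%E).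
Implicit Types f g : X -> R.
Local Notation bmf := (bounded_mfun D).

Lemma bmf_integrable f : bmf f -> mu.-integrable D (EFin \o f).
Proof.
move=> [mf [a fa]]; apply: measurable_bounded_integrable => //.
by exists a; split; [exact: num_real|move=> b ab x /fa h; exact: le_trans h (ltW ab)].
Qed.

Lemma Rintegral_sum (I : Type) (s : seq I) (P : pred I) (f : I -> X -> R) :
  (forall i, mu.-integrable D (EFin \o f i)) ->
  \int[mu]_(x in D) (\sum_(i <- s | P i) f i x) =
  \sum_(i <- s | P i) \int[mu]_(x in D) f i x.
Proof.
move=> fi; elim: s => [|i s IH].
  by under eq_Rintegral do rewrite big_nil; rewrite big_nil Rintegral_cst// mul0r.
rewrite big_cons -IH; under eq_Rintegral do rewrite big_cons.
case: (P i) => //; rewrite RintegralD//.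
apply: (eq_integrable mD (fun x => (\sum_(i <- s | P i) (f i x)%:E)%E)).
  by move=> x _ /=; rewrite sumEFin.
by apply: integrable_sum => // k _; exact: fi.
Qed.

Lemma Rintegral_indic (A : set X) : measurable A ->
  \int[mu]_(x in D) (\1_A x) = fine (mu (A `&` D)).
Proof. by move=> mA; rewrite /Rintegral integral_indic. Qed.

Lemma le_Rintegral_dist f g (e : R) : bmf f -> bmf g ->
  (forall x, D x -> `|f x - g x| <= e) ->
  `|\int[mu]_(x in D) f x - \int[mu]_(x in D) g x| <= e * fine (mu D).
Proof.
move=> bf bg fge; rewrite -RintegralB//; try exact: bmf_integrable.
have bfg := bmfB bf bg.
rewrite (le_trans (le_normr_Rintegral _ _))//; first exact: bmf_integrable.
rewrite -Rintegral_cst//; apply: le_Rintegral => //; apply: bmf_integrable.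
  exact: bmf_norm.
exact: bmf_cst.
Qed.

End Rintegral_complements.

(** * Trees of sets, and weights on words realised by intervals *)

Section word_integral.
Context d (X : measurableType d) (R : realType) (mu : {measure set X -> \bar R}).
Variable D : set X.
Hypotheses (mD : measurable D) (muD : (mu D < +oo)%E).

Lemma sum_words (J : nat) (s : seq bool) (G : seq bool -> R) : size s = J ->
  G s = \sum_(w : J.-tuple bool) G w * (s == w :> seq bool)%:R.
Proof.
move=> sJ; have /eqP sJ' := sJ.
rewrite (bigD1 (Tuple sJ')) //= eqxx mulr1 big1 ?addr0// => w nw.
case: eqP => [sw|_]; last by rewrite mulr0.
by case/negP: nw; apply/eqP; exact/val_inj.
Qed.

(** Words of a given length being finitely many, an integral that sees x only through
    its word is a finite sum. *)
Lemma Rintegral_word (c : X -> seq bool) (J : nat) (F : seq bool -> R) :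
  (forall w, measurable [set x | c x = w]) ->
  (forall x, D x -> size (c x) = J) ->
  \int[mu]_(x in D) F (c x) =
  \sum_(w : J.-tuple bool) F w * fine (mu ([set x | c x = w] `&` D)).
Proof.
move=> mc cJ.
have bi w : bounded_mfun D (\1_[set x | c x = w] : X -> R).
  exact: bmf_indic.
rewrite (@eq_Rintegral _ _ _ _ _ (fun x => \sum_(w : J.-tuple bool) F w * \1_[set x | c x = w] x)).
  rewrite Rintegral_sum//; last by move=> w; apply: bmf_integrable => //; exact: bmfZ.
  apply: eq_bigr => w _; rewrite RintegralZl//; last exact: bmf_integrable.
  by rewrite Rintegral_indic.
move=> x; rewrite inE => Dx; rewrite (sum_words _ (cJ x Dx)).
apply: eq_bigr => w _; rewrite indicE; congr (_ * _).
congr (nat_of_bool _)%:R; apply/idP/idP; first by move=> /eqP ?; rewrite inE.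
by rewrite inE => /eqP.
Qed.

Lemma bmf_word (c : X -> seq bool) (J : nat) (F : seq bool -> R) :
  (forall w, measurable [set x | c x = w]) ->
  (forall x, D x -> size (c x) = J) ->
  bounded_mfun D (fun x => F (c x)).
Proof.
move=> mc cJ.
apply: (@eq_bmf _ _ _ _ (fun x => \sum_(w : J.-tuple bool) F w * \1_[set x | c x = w] x)).
  move=> x Dx; rewrite [RHS](sum_words _ (cJ x Dx)).
  apply: eq_bigr => w _; rewrite indicE; congr (_ * _).
  congr (nat_of_bool _)%:R; apply/idP/idP; first by rewrite inE => /eqP.
  by move=> /eqP ?; rewrite inE.
by apply: bmf_sum => w; apply: bmfZ; exact: bmf_indic.
Qed.

End word_integral.

Section tree.
Context {X : Type}.
Variable Z : seq bool -> set X.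
Hypothesis ZU : forall w, Z w = Z (rcons w false) `|` Z (rcons w true).
Hypothesis ZI : forall w, Z (rcons w false) `&` Z (rcons w true) = set0.

(** For a point of the root this is the branch of the tree that contains it. Its bits
    are defined separately, without recursion, which makes their measurability
    immediate. *)
Definition tree_path (x : X) : nat -> bool :=
  fun j => `[< exists2 w, size w = j & Z (rcons w true) x >].

Lemma tree_sub w b : Z (rcons w b) `<=` Z w.
Proof. by move=> x Zx; rewrite ZU; case: b Zx; [right|left]. Qed.

Lemma tree_inj w w' x : size w = size w' -> Z w x -> Z w' x -> w = w'.
Proof.
elim/last_ind: w w' => [|w b IH] w'; first by move=> /esym/size0nil ->.
case/lastP: w' => [|w' b']; first by rewrite size_rcons.
rewrite !size_rcons => -[sw] Zw Zw'.
have ww' : w = w' by apply: IH => //; [exact: tree_sub Zw|exact: tree_sub Zw'].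
subst w'; congr rcons; case: b b' Zw Zw' => -[] // h1 h2.
  by suff : (Z (rcons w false) `&` Z (rcons w true)) x by rewrite ZI.
by suff : (Z (rcons w false) `&` Z (rcons w true)) x by rewrite ZI.
Qed.

Lemma tree_path_in x J : Z [::] x -> Z (mkseq (tree_path x) J) x.
Proof.
move=> Zx; elim: J => [|J IH]//; rewrite mkseqS.
rewrite {2}/tree_path; case: asboolP => [[w sw Zw]|nw].
  rewrite (_ : mkseq _ _ = w)//; apply: (@tree_inj _ _ x) => //.
    by rewrite size_mkseq.
  exact: tree_sub Zw.
move: IH; rewrite {1}ZU => -[//|h]; exfalso; apply: nw.
by exists (mkseq (tree_path x) J) => //; rewrite size_mkseq.
Qed.

Lemma tree_pathP x w : Z [::] x -> mkseq (tree_path x) (size w) = w <-> Z w x.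
Proof.
move=> Zx; split=> [<-|Zw]; first exact: tree_path_in.
by apply: (@tree_inj _ _ x) => //; [rewrite size_mkseq|exact: tree_path_in].
Qed.

End tree.

Lemma measurable_tree_path d (X : measurableType d) (Z : seq bool -> set X) :
  (forall w, measurable (Z w)) ->
  forall j, measurable [set x | tree_path Z x j].
Proof.
move=> mZ j; rewrite (_ : mkset _ =
    \bigcup_w (if size w == j then Z (rcons w true) else set0)).
  by apply: countable_bigcupT_measurable => // w; case: ifP.
apply/seteqP; split => x /=.
  by move=> /asboolP[w /eqP sw Zw]; exists w => //; rewrite sw.
by move=> [w _]; case: ifPn => // /eqP sw Zw; apply/asboolP; exists w.
Qed.

(** A consistent family of weights on words, measurable in t, is realised by
    subdividing the interval [0, m t [::][ again and again, in proportion to the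
    weights. *)
Section interval_tree.
Context {R : realType}.
Variable m : R -> seq bool -> R.
Hypothesis m_ge0 : forall t w, 0 <= m t w.
Hypothesis m_rcons : forall t w,
  m t w = m t (rcons w false) + m t (rcons w true).
Hypothesis m_meas : forall w, measurable_fun setT (m ^~ w).

(** Words grow at their end, hence a recursion on reversed words. *)
Fixpoint left_end_rev (t : R) (v : seq bool) : R :=
  if v is b :: v' then
    left_end_rev t v' + (if b then m t (rcons (rev v') false) else 0)
  else 0.

Definition left_end t w := left_end_rev t (rev w).

Lemma left_end_rcons t w b : left_end t (rcons w b) =
  left_end t w + (if b then m t (rcons w false) else 0).
Proof. by rewrite /left_end rev_rcons /= revK. Qed.

Definition itree (w : seq bool) : set (R * R) :=
  [set p | left_end p.1 w <= p.2 < left_end p.1 w + m p.1 w].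

Lemma itreeU w : itree w = itree (rcons w false) `|` itree (rcons w true).
Proof.
apply/seteqP; split => -[t s]; rewrite /itree /= !left_end_rcons addr0.
  move=> /andP[h1]; rewrite m_rcons => h2.
  have [h|h] := ltP s (left_end t w + m t (rcons w false)); [left|right].
    by apply/andP; split; lra.
  by apply/andP; split; lra.
have := m_ge0 t (rcons w false); have := m_ge0 t (rcons w true).
by have := m_rcons t w => e h0 h1 [] /andP[h2 h3]; apply/andP; split; lra.
Qed.

Lemma itreeI w : itree (rcons w false) `&` itree (rcons w true) = set0.
Proof.
apply/seteqP; split => -[t s] //; rewrite /itree /= !left_end_rcons addr0.
by move=> [/andP[_ h1] /andP[h2 _]]; lra.
Qed.

Lemma measurable_left_end w : measurable_fun setT (left_end ^~ w).
Proof.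
rewrite /left_end; elim: (rev w) => [|b v IH] /=; first exact: measurable_cst.
apply: measurable_funD => //; case: b => //; exact: measurable_cst.
Qed.

Lemma measurable_itree w : measurable (itree w).
Proof.
have ml : measurable_fun setT (fun p : R * R => left_end p.1 w).
  by apply: (measurableT_comp (measurable_left_end w)); exact: measurable_fst.
have mm : measurable_fun setT (fun p : R * R => m p.1 w).
  by apply: (measurableT_comp (m_meas w)); exact: measurable_fst.
rewrite (_ : itree w = (fun p : R * R => (left_end p.1 w <= p.2) &&
    (p.2 < left_end p.1 w + m p.1 w)) @^-1` [set true]); last by apply/seteqP; split.
rewrite -[X in measurable X]setTI; apply: measurable_and => //.
  by apply: measurable_fun_ler => //; exact: measurable_snd.
apply: measurable_fun_ltr; first exact: measurable_snd.
exact: measurable_funD.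
Qed.

Local Notation mu := (@lebesgue_measure R).
Local Notation I_ t := (`[0, m t [::][%classic).

Definition ipath (p : R * R) : nat -> bool := tree_path itree p.

Lemma measurable_ipath j : measurable [set p | ipath p j].
Proof. by apply: measurable_tree_path; exact: measurable_itree. Qed.

Lemma measurable_ipath2 t j : measurable [set s | ipath (t, s) j].
Proof.
have mt : measurable_fun setT (fun s : R => (t, s)) by exact: measurable_pair1.
by have := mt measurableT _ (measurable_ipath j); rewrite setTI.
Qed.

Lemma itree_nil t s : itree [::] (t, s) = I_ t s.
Proof. by rewrite /itree /left_end /= add0r in_itv. Qed.

(** The parameters whose branch starts with w form the interval attached to w. *)
Lemma lebesgue_cell t w :
  mu ([set s | mkseq (ipath (t, s)) (size w) = w] `&` I_ t) = (m t w)%:E.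
Proof.
rewrite (_ : _ `&` _ = `[left_end t w, left_end t w + m t w[%classic).
  rewrite lebesgue_measure_itv/= lte_fin; case: ltP => h.
    by rewrite -EFinB addrAC subrr add0r.
  by congr EFin; apply/eqP; rewrite eq_le m_ge0; lra.
have e s : `[left_end t w, left_end t w + m t w[%classic s = itree w (t, s).
  by rewrite /= in_itv.
apply/seteqP; split => s; rewrite e.
  by move=> [hw]; rewrite -itree_nil => h; apply/(tree_pathP itreeU itreeI _ h).
move=> h; have h0 : itree [::] (t, s).
  elim/last_ind: w h {e} => // w b IH h.
  by apply: IH; exact: (tree_sub itreeU h).
split; last by rewrite -itree_nil.
by apply/(tree_pathP itreeU itreeI _ h0).
Qed.

Lemma lebesgue_I_lty t : (mu (I_ t) < +oo)%E.
Proof. by rewrite lebesgue_measure_itv/=; case: ifP; rewrite ?ltry// -EFinB ltry. Qed.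

Lemma Rintegral_ipath t J (F : seq bool -> R) :
  \int[mu]_(s in I_ t) F (mkseq (ipath (t, s)) J) =
  \sum_(w : J.-tuple bool) F w * m t w.
Proof.
have -> : \sum_(w : J.-tuple bool) F w * m t w =
    \sum_(w : J.-tuple bool) F w *
      fine (mu ([set s | mkseq (ipath (t, s)) J = w] `&` I_ t)).
  by move=> *; apply: eq_bigr => w _; have := lebesgue_cell t w; rewrite size_tuple => ->.
apply: (@Rintegral_word _ _ _ mu (I_ t) _ _ (fun s => mkseq (ipath (t, s)) J)) => //.
- exact: lebesgue_I_lty.
- by apply: measurable_word => j; exact: measurable_ipath2.
- by move=> s _; rewrite size_mkseq.
Qed.

End interval_tree.

(** * Borel sets of space-time and density of continuous functions *)

Section bounded_convergence.
Context d (X : measurableType d) (R : realType) (mu : {measure set X -> \bar R}).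
Variable D : set X.
Hypotheses (mD : measurable D) (muD : (mu D < +oo)%E).

Lemma Rintegral_bounded_cvg (f_ : nat -> X -> R) (f : X -> R) (C : R) :
  (forall k, measurable_fun D (f_ k)) ->
  (forall k x, D x -> `|f_ k x| <= C) ->
  (forall x, D x -> f_ ^~ x @ \oo --> f x) ->
  (fun k => \int[mu]_(x in D) f_ k x) @ \oo --> \int[mu]_(x in D) f x.
Proof.
move=> mf_ f_C cf.
have mf : measurable_fun D f by exact: measurable_fun_cvg mf_ cf.
have fC x : D x -> `|f x| <= C.
  move=> Dx; have := cf x Dx => /cvg_norm /(cvg_lim (@Rhausdorff R)) <-.
  by apply: limr_le; [apply/cvg_ex; eexists; apply: cvg_norm; exact: cf|near=> k; exact: f_C].
have bf k : bounded_mfun D (f_ k) by split => //; exists C; exact: f_C.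
have bbf : bounded_mfun D f by split => //; exists C.
have fin g : bounded_mfun D g -> (\int[mu]_(x in D) (g x)%:E)%E \is a fin_num.
  by move=> bg; apply: integrable_fin_num => //; exact: bmf_integrable.
apply: fine_cvg; rewrite fineK; last exact: fin.
apply: (@dominated_cvg _ _ _ mu D mD (fun k => EFin \o f_ k) _ (fun=> C%:E)) => //.
- by move=> k; exact/measurable_EFinP.
- by move=> x Dx; apply: cvg_EFin; [exact: nearW|exact: cf].
- by apply: (bmf_integrable mD muD); exact: bmf_cst.
Unshelve. all: by end_near. Qed.

End bounded_convergence.

Section space_time.
Context {R : realType} {n : nat}.
Local Notation T := (R * 'rV[R]_n)%type.

Lemma word_point_cvg (M : R) (M0 : 0 < M) (phi : T -> R) (S : nat -> bool) :
  continuous phi ->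
  (fun J => phi (word_point M (mkseq S J))) @ \oo --> phi (point_of_bits M S).
Proof.
move=> cphi; apply/cvgrPdist_le => e e0.
have [J0 h] := point_of_bits_word_uniform M0 cphi e0.
by exists J0 => // J /= JJ; exact: h.
Qed.

Lemma eventually_box (p : T) : \forall k \near \oo, box k.+1%:R p.
Proof.
near=> k; have pk : `|p| <= k.+1%:R.
  by rewrite ltW// (@lt_trans _ _ k%:R) ?ltr_nat//; near: k; exact: nbhs_infty_gtr.
split.
  by apply: le_trans pk; rewrite prod_normE le_max lexx.
move=> i; apply: (le_trans (row_coord_le_norm _ _)).
by apply: le_trans pk; rewrite prod_normE le_max lexx orbT.
Unshelve. all: by end_near. Qed.

(** A continuous function is the pointwise limit of its values at the points coded by
    truncated streams of bits, and these approximations are countably valued. *)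
Lemma continuous_measurable_prod (phi : T -> R) :
  continuous phi -> measurable_fun setT phi.
Proof.
move=> cphi; have k0 k : (0 : R) < k.+1%:R by [].
apply: (@measurable_fun_cvg _ _ _ _ (fun k p => phi (point_of_bits k.+1%:R (bits_of_point k.+1%:R p)))).
  move=> k; apply: (@measurable_fun_cvg _ _ _ _
    (fun J p => phi (word_point k.+1%:R (mkseq (bits_of_point k.+1%:R p) J)))).
    move=> J; apply: (@measurable_countably_valued _ _ _ _ _
      (fun p => mkseq (bits_of_point k.+1%:R p) J) (fun w => phi (word_point k.+1%:R w))).
    exact: measurable_cell.
  by move=> p _; exact: word_point_cvg.
move=> p _; apply/cvgrPdist_le => e e0; near=> k.
rewrite bits_of_pointK//; first by rewrite subrr normr0 ltW.
by near: k; exact: eventually_box.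
Unshelve. all: by end_near. Qed.

Lemma measurable_prod_open_sub (A : set T) : measurable A -> <<s @open T >> A.
Proof.
have sig (U : Type) (f : T -> U) (G : set (set U)) :
    (forall B, G B -> <<s @open T >> (f @^-1` B)) ->
    forall B, <<s G >> B -> <<s @open T >> (f @^-1` B).
  move=> GG; apply: (@smallest_sub _ _ _ [set B | <<s @open T >> (f @^-1` B)]) => //.
  split=> [|C|F] /=.
  - by rewrite preimage_set0; exact: sigma_algebra0.
  - by move=> fC; rewrite setTD preimage_setC -setTD; apply: sigma_algebraCD.
  - by move=> fF; rewrite preimage_bigcup; exact: sigma_algebra_bigcup.
apply: smallest_sub; first exact: smallest_sigma_algebra.
move=> B [[C mC <-]|[C mC <-]]; rewrite setTI.
- apply: (sig _ fst (@RGenOpens.G R)); last first.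
    have E : @measurable _ R = <<s @RGenOpens.G R >> := RGenOpens.measurableE R.
    by rewrite -E; exact: mC.
  move=> _ [x [y ->]]; apply: sub_sigma_algebra.
  by apply: (continuousP _).1; [move=> ?; exact: cvg_fst|exact: interval_open].
- apply: (sig _ snd (@open 'rV[R]_n)) => // D oD; apply: sub_sigma_algebra.
  by apply: (continuousP _).1 => // ?; exact: cvg_snd.
Qed.

Lemma open_measurable_prod (A : set T) : open A -> measurable A.
Proof.
move=> /open_gt0[phi [cphi ->]]; apply: measurable_fun_gt0.
exact: continuous_measurable_prod.
Qed.

Lemma closed_measurable_prod (A : set T) : closed A -> measurable A.
Proof. by move/closed_openC/open_measurable_prod/measurableC; rewrite setCK. Qed.

Lemma continuous_bmf (phi : T -> R) (C : R) (D : set T) : measurable D ->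
  continuous phi -> (forall p, D p -> `|phi p| <= C) -> bounded_mfun D phi.
Proof.
move=> mD cphi phiC; split; last by exists C.
by apply: measurable_funTS; exact: continuous_measurable_prod.
Qed.

Lemma dist_maxr (a b c d : R) :
  `|Num.max a b - Num.max c d| <= `|a - c| + `|b - d|.
Proof.
have := ler_norm (a - c); have := ler_norm (b - d).
have := ler_norm (c - a); have := ler_norm (d - b).
rewrite (distrC c) (distrC d) ler_norml.
have := normr_ge0 (a - c); have := normr_ge0 (b - d).
by case: (leP a b); case: (leP c d) => *; apply/andP; split; lra.
Qed.

Section density.
Variables (lambda : {measure set T -> \bar R}) (K : set T).
Hypotheses (mK : measurable K) (lamK : (lambda K < +oo)%E).

(** Approximation in the mean by continuous functions with the same bounds 0 and 1.
    Uniform bounds make this property stable under pointwise limits. *)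
Definition unit_approximable (f : T -> R) : Prop := forall e : R, 0 < e ->
  exists phi : T -> R, [/\ continuous phi, (forall p, 0 <= phi p <= 1) &
    \int[lambda]_(p in K) `|f p - phi p| <= e].

Let unit_bmf (f : T -> R) : measurable_fun K f -> (forall p, 0 <= f p <= 1) ->
  bounded_mfun K f.
Proof.
move=> mf f01; split => //; exists 1 => p _; have /andP[f0 f1] := f01 p.
by rewrite ger0_norm.
Qed.

Let cont_bmf (phi : T -> R) : continuous phi -> (forall p, 0 <= phi p <= 1) ->
  bounded_mfun K phi.
Proof.
move=> cphi p01; apply: unit_bmf => //.
by apply: measurable_funTS; exact: continuous_measurable_prod.
Qed.

Let approx_cvg (f_ : nat -> T -> R) (f : T -> R) :
  (forall k, measurable_fun K (f_ k)) -> (forall k p, 0 <= f_ k p <= 1) ->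
  (forall p, 0 <= f p <= 1) ->
  (forall p, f_ ^~ p @ \oo --> f p) ->
  (forall k, unit_approximable (f_ k)) -> unit_approximable f.
Proof.
move=> mf_ f_01 f01 cf af_ e e0.
have e20 : 0 < e / 2 by rewrite divr_gt0.
have mf : measurable_fun K f by exact: measurable_fun_cvg.
have : (fun k => \int[lambda]_(p in K) `|f p - f_ k p|) @ \oo -->
    \int[lambda]_(p in K) (0 : R).
  apply: (@Rintegral_bounded_cvg _ _ _ _ _ mK lamK (fun k p => `|f p - f_ k p|) _ 1).
  - by move=> k; apply: measurableT_comp => //; exact: measurable_funB.
  - move=> k p _; rewrite normr_id ler_norml.
    by have /andP[? ?] := f_01 k p; have /andP[? ?] := f01 p; apply/andP; split; lra.
  - move=> p _; rewrite -[X in _ --> X](@normr0 R R) -(subrr (f p)).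
    by apply: cvg_norm; apply: cvgB; [exact: cvg_cst|exact: cf].
rewrite Rintegral_cst// mul0r => /cvgrPdist_le/(_ _ e20)[k _ hk].
have [phi [cphi p01 hphi]] := af_ k _ e20.
exists phi; split => //.
have bf := unit_bmf mf f01; have bfk := unit_bmf (mf_ k) (f_01 k).
have bp := cont_bmf cphi p01.
have := hk k (leqnn k); rewrite sub0r normrN => hk'.
have {}hk' := le_trans (ler_norm _) hk'.
apply: (@le_trans _ _ (\int[lambda]_(p in K) (`|f p - f_ k p| + `|f_ k p - phi p|))).
  apply: le_Rintegral => //.
  - by apply: bmf_integrable => //; apply: bmf_norm; exact: bmfB.
  - by apply: bmf_integrable => //; apply: bmfD; apply: bmf_norm; exact: bmfB.
  - by move=> p _; exact: ler_distD.
rewrite RintegralD//; last 2 first.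
- by apply: bmf_integrable => //; apply: bmf_norm; exact: bmfB.
- by apply: bmf_integrable => //; apply: bmf_norm; exact: bmfB.
by rewrite (le_trans (lerD hk' hphi))//; lra.
Qed.

Let approx_continuous (phi : T -> R) : continuous phi ->
  (forall p, 0 <= phi p <= 1) -> unit_approximable phi.
Proof.
move=> cphi p01 e e0; exists phi; split => //.
under eq_Rintegral do rewrite subrr normr0.
by rewrite Rintegral_cst// mul0r ltW.
Qed.

Let indic01 (A : set T) p : 0 <= (\1_A p : R) <= 1.
Proof. by rewrite indicE; case: (_ \in _); rewrite /= ?lexx ?ler01. Qed.

Let approx_open (A : set T) : open A -> unit_approximable (\1_A).
Proof.
move=> oA; have cA : closed (~` A) by rewrite closedC.
pose dA := clipped_dist (~` A).
have dA0 p := clipped_dist_ge0 (~` A) p.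
pose g (k : nat) (p : T) : R := Num.min 1 (k%:R * dA p).
have g01 k p : 0 <= g k p <= 1.
  by rewrite /g ge_min lexx /= le_min ler01 mulr_ge0.
have cg k : continuous (g k).
  move=> p; apply: (@continuous_min R T (cst 1) (fun p => k%:R * dA p) p); first exact: cvg_cst.
  by apply: cvgM; [exact: cvg_cst|exact: clipped_dist_continuous].
apply: (@approx_cvg g) => //.
- by move=> k; apply: measurable_funTS; exact: continuous_measurable_prod.
- move=> p; rewrite indicE; case: (boolP (p \in A)) => pA.
    have d0 : 0 < dA p.
      rewrite lt_neqAle dA0 andbT eq_sym; apply/eqP => /(clipped_dist_eq0 cA).
      by apply; rewrite inE in pA.
    apply/cvgrPdist_le => e e0; near=> k.
    have -> : g k p = 1.
      apply: min_l; rewrite -ler_pdivrMr// mul1r ltW//.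
      by near: k; exact: nbhs_infty_gtr.
    by rewrite subrr normr0 ltW.
  have d0 : dA p = 0 by apply/(clipped_dist_eq0 cA); move: pA; rewrite notin_setE.
  rewrite /g d0; under eq_fun do rewrite mulr0 min_r//.
  exact: cvg_cst.
- by move=> k; exact: approx_continuous.
Unshelve. all: by end_near. Qed.

(** The sets with an approximable indicator form a sigma-algebra, and it contains the
    open sets, whose indicators are increasing limits of continuous functions. *)
Lemma unit_approximable_indic (A : set T) : measurable A ->
  unit_approximable (\1_A).
Proof.
move=> mA; have {}mA' := measurable_prod_open_sub mA; move: A mA' {mA}.
have mo : <<s @open T >> `<=` measurable.
  apply: smallest_sub; last by move=> ?; exact: open_measurable_prod.
  split; [exact: measurable0|move=> B mB; rewrite setTD; exact: measurableC|].
  by move=> F mF; exact: bigcupT_measurable.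
suff : <<s @open T >> `<=` [set A | measurable A /\ unit_approximable (\1_A)].
  by move=> h A /h[].
apply: smallest_sub; last by move=> A oA; split; [exact: open_measurable_prod|exact: approx_open].
have aU (A B : set T) : measurable A -> measurable B ->
    unit_approximable (\1_A) -> unit_approximable (\1_B) ->
    unit_approximable (\1_(A `|` B)).
  move=> mA mB aA aB e e0; have e20 : 0 < e / 2 by rewrite divr_gt0.
  have [phi [cphi p01 hphi]] := aA _ e20; have [psi [cpsi q01 hpsi]] := aB _ e20.
  exists (fun p => Num.max (phi p) (psi p)); split.
  - by move=> p; apply: (@continuous_max R T phi psi p); [exact: cphi|exact: cpsi].
  - by move=> p; rewrite le_max ge_max; have /andP[-> ->] := p01 p; have /andP[_ ->] := q01 p.
  have bA := bmf_indic R K mA; have bB := bmf_indic R K mB.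
  have bp := cont_bmf cphi p01; have bq := cont_bmf cpsi q01.
  have bm : bounded_mfun K (fun p => Num.max (phi p) (psi p)).
    apply: unit_bmf; first by apply: measurable_maxr; [exact: bp.1|exact: bq.1].
    by move=> p; rewrite le_max ge_max; have /andP[-> ->] := p01 p; have /andP[_ ->] := q01 p.
  apply: (@le_trans _ _ (\int[lambda]_(p in K) (`|\1_A p - phi p| + `|\1_B p - psi p|))).
    apply: le_Rintegral => //.
    - by apply: bmf_integrable => //; apply: bmf_norm; apply: bmfB => //; apply: bmf_indic; exact: measurableU.
    - by apply: bmf_integrable => //; apply: bmfD; apply: bmf_norm; exact: bmfB.
    - move=> p _; apply: le_trans (dist_maxr _ _ _ _).
      rewrite le_eqVlt; apply/orP; left; apply/eqP; congr (`|_ - _|).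
      rewrite !indicE in_setU; case: (p \in A); case: (p \in B) => /=;
      by rewrite ?maxxx ?(@max_l _ _ 1) ?(@max_r _ _ 0)// ?ler01.
  rewrite RintegralD//; last 2 first.
  - by apply: bmf_integrable => //; apply: bmf_norm; exact: bmfB.
  - by apply: bmf_integrable => //; apply: bmf_norm; exact: bmfB.
  by rewrite (le_trans (lerD hphi hpsi))//; lra.
split.
- split; first exact: measurable0.
  by rewrite indic0; apply: approx_continuous => p; [exact: cvg_cst|rewrite /= lexx ler01].
- move=> A [mA aA]; rewrite setTD; split; first exact: measurableC.
  move=> e e0; have [phi [cphi p01 hphi]] := aA e e0.
  exists (fun p => 1 - phi p); split.
  + by move=> p; apply: cvgB; [exact: cvg_cst|exact: cphi].
  + by move=> p; have /andP[? ?] := p01 p; apply/andP; split; lra.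
  + apply: le_trans hphi; rewrite le_eqVlt; apply/orP; left; apply/eqP.
    apply: eq_Rintegral => p _; rewrite -[RHS]normrN; congr (`|_|).
    by rewrite !indicE in_setC; case: (p \in A) => /=; lra.
- move=> F aF; have mF i := (aF i).1.
  split; first exact: bigcupT_measurable.
  have mG k : measurable (\big[setU/set0]_(i < k) F i) by exact: bigsetU_measurable.
  apply: (@approx_cvg (fun k => \1_(\big[setU/set0]_(i < k) F i))) => //.
  + move=> p; apply/cvgrPdist_le => e e0.
    rewrite indicE; case: (boolP (p \in _)) => pF.
      move: pF; rewrite inE => -[i _ Fip]; exists i.+1 => // k /= ik.
      rewrite indicE mem_set ?subrr ?normr0 ?ltW//.
      by rewrite -bigcup_mkord; exists i.
    near=> k; rewrite indicE memNset ?subrr ?normr0 ?ltW//.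
    rewrite -bigcup_mkord => -[i _ Fip]; move/negP: pF; apply.
    by rewrite inE; exists i.
  + elim=> [|k IH]; last by rewrite big_ord_recr /=; exact: (aU _ _ (mG k) (mF k) IH (aF k).2).
    rewrite big_ord0 indic0.
    by apply: approx_continuous => p; [exact: cvg_cst|rewrite /= lexx ler01].
Unshelve. all: by end_near. Qed.

End density.

End space_time.

(** * Image measures, cells and random points *)

Section image_measure.
Context d d' (X : measurableType d) (Y : measurableType d') (R : realType).
Variables (mu : {measure set X -> \bar R}) (D : set X) (f : X -> Y).
Hypotheses (mD : measurable D) (muD : (mu D < +oo)%E).
Hypothesis mf : measurable_fun setT f.

(** The image under f of mu restricted to D. The hypotheses are arguments of the
    definition, so that the structure of finite measure is inferred from them. *)
Definition image_measure & measurable D & (mu D < +oo)%E & measurable_fun setT f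
  : set Y -> \bar R := fun A => mu (f @^-1` A `&` D).

Local Notation nu := (image_measure mD muD mf).

Let mpre A : measurable A -> measurable (f @^-1` A).
Proof. by move=> mA; rewrite -[X in measurable X]setTI; exact: mf. Qed.

Let nu0 : nu set0 = 0%E.
Proof. by rewrite /image_measure preimage_set0 set0I measure0. Qed.

Let nu_ge0 A : (0 <= nu A)%E.
Proof. exact: measure_ge0. Qed.

Let nu_sigma_additive : semi_sigma_additive nu.
Proof.
move=> F mF tF mUF; rewrite /image_measure preimage_bigcup setI_bigcupl.
apply: measure_semi_sigma_additive.
- by move=> n; apply: measurableI => //; exact: mpre.
- apply/trivIsetP => /= i j _ _ ij; rewrite setIACA -preimage_setI.
  by move/trivIsetP : tF => /(_ _ _ _ _ ij) ->//; rewrite preimage_set0 set0I.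
- by rewrite -setI_bigcupl -preimage_bigcup; apply: measurableI => //; exact: mpre.
Qed.

HB.instance Definition _ := isMeasure.Build _ _ _ nu nu0 nu_ge0 nu_sigma_additive.

Let nu_fin : fin_num_fun nu.
Proof.
move=> A mA; rewrite ge0_fin_numE ?measure_ge0//; apply: le_lt_trans muD.
by apply: le_measure; rewrite ?inE//; apply: measurableI => //; exact: mpre.
Qed.

HB.instance Definition _ := @Measure_isFinite.Build _ _ _ nu nu_fin.

Lemma Rintegral_image_measure (E : set Y) (phi : Y -> R) : measurable E ->
  (forall x, D x -> E (f x)) -> bounded_mfun E phi ->
  \int[nu]_(y in E) phi y = \int[mu]_(x in D) phi (f x).
Proof.
move=> mE DE [mphi [C phiC]].
have mpE : measurable_fun setT (phi \_ E) by exact/(measurable_restrictT phi mE).1.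
have bpE x : `|(phi \_ E) x| <= `|C|.
  rewrite /patch; case: ifPn => [|_]; last by rewrite normr0.
  by rewrite inE => /phiC/le_trans; apply; exact: ler_norm.
have mDT : measurable (setT : set X) by [].
rewrite Rintegral_mkcond [RHS](@eq_Rintegral _ _ _ _ _ ((phi \_ E) \o f)); last first.
  by move=> x; rewrite inE => Dx /=; rewrite /patch mem_set//; exact: DE.
rewrite /Rintegral; congr fine.
rewrite (eq_measure_integral (pushforward (mrestr mu mD) f)) => //.
set g := EFin \o ((phi \_ E) \o f).
have mg : measurable_fun setT g.
  by apply/measurable_EFinP; exact: measurableT_comp.
have gi : (mrestr mu mD).-integrable setT g.
  apply: measurable_bounded_integrable => //.
  - by rewrite /= /mrestr setTI.
  - exact: measurableT_comp.
  - by exists `|C|; split => // M CM x _; exact: le_trans (bpE _) (ltW CM).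
transitivity (\int[mrestr mu mD]_x g x)%E.
  by rewrite integral_pushforward//; exact/measurable_EFinP.
rewrite (@negligible_integral _ _ _ (mrestr mu mD) setT (~` D)) => //; first last.
- by rewrite /= /mrestr setICl measure0.
- exact: measurableC.
rewrite setTD setCK; apply: eq_measure_integral => A mA AD.
by rewrite /= /mrestr setIidl.
Qed.

End image_measure.

Lemma Rintegral_carried d (X : measurableType d) (R : realType)
    (nu : {measure set X -> \bar R}) (K D : set X) (f : X -> R) :
  measurable K -> measurable D -> K `<=` D -> nu.-null_set (~` K) ->
  nu.-integrable D (EFin \o f) ->
  \int[nu]_(x in D) f x = \int[nu]_(x in K) f x.
Proof.
move=> mK mD KD nuK fi; rewrite /Rintegral; congr fine.
rewrite (@negligible_integral _ _ _ nu D (~` K)) => //.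
- by rewrite setDE setCK setIidr.
- exact: measurableC.
- by apply: nuK => //; exact: measurableC.
Qed.

(** Along an ultrafilter all bounded sequences converge at once, which replaces the
    extraction of diagonal subsequences. *)
Lemma ultra_cvg (R : realType) (U : set_system nat) (u : nat -> R) (C : R) :
  UltraFilter U -> (forall k, `|u k| <= C) -> exists l : R, u @ U --> l.
Proof.
move=> UU uC.
have UI : UltraFilter (fmap u U).
  split; first exact: fmap_proper_filter.
  move=> G FG UG; apply/seteqP; split => A; last exact: UG.
  move=> GA; case: (in_ultra_setVsetC (u @^-1` A) UU) => // UnA.
  have : G (A `&` ~` A) by apply: filterI => //; exact: UG.
  by rewrite setICr => /filter_not_empty.
have := @segment_compact R (- C) C; rewrite compact_ultra => /(_ (fmap u U) UI).
case; last by move=> l [_ /= ul]; exists l.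
by apply: (@filterE _ U) => k /=; rewrite in_itv/= -ler_norml.
Qed.

Section weak_compactness.
Context {R : realType} {n : nat}.
Local Notation T := (R * 'rV[R]_n)%type.
Variable M : R.
Hypothesis M0 : 0 < M.
Local Notation Box := (@box R n M).

Lemma continuous_bmf_box (phi : T -> R) : continuous phi -> bounded_mfun Box phi.
Proof.
move=> cphi; have cB : compact (phi @` Box).
  apply: continuous_compact; last exact: box_compact.
  exact: continuous_subspaceT.
have [N [Nr hN]] := compact_bounded cB.
apply: (@continuous_bmf _ _ _ (N + 1)) => //; first exact: measurable_box.
by move=> p Bp; apply: (hN (N + 1)); [rewrite ltrDl|exists p].
Qed.

Definition word_close (phi : T -> R) (e : R) (J : nat) : Prop :=
  forall S, `|phi (point_of_bits M S) - phi (word_point M (mkseq S J))| <= e.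

Lemma word_close_ex (phi : T -> R) (e : R) : continuous phi -> 0 < e ->
  exists J, word_close phi e J.
Proof.
move=> cphi e0; have [J h] := point_of_bits_word_uniform M0 cphi e0.
by exists J => S; exact: h.
Qed.

Definition cell (w : seq bool) : set T :=
  [set p | mkseq (bits_of_point M p) (size w) = w].

Lemma measurable_cell_box w : measurable (cell w `&` Box).
Proof. by apply: measurableI; [exact: measurable_cell|exact: measurable_box]. Qed.

(** On each cell phi is within e of its value at the point coded by the word. *)
Lemma Rintegral_cells (mu : {measure set T -> \bar R}) (phi : T -> R) e J :
  (mu Box < +oo)%E -> continuous phi -> word_close phi e J ->
  `|\int[mu]_(p in Box) phi p -
    \sum_(w : J.-tuple bool) phi (word_point M w) * fine (mu (cell w `&` Box))|
  <= e * fine (mu Box).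
Proof.
move=> muB cphi hJ; have mB : measurable Box by exact: measurable_box.
have mc w : measurable [set p : T | mkseq (bits_of_point M p) J = w].
  exact: measurable_cell.
have sc p : Box p -> size (mkseq (bits_of_point M p) J) = J.
  by rewrite size_mkseq.
have := @Rintegral_word _ _ _ mu _ mB muB (fun p => mkseq (bits_of_point M p) J) J
  (fun w => phi (word_point M w)) mc sc.
have -> : \sum_(w : J.-tuple bool) phi (word_point M w) *
      fine (mu ([set p | mkseq (bits_of_point M p) J = w] `&` Box)) =
    \sum_(w : J.-tuple bool) phi (word_point M w) * fine (mu (cell w `&` Box)).
  by apply: eq_bigr => w _; rewrite /cell size_tuple.
move=> <-; apply: le_Rintegral_dist => //.
- exact: continuous_bmf_box.
- by apply: (@bmf_word _ _ _ _ (fun p => mkseq (bits_of_point M p) J) J (fun w => phi (word_point M w))).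
- by move=> p Bp; rewrite -{1}(bits_of_pointK M0 Bp); exact: hJ.
Qed.

Lemma cell_rcons w :
  cell w `&` Box = (cell (rcons w false) `&` Box) `|` (cell (rcons w true) `&` Box).
Proof.
apply/seteqP; split=> p; rewrite /cell /=.
  move=> [pw Bp]; case E : (bits_of_point M p (size w)); [right|left]; split => //;
  by rewrite size_rcons mkseqS pw E.
by rewrite !size_rcons !mkseqS => -[[/rcons_inj[-> _]]|[/rcons_inj[-> _]]].
Qed.

Lemma cell_rcons_disj w :
  (cell (rcons w false) `&` Box) `&` (cell (rcons w true) `&` Box) = set0.
Proof.
apply/seteqP; split=> // p; rewrite /cell /= !size_rcons !mkseqS.
by move=> [[/rcons_inj[_ ->] _] [/rcons_inj[]]].
Qed.

Lemma cell_nil : cell [::] `&` Box = Box.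
Proof. by apply/seteqP; split=> p; [move=> []|]. Qed.

Section realization.
Variable m : R -> seq bool -> R.
Hypothesis m_ge0 : forall t w, 0 <= m t w.
Hypothesis m_rcons : forall t w,
  m t w = m t (rcons w false) + m t (rcons w true).
Hypothesis m_meas : forall w, measurable_fun setT (m ^~ w).

(** For a parameter s uniform on [0, m t [::][, the point coded by a random stream of
    bits that starts with w with mass m t w. *)
Definition random_point (p : R * R) : T := point_of_bits M (ipath m p).

Lemma measurable_random_point : measurable_fun setT random_point.
Proof. by apply: measurable_point_of_bits => // j; exact: measurable_ipath. Qed.

Lemma Rintegral_random_point t (phi : T -> R) e J :
  continuous phi -> word_close phi e J ->
  `|\int[lebesgue_measure]_(s in `[0, m t [::][%classic) phi (random_point (t, s))
    - \sum_(w : J.-tuple bool) phi (word_point M w) * m t w| <= e * m t [::].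
Proof.
move=> cphi hJ.
have -> : \sum_(w : J.-tuple bool) phi (word_point M w) * m t w =
    \int[lebesgue_measure]_(s in `[0, m t [::][%classic)
      phi (word_point M (mkseq (ipath m (t, s)) J)).
  by rewrite (Rintegral_ipath m_ge0 m_rcons m_meas t J (fun w => phi (word_point M w))).
have e1 : m t [::] = fine (@lebesgue_measure R `[0, m t [::][%classic).
  rewrite lebesgue_measure_itv/= lte_fin; case: ltP => [|h].
    by rewrite -EFinB/= subr0.
  by apply/eqP; rewrite eq_le h m_ge0.
have mrp : measurable_fun setT (fun s : R => random_point (t, s)).
  apply: (measurableT_comp measurable_random_point); exact: measurable_pair1.
rewrite [in leRHS]e1; apply: le_Rintegral_dist => //.
- exact: lebesgue_I_lty.
- have [mphi [C phiC]] := continuous_bmf_box cphi.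
  split; last by exists C => s _; apply: phiC; exact: point_of_bits_box.
  apply: measurable_funTS; apply: (measurableT_comp _ mrp).
  exact: continuous_measurable_prod.
- apply: (@bmf_word _ _ _ _ (fun s => mkseq (ipath m (t, s)) J) J
    (fun w => phi (word_point M w))).
    by apply: measurable_word => j; exact: measurable_ipath2.
  by move=> s _; rewrite size_mkseq.
- by move=> s _; exact: hJ.
Qed.

End realization.

End weak_compactness.

(** * Weak compactness of bounded measures *)

Lemma cvg_finite_sum (R : realType) (I J : Type) (F : set_system I)
    {FF : Filter F} (s : seq J) (f : J -> I -> R) (l : J -> R) :
  (forall j, f j @ F --> l j) ->
  (fun i => \sum_(j <- s) f j i) @ F --> \sum_(j <- s) l j.
Proof.
move=> fl; elim: s => [|j s IH].
  by rewrite big_nil; under eq_fun do rewrite big_nil; exact: cvg_cst.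
by rewrite big_cons; under eq_fun do rewrite big_cons; exact: cvgD.
Qed.

Section weak_limit.
Context {R : realType} {n : nat}.
Local Notation T := (R * 'rV[R]_n)%type.
Variable M : R.
Hypothesis M0 : 0 < M.
Local Notation Box := (@box R n M).

Lemma fin_lty d (X : measurableType d) (mu : {finite_measure set X -> \bar R})
  (A : set X) : measurable A -> (mu A < +oo)%E.
Proof. by move=> mA; rewrite -ge0_fin_numE// fin_num_measure. Qed.

Lemma fine_measureU d (X : measurableType d) (mu : {finite_measure set X -> \bar R})
  (A B : set X) : measurable A -> measurable B -> A `&` B = set0 ->
  fine (mu (A `|` B)) = fine (mu A) + fine (mu B).
Proof.
by move=> mA mB AB; rewrite measureU// fineD ?fin_num_measure.
Qed.

Lemma le_fine_measure d (X : measurableType d) (mu : {finite_measure set X -> \bar R})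
  (A B : set X) : measurable A -> measurable B -> A `<=` B ->
  fine (mu A) <= fine (mu B).
Proof.
move=> mA mB AB; apply: fine_le; rewrite ?fin_num_measure//.
by apply: le_measure; rewrite ?inE.
Qed.

(** Limits of the masses of the cells form a consistent family of weights, and nu is the
    law of the random point with these weights. A cell is neither open nor closed, so its
    mass under nu may differ from its weight; the convergence of integrals only uses that
    a continuous function is almost constant on small cells. *)
Lemma weak_limit (U : set_system nat) (mu_ : nat -> {finite_measure set T -> \bar R})
    (K : set T) (C : R) : UltraFilter U ->
  closed K -> K `<=` Box -> (forall k, (mu_ k).-null_set (~` K)) ->
  (forall k, fine (mu_ k K) <= C) ->
  exists nu : {finite_measure set T -> \bar R}, nu.-null_set (~` K) /\
    forall phi : T -> R, continuous phi ->
      (fun k => \int[mu_ k]_(p in K) phi p) @ U --> \int[nu]_(p in K) phi p.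
Proof.
move=> UU cK KB muK muC.
have mB : measurable Box by exact: measurable_box.
have mK : measurable K by exact: closed_measurable_prod.
have muB k : mu_ k Box = mu_ k K.
  rewrite -[in LHS](setDUK KB) measureU//; first last.
  - by apply/seteqP; split => // p [Kp []].
  - exact: measurableD.
  rewrite [X in (_ + X)%E](_ : _ = 0%E) ?adde0//.
  by apply: (muK k); [exact: measurableD|move=> p []].
have C0 : 0 <= C by rewrite (le_trans _ (muC 0%N))// fine_ge0.
have wtP w : exists l : R, (fun k => fine (mu_ k (cell M w `&` Box))) @ U --> l.
  apply: (@ultra_cvg _ _ _ C) => k; rewrite ger0_norm ?fine_ge0//.
  rewrite (le_trans _ (muC k))// -muB.
  by apply: le_fine_measure => //; exact: measurable_cell_box.
pose wt w := sval (cid (wtP w)).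
have wtE w : (fun k => fine (mu_ k (cell M w `&` Box))) @ U --> wt w.
  exact: (svalP (cid (wtP w))).
(* These weights are the same at all times; the time parameter serves for
   disintegrations. *)
pose m (t : R) w := wt w.
have m_ge0 t w : 0 <= m t w.
  rewrite /m -(cvg_lim (@Rhausdorff R) (wtE w)); apply: limr_ge; first by apply/cvg_ex; exists (wt w).
  by apply: nearW => k; rewrite fine_ge0.
have m_rcons t w : m t w = m t (rcons w false) + m t (rcons w true).
  rewrite /m -(cvg_lim (@Rhausdorff R) (wtE w)); apply/cvg_lim => //.
  have -> : (fun k => fine (mu_ k (cell M w `&` Box))) =
    (fun k => fine (mu_ k (cell M (rcons w false) `&` Box)) +
              fine (mu_ k (cell M (rcons w true) `&` Box))).
    apply/funext => k; rewrite cell_rcons fine_measureU//.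
    - exact: measurable_cell_box.
    - exact: measurable_cell_box.
    - exact: cell_rcons_disj.
  by apply: cvgD; exact: wtE.
have m_meas w : measurable_fun setT (m ^~ w) by exact: measurable_cst.
have mnilC : m 0 [::] <= C.
  rewrite /m -(cvg_lim (@Rhausdorff R) (wtE [::])); apply: limr_le; first by apply/cvg_ex; eexists; exact: wtE.
  by apply: nearW => k; rewrite cell_nil muB.
pose X (s : R) : T := random_point M m (0, s).
have mX : measurable_fun setT X.
  apply: (measurableT_comp (measurable_random_point M0 m_meas)); exact: measurable_pair1.
have mI : measurable (`[0, m 0 [::][%classic : set R) by exact: measurable_itv.
pose nu : {finite_measure set T -> \bar R} :=
  @image_measure _ _ _ _ _ (@lebesgue_measure R) _ X mI (lebesgue_I_lty m 0) mX.
have cvgB phi : continuous phi ->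
    (fun k => \int[mu_ k]_(p in Box) phi p) @ U --> \int[nu]_(p in Box) phi p.
  move=> cphi; rewrite (Rintegral_image_measure _ _ _ mB); last 2 first.
  - by move=> s _; exact: point_of_bits_box.
  - exact: continuous_bmf_box.
  apply/cvgrPdist_le => e e0; pose a := e / (2 * C + 1).
  have a0 : 0 < a by rewrite divr_gt0//; lra.
  have aE : a * C + a * C + a = e by rewrite /a; field; lra.
  have [J hJ] := word_close_ex M0 cphi a0.
  have h1 := Rintegral_random_point M0 m_ge0 m_rcons m_meas 0 cphi hJ.
  have : (fun k => \sum_(w : J.-tuple bool) phi (word_point M w) *
      fine (mu_ k (cell M w `&` Box))) @ U -->
      \sum_(w : J.-tuple bool) phi (word_point M w) * m 0 w.
    apply: cvg_finite_sum => w; apply: cvgM; [exact: cvg_cst|exact: wtE].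
  move=> /cvgrPdist_le/(_ _ a0); apply: filterS => k h2.
  have h3 := Rintegral_cells M0 (fin_lty (mu_ k) mB) cphi hJ.
  have h4 : a * m 0 [::] <= a * C by rewrite ler_wpM2l// ltW.
  have h5 : a * fine (mu_ k Box) <= a * C by rewrite ler_wpM2l ?muB// ltW.
  rewrite -/(X _) in h1 *; move: h1 h2 h3.
  set I1 := Rintegral _ _ _; set S1 := bigop _ _ _; set S2 := bigop _ _ _.
  set I2 := Rintegral _ _ _ => h1 h2 h3.
  rewrite -aE; apply: (le_trans (ler_distD S1 _ _)).
  have := ler_distD S2 S1 I2; rewrite (distrC S2); lra.
(* The distance to K integrates to 0 against every mu_ k, hence against nu. *)
have nuK : nu.-null_set (~` K).
  pose dK := clipped_dist K.
  have cd : continuous dK by exact: clipped_dist_continuous.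
  have d0 : \int[nu]_(p in Box) dK p = 0.
    rewrite -(cvg_lim (@Rhausdorff R) (cvgB dK cd)); apply/cvg_lim => //.
    rewrite (_ : (fun k => _) = fun=> 0); first exact: cvg_cst.
    apply/funext => k.
    rewrite (Rintegral_carried mK mB KB (muK k)); last first.
      by apply: bmf_integrable => //; [exact: fin_lty|exact: continuous_bmf_box].
    rewrite (@eq_Rintegral _ _ _ _ _ (cst 0)); first by rewrite Rintegral_cst// mul0r.
    by move=> p; rewrite inE => Kp; apply/clipped_dist_eq0.
  have mdK : measurable_fun Box dK := (continuous_bmf_box M0 cd).1.
  have id0 : (\int[nu]_(p in Box) `|(dK p)%:E| = 0)%E.
    under eq_integral do rewrite gee0_abs ?lee_fin ?clipped_dist_ge0//.
    rewrite -[LHS]fineK; first by congr EFin; exact: d0.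
    apply: integrable_fin_num => //.
    by apply: bmf_integrable => //; [exact: fin_lty|exact: continuous_bmf_box].
  have mdK' : measurable_fun Box (EFin \o dK) by exact/measurable_EFinP.
  have := (ae_eq_integral_abs nu mB mdK').1 id0.
  move=> [N [mN N0 sN]] A mA AK.
  have : nu (A `&` Box) = 0%E.
    apply/eqP; rewrite eq_le measure_ge0 andbT -N0; apply: le_measure; rewrite ?inE//.
      exact: measurableI.
    move=> p [Ap Bp]; apply: sN => /= /(_ Bp)[] /(clipped_dist_eq0 cK).
    exact: AK.
  suff -> : nu A = nu (A `&` Box) by [].
  rewrite /nu /= /image_measure; congr (_ _); apply/seteqP; split => s.
    by move=> [As Is]; split => //; split => //; exact: point_of_bits_box.
  by move=> [[As _] Is].
exists nu; split => // phi cphi.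
rewrite -(Rintegral_carried mK mB KB nuK); last first.
  by apply: bmf_integrable => //; [exact: fin_lty|exact: continuous_bmf_box].
rewrite (_ : (fun k => _) = (fun k => \int[mu_ k]_(p in Box) phi p)); first exact: cvgB.
apply/funext => k; apply/esym/(Rintegral_carried mK mB KB (muK k)).
by apply: bmf_integrable => //; [exact: fin_lty|exact: continuous_bmf_box].
Qed.

End weak_limit.

(** * Comparison of measures through continuous functions *)

Section comparison.
Context {R : realType} {n : nat}.
Local Notation T := (R * 'rV[R]_n)%type.

Lemma Rintegral_measure_add d (X : measurableType d)
    (m1 m2 : {finite_measure set X -> \bar R}) (D : set X) (f : X -> R) :
  measurable D -> bounded_mfun D f ->
  \int[measure_add m1 m2]_(x in D) f x =
  \int[m1]_(x in D) f x + \int[m2]_(x in D) f x.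
Proof.
move=> mD bf; have i1 := bmf_integrable mD (fin_lty m1 mD) bf.
have i2 := bmf_integrable mD (fin_lty m2 mD) bf.
rewrite /Rintegral (integral_measure_add mD i1 i2).
by rewrite fineD//; apply: integrable_fin_num.
Qed.

Lemma indic_bmf_approx d (X : measurableType d) (mu : {finite_measure set X -> \bar R})
    (K A : set X) (phi : X -> R) : measurable K -> measurable A ->
  bounded_mfun K phi ->
  `|fine (mu (A `&` K)) - \int[mu]_(p in K) phi p| <=
  \int[mu]_(p in K) `|\1_A p - phi p|.
Proof.
move=> mK mA bp; have bA := bmf_indic R K mA; have muK := fin_lty mu mK.
rewrite -Rintegral_indic// -RintegralB//; try exact: bmf_integrable.
by apply: le_normr_Rintegral => //; apply: bmf_integrable => //; exact: bmfB.
Qed.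

(** Indicators are approximated by continuous functions in the mean with respect to the
    sum of the two measures. *)
Lemma le_measure_continuous (m1 m2 : {finite_measure set T -> \bar R})
    (K : set T) (C : R) : measurable K -> 0 <= C ->
  (forall phi : T -> R, continuous phi -> (forall p, 0 <= phi p <= 1) ->
    \int[m1]_(p in K) phi p <= C * \int[m2]_(p in K) phi p) ->
  forall A, measurable A -> fine (m1 (A `&` K)) <= C * fine (m2 (A `&` K)).
Proof.
move=> mK C0 m12 A mA.
have lamK : (measure_add m1 m2 K < +oo)%E.
  by rewrite /measure_add /= /msum 2!big_ord_recr big_ord0/= add0e lte_add_pinfty ?fin_lty.
apply/ler_addgt0Pr => e e0.
have a0 : 0 < e / (1 + C) by rewrite divr_gt0//; lra.
set a := e / (1 + C) in a0; have aE : a + C * a = e by rewrite /a; field; lra.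
have [phi [cphi p01 h]] := unit_approximable_indic mK lamK mA a0.
have bp : bounded_mfun K phi.
  apply: (@continuous_bmf _ _ _ 1) => // p _; have /andP[? ?] := p01 p.
  by rewrite ger0_norm.
have bA : bounded_mfun K (\1_A : T -> R) by exact: bmf_indic.
have ba : bounded_mfun K (fun p => `|\1_A p - phi p|) by apply: bmf_norm; exact: bmfB.
move: h; rewrite Rintegral_measure_add// => h.
have := indic_bmf_approx m1 mK mA bp; have := indic_bmf_approx m2 mK mA bp.
rewrite !ler_norml => /andP[h1 h2] /andP[h3 h4]; have h5 := m12 _ cphi p01.
set I1 := \int[m1]_(p in K) phi p in h3 h4 h5.
set I2 := \int[m2]_(p in K) phi p in h1 h2 h5.
set J1 := \int[m1]_(x in K) `|_| in h h3 h4.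
set J2 := \int[m2]_(x in K) `|_| in h h1 h2.
have J10 : 0 <= J1 by exact: Rintegral_ge0.
have J20 : 0 <= J2 by exact: Rintegral_ge0.
have h6 : C * (I2 - fine (m2 (A `&` K))) <= C * J2 by rewrite ler_wpM2l//; lra.
have h7 : C * J2 <= C * a - C * J1 by rewrite -mulrBr ler_wpM2l//; lra.
have : 0 <= C * J1 by exact: mulr_ge0.
lra.
Qed.

Lemma measure_carried d (X : measurableType d) (m : {finite_measure set X -> \bar R})
  (K A : set X) : measurable K -> m.-null_set (~` K) -> measurable A ->
  m A = m (A `&` K).
Proof.
move=> mK mK0 mA; rewrite -{1}(setUIDK A K).
rewrite measureU//; first last.
- by apply/seteqP; split => // p [[_ Kp] [_ nKp]].
- exact: measurableD.
- exact: measurableI.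
rewrite [X in (_ + X)%E](_ : _ = 0%E) ?adde0//.
by apply: mK0; [exact: measurableD|move=> p []].
Qed.

Lemma eq_measure_continuous (m1 m2 : {finite_measure set T -> \bar R})
    (K : set T) : measurable K ->
  m1.-null_set (~` K) -> m2.-null_set (~` K) ->
  (forall phi : T -> R, continuous phi -> (forall p, 0 <= phi p <= 1) ->
    \int[m1]_(p in K) phi p = \int[m2]_(p in K) phi p) ->
  forall A, measurable A -> m1 A = m2 A.
Proof.
move=> mK mK1 mK2 m12 A mA.
rewrite (measure_carried mK mK1 mA) (measure_carried mK mK2 mA).
have mAK : measurable (A `&` K) by exact: measurableI.
rewrite -[LHS]fineK ?fin_num_measure// -[RHS]fineK ?fin_num_measure//; congr EFin.
have le12 (u v : {finite_measure set T -> \bar R}) :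
    (forall phi : T -> R, continuous phi -> (forall p, 0 <= phi p <= 1) ->
      \int[u]_(p in K) phi p = \int[v]_(p in K) phi p) ->
    fine (u (A `&` K)) <= fine (v (A `&` K)).
  move=> uv; rewrite -[leRHS]mul1r; apply: le_measure_continuous => // phi cp p01.
  by rewrite mul1r uv.
apply/eqP; rewrite eq_le; apply/andP; split; apply: le12 => // phi cp p01.
by rewrite m12.
Qed.

(** Riemann sums over the cells determine the integrals of continuous functions. *)
Lemma eq_measure_cells (M : R) (M0 : 0 < M)
    (m1 m2 : {finite_measure set T -> \bar R}) :
  m1.-null_set (~` box M) -> m2.-null_set (~` box M) ->
  (forall w, m1 (cell M w `&` box M) = m2 (cell M w `&` box M)) ->
  forall A, measurable A -> m1 A = m2 A.
Proof.
move=> mB1 mB2 m12; have mB : measurable (@box R n M) by exact: measurable_box.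
apply: eq_measure_continuous mB1 mB2 _ => // phi cphi _.
have Bm : m1 (box M) = m2 (box M) by have := m12 [::]; rewrite cell_nil.
apply/eqP; rewrite -subr_eq0 -normr_le0; apply/ler_addgt0Pr => e e0; rewrite add0r.
pose c := fine (m2 (box M)); have c0 : 0 <= c by exact: fine_ge0.
have a0 : 0 < e / (2 * c + 1) by rewrite divr_gt0//; lra.
set a := e / (2 * c + 1) in a0.
have aE : 2 * (a * c) + a = e by rewrite /a; field; lra.
have [J hJ] := word_close_ex M0 cphi a0.
pose S (m : {finite_measure set T -> \bar R}) := \sum_(w : J.-tuple bool)
  phi (word_point M w) * fine (m (cell M w `&` box M)).
have h1 : `|\int[m1]_(p in box M) phi p - S m1| <= a * fine (m1 (box M)).
  exact (Rintegral_cells M0 (fin_lty m1 mB) cphi hJ). 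
have h2 : `|\int[m2]_(p in box M) phi p - S m2| <= a * fine (m2 (box M)).
  exact (Rintegral_cells M0 (fin_lty m2 mB) cphi hJ).
have SE : S m1 = S m2 by apply: eq_bigr => w _; rewrite m12.
move: h1 h2; rewrite Bm SE -/c; move: (S m2) => s2.
by rewrite !ler_norml => /andP[h1 h2] /andP[h3 h4]; apply/andP; split; lra.
Qed.

(** For x at most N the sum is the integer part of x. *)
Lemma staircase_bounds (N : nat) (x : R) : 0 <= x ->
  (N%:R <= x -> \sum_(i < N) (i.+1%:R <= x :> R)%:R = N%:R :> R) /\
  (x <= N%:R -> x - 1 <= \sum_(i < N) (i.+1%:R <= x :> R)%:R <= x).
Proof.
move=> x0; elim: N => [|N [IH1 IH2]]; first by rewrite big_ord0; split => // h; apply/andP; split; lra.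
have e : N.+1%:R = N%:R + 1 :> R by rewrite -natr1.
rewrite big_ord_recr/=; split=> [Nx|xN].
  by rewrite IH1 ?Nx /=; lra.
have [Nx|xN'] := leP (N.+1%:R) x.
  by rewrite IH1 /=; [apply/andP; split|]; lra.
rewrite addr0; have [xN1|Nx] := leP x N%:R; first exact: IH2.
rewrite (IH1 (ltW Nx)); apply/andP; split; lra.
Qed.

(** A bounded function is uniformly close to an average of indicators of its superlevel
    sets, and indicators are approximated by continuous functions. *)
Lemma bounded_approximable (lambda : {finite_measure set T -> \bar R})
    (K : set T) (f : T -> R) (B e : R) : measurable K -> 0 < B -> 0 < e ->
  measurable_fun setT f -> (forall p, `|f p| <= B) ->
  exists phi : T -> R, [/\ continuous phi, (forall p, `|phi p| <= B) &
    \int[lambda]_(p in K) `|f p - phi p| <= e].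
Proof.
move=> mK B0 e0 mf fB; have lamK := fin_lty lambda mK.
pose c := fine (lambda K); have c0 : 0 <= c by exact: fine_ge0.
pose N := (Num.bound (2 * (2 * B * c) / e)).+1.
have N0 : (0 : R) < N%:R by rewrite ltr0n.
have hN : 2 * B * c / N%:R <= e / 2.
  have : 2 * (2 * B * c) / e <= N%:R.
    have x0 : 0 <= 2 * (2 * B * c) / e by rewrite divr_ge0 ?mulr_ge0// ltW.
    by rewrite (le_trans (ltW (archi_boundP x0)))// ler_nat.
  rewrite !ler_pdivrMr// => h; lra.
pose x p := N%:R * (f p + B) / (2 * B).
have B20 : 0 < 2 * B by lra.
have x01 p : 0 <= x p <= N%:R.
  have := fB p; rewrite ler_norml => /andP[h1 h2].
  have fB0 : 0 <= f p + B by lra.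
  apply/andP; split; first by rewrite /x divr_ge0 ?mulr_ge0// ltW.
  by rewrite /x -mulrA ger_pMr// ler_pdivrMr//; lra.
pose A i := [set p | (i.+1%:R : R) <= x p].
have mA i : measurable (A i).
  rewrite (_ : A i = (fun p => i.+1%:R <= x p) @^-1` [set true]); last by apply/seteqP; split.
  rewrite -[X in measurable X]setTI; apply: measurable_fun_ler => //.
  by do 2 apply: measurable_funM => //; exact: measurable_funD.
have dlt : 0 < e / (4 * B) by rewrite divr_gt0//; lra.
have hphi i := unit_approximable_indic mK lamK (mA i) dlt.
pose phi_ i := sval (cid (hphi i)).
have phi_P i : [/\ continuous (phi_ i), (forall p, 0 <= phi_ i p <= 1) &
    \int[lambda]_(p in K) `|\1_(A i) p - phi_ i p| <= e / (4 * B)].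
  exact: (svalP (cid (hphi i))).
pose phi p := 2 * B / N%:R * (\sum_(i < N) phi_ i p) - B.
pose g p := 2 * B / N%:R * (\sum_(i < N) \1_(A i) p) - B.
have fg p : `|f p - g p| <= 2 * B / N%:R.
  have /andP[x0 xN] := x01 p; have [_ /(_ xN)] := staircase_bounds N x0.
  have -> : \sum_(i < N) (i.+1%:R <= x p :> R)%:R = \sum_(i < N) \1_(A i) p :> R.
    apply: eq_bigr => i _; rewrite indicE; congr (nat_of_bool _)%:R.
    by apply/idP/idP => [h|]; rewrite inE.
  set s := bigop _ _ _ => /andP[h1 h2].
  have -> : f p - g p = 2 * B / N%:R * (x p - s).
    by rewrite /g -/s /x; field; lra.
  rewrite normrM ger0_norm; last by rewrite divr_ge0// ltW.
  rewrite ger_pMr ?divr_gt0// ler_norml; apply/andP; split; lra.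
have bphi i : bounded_mfun K (phi_ i).
  have [cp p01 _] := phi_P i; apply: (@continuous_bmf _ _ _ 1) => // p _.
  by have /andP[? ?] := p01 p; rewrite ger0_norm.
have bA i : bounded_mfun K (\1_(A i) : T -> R) by exact: bmf_indic.
have cphi : continuous phi.
  move=> p; apply: cvgB; last exact: cvg_cst.
  apply: cvgM; first exact: cvg_cst.
  by apply: cvg_finite_sum => i; have [cp _ _] := phi_P i; exact: cp.
have phiB p : `|phi p| <= B.
  have h0 : 0 <= \sum_(i < N) phi_ i p.
    by apply: sumr_ge0 => i _; have [_ /(_ p)/andP[]] := phi_P i.
  have h1 : \sum_(i < N) phi_ i p <= N%:R.
    rewrite -[leRHS]mulr1 -[N in leRHS]card_ord mulr_natl -sumr_const.
    by apply: ler_sum => i _; have [_ /(_ p)/andP[]] := phi_P i.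
  have h2 : 2 * B / N%:R * \sum_(i < N) phi_ i p <= 2 * B.
    by rewrite mulrAC ler_pdivrMr// ler_wpM2l// ltW.
  have h3 : 0 <= 2 * B / N%:R * \sum_(i < N) phi_ i p by rewrite mulr_ge0// divr_ge0// ltW.
  by rewrite ler_norml /phi; apply/andP; split; lra.
exists phi; split => //.
have bf : bounded_mfun K f by split; [exact: measurable_funTS|exists B].
have bph : bounded_mfun K phi by exact: (@continuous_bmf _ _ _ B).
have bd i : bounded_mfun K (fun p => `|\1_(A i) p - phi_ i p|).
  by apply: bmf_norm; exact: bmfB.
have bsum : bounded_mfun K (fun p => \sum_(i < N) `|\1_(A i) p - phi_ i p|).
  by apply: bmf_sum => i; exact: bd.
apply: (@le_trans _ _ (\int[lambda]_(p in K)
    (2 * B / N%:R + 2 * B / N%:R * \sum_(i < N) `|\1_(A i) p - phi_ i p|))).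
  apply: le_Rintegral => //.
  - by apply: bmf_integrable => //; apply: bmf_norm; exact: bmfB.
  - by apply: bmf_integrable => //; apply: bmfD; [exact: bmf_cst|exact: bmfZ].
  - move=> p _; apply: (le_trans (ler_distD (g p) _ _)); apply: lerD => //.
    rewrite /g /phi opprB addrA subrK -mulrBr -sumrB normrM.
    rewrite ger0_norm; last by rewrite divr_ge0// ltW.
    rewrite ler_wpM2l//; first by rewrite divr_ge0// ltW.
    exact: ler_norm_sum.
rewrite RintegralD//; last 2 first.
- by apply: bmf_integrable => //; exact: bmf_cst.
- by apply: bmf_integrable => //; exact: bmfZ.
rewrite Rintegral_cst// -/c RintegralZl//; last exact: bmf_integrable.
rewrite Rintegral_sum//; last by move=> i; exact: bmf_integrable.
have : 2 * B / N%:R * \sum_(i < N) \int[lambda]_(p in K) `|\1_(A i) p - phi_ i p|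
    <= 2 * B / N%:R * (N%:R * (e / (4 * B))).
  rewrite ler_wpM2l//; first by rewrite divr_ge0// ltW.
  rewrite -[N in leRHS]card_ord mulr_natl -sumr_const.
  by apply: ler_sum => i _; have [_ _] := phi_P i.
have -> : 2 * B / N%:R * (N%:R * (e / (4 * B))) = e / 2 by field; lra.
move: hN; rewrite mulrAC; lra.
Qed.

End comparison.

(** * Integration against charges *)

Local Open Scope charge_scope.

Section cintegral.
Context d (X : measurableType d) (R : realType).
Implicit Types (nu : {charge set X -> \bar R}) (D : set X) (f g : X -> R).

Definition jpos nu : {finite_measure set X -> \bar R} := jordan_pos (hahn_choice nu).
Definition jneg nu : {finite_measure set X -> \bar R} := jordan_neg (hahn_choice nu).

Lemma charge_jordan nu A : measurable A -> nu A = (jpos nu A - jneg nu A)%E.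
Proof. by move=> mA; rewrite (jordan_decomp (hahn_choice nu) mA) /cadd/= cscaleN1. Qed.

Lemma cintegralE nu D f :
  cintegral nu D f = \int[jpos nu]_(x in D) f x - \int[jneg nu]_(x in D) f x.
Proof. by []. Qed.

(** Any decomposition may replace the Jordan one: move the subtracted measures to the
    other side and compare sums of nonnegative measures. *)
Lemma cintegral_diff nu (m1 m2 : {finite_measure set X -> \bar R}) D f :
  measurable D -> bounded_mfun D f ->
  (forall A, measurable A -> nu A = (m1 A - m2 A)%E) ->
  cintegral nu D f = \int[m1]_(x in D) f x - \int[m2]_(x in D) f x.
Proof.
move=> mD bf nuE; rewrite cintegralE.
suff : \int[jpos nu]_(x in D) f x + \int[m2]_(x in D) f x =
    \int[m1]_(x in D) f x + \int[jneg nu]_(x in D) f x by lra.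
rewrite -!Rintegral_measure_add//; congr fine.
apply: eq_measure_integral => A mA _.
rewrite /measure_add /= /msum !big_ord_recr !big_ord0 /= !add0e.
suff : (jpos nu A + m2 A = m1 A + jneg nu A)%E by [].
have := charge_jordan nu mA; rewrite nuE//.
have f1 : m1 A \is a fin_num by rewrite fin_num_measure.
have f2 : m2 A \is a fin_num by rewrite fin_num_measure.
have f3 : jpos nu A \is a fin_num by rewrite fin_num_measure.
have f4 : jneg nu A \is a fin_num by rewrite fin_num_measure.
rewrite -(fineK f1) -(fineK f2) -(fineK f3) -(fineK f4) -!EFinB -!EFinD => -[h].
by congr EFin; lra.
Qed.

Lemma eq_cintegral nu D f g : {in D, f =1 g} -> cintegral nu D f = cintegral nu D g.
Proof. by move=> fg; rewrite /cintegral !(eq_Rintegral _ fg). Qed.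

Lemma cintegral_finite_measure (m : {finite_measure set X -> \bar R}) D f :
  measurable D -> bounded_mfun D f ->
  cintegral (charge_of_finite_measure m) D f = \int[m]_(x in D) f x.
Proof.
move=> mD bf; rewrite (@cintegral_diff _ m mzero)//.
  by rewrite [X in _ - X]/Rintegral integral_measure_zero subr0.
by move=> A mA; rewrite /mzero sube0.
Qed.

Section finite.
Variables (nu : {charge set X -> \bar R}) (D : set X).
Hypothesis mD : measurable D.

Lemma jpos_lty : (jpos nu D < +oo)%E. Proof. exact: fin_lty. Qed.
Lemma jneg_lty : (jneg nu D < +oo)%E. Proof. exact: fin_lty. Qed.

Lemma cintegralD f g : bounded_mfun D f -> bounded_mfun D g ->
  cintegral nu D (fun x => f x + g x) = cintegral nu D f + cintegral nu D g.
Proof.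
move=> bf bg; have ip h (bh : bounded_mfun D h) := bmf_integrable mD jpos_lty bh.
have iq h (bh : bounded_mfun D h) := bmf_integrable mD jneg_lty bh.
rewrite !cintegralE (RintegralD mD (ip _ bf) (ip _ bg)).
by rewrite (RintegralD mD (iq _ bf) (iq _ bg)); lra.
Qed.

Lemma cintegralZ (c : R) f : bounded_mfun D f ->
  cintegral nu D (fun x => c * f x) = c * cintegral nu D f.
Proof.
move=> bf; have ip h (bh : bounded_mfun D h) := bmf_integrable mD jpos_lty bh.
have iq h (bh : bounded_mfun D h) := bmf_integrable mD jneg_lty bh.
by rewrite !cintegralE (RintegralZl c mD (ip _ bf)) (RintegralZl c mD (iq _ bf)) mulrBr.
Qed.

Lemma cintegral_indic A : measurable A ->
  cintegral nu D (\1_A : X -> R) = fine (nu (A `&` D)).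
Proof.
move=> mA; rewrite cintegralE !Rintegral_indic//.
have mAD : measurable (A `&` D) by exact: measurableI.
by rewrite charge_jordan// fineB// fin_num_measure.
Qed.

Lemma cintegral_dist f g : bounded_mfun D f -> bounded_mfun D g ->
  `|cintegral nu D f - cintegral nu D g| <=
    \int[jpos nu]_(x in D) `|f x - g x| + \int[jneg nu]_(x in D) `|f x - g x|.
Proof.
move=> bf bg; have bfg := bmfB bf bg.
have e : cintegral nu D f - cintegral nu D g = cintegral nu D (fun x => f x - g x).
  rewrite (@cintegralD f (fun x => - g x))//; last exact: bmfN.
  rewrite (_ : cintegral nu D (fun x => - g x) = - cintegral nu D g)//.
  rewrite -mulN1r -cintegralZ//; apply: eq_cintegral => x _; by rewrite mulN1r.
rewrite e cintegralE (le_trans (ler_normB _ _))//.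
by apply: lerD; apply: le_normr_Rintegral => //; apply: bmf_integrable => //;
  [exact: jpos_lty|exact: jneg_lty].
Qed.

End finite.

(** A dominated charge has a derivative with finite values, so that fine loses nothing. *)
Definition density nu (lambda : {sigma_finite_measure set X -> \bar R}) (x : X) : R :=
  fine (('d nu '/d lambda) x).

Section density.
Variables (nu : {charge set X -> \bar R}).
Variable lambda : {sigma_finite_measure set X -> \bar R}.
Hypothesis nul : nu `<< lambda.

Lemma EFin_density : EFin \o density nu lambda = 'd nu '/d lambda.
Proof.
by apply/funext => x /=; rewrite /density fineK// Radon_Nikodym_fin_num.
Qed.

Lemma integrable_density : lambda.-integrable setT (EFin \o density nu lambda).
Proof. by rewrite EFin_density; exact: Radon_Nikodym_integrable. Qed.

Lemma measurable_density : measurable_fun setT (density nu lambda).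
Proof. by apply/measurable_EFinP; apply: measurable_int integrable_density. Qed.

Lemma integrable_bmf_density (D : set X) f : measurable D -> bounded_mfun D f ->
  lambda.-integrable D (EFin \o (fun x => f x * density nu lambda x)).
Proof.
move=> mD [mf [C fC]]; pose g x := (C%:E * (density nu lambda x)%:E)%E.
have ig : lambda.-integrable D g.
  apply: integrableZl => //; apply: integrableS integrable_density => //.
apply: (le_integrable mD _ _ ig).
  apply/measurable_EFinP; apply: measurable_funM => //.
  exact: measurable_funTS measurable_density.
move=> x Dx; rewrite /g /= lee_fin !normrM ler_wpM2r//.
by rewrite (le_trans (fC x Dx))// ler_norm.
Qed.


End density.

Lemma Rintegral_density (m : {finite_measure set X -> \bar R})
    (lambda : {sigma_finite_measure set X -> \bar R}) D f :
  m `<< lambda -> measurable D -> bounded_mfun D f ->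
  \int[lambda]_(x in D) (f x * density (charge_of_finite_measure m) lambda x) =
  \int[m]_(x in D) f x.
Proof.
move=> ml mD bf.
have := Radon_Nikodym_change_of_variables ml mD (bmf_integrable mD (fin_lty m mD) bf).
rewrite /Rintegral => <-; congr fine; apply: eq_integral => x _.
by rewrite -(@EFin_density (charge_of_finite_measure m) lambda ml).
Qed.

(** The Jordan parts are dominated as well, and the difference of their densities is
    almost everywhere the density of nu. *)
Lemma cintegral_density nu (lambda : {sigma_finite_measure set X -> \bar R}) D f :
  nu `<< lambda -> measurable D -> bounded_mfun D f ->
  cintegral nu D f = \int[lambda]_(x in D) (f x * density nu lambda x).
Proof.
move=> nul mD bf.
have pl : jpos nu `<< lambda := jordan_pos_dominates (hahn_choice nu) nul.
have nl : jneg nu `<< lambda := jordan_neg_dominates (hahn_choice nu) nul.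
pose p := density (charge_of_finite_measure (jpos nu)) lambda.
pose q := density (charge_of_finite_measure (jneg nu)) lambda.
have pl' : charge_of_finite_measure (jpos nu) `<< lambda := pl.
have nl' : charge_of_finite_measure (jneg nu) `<< lambda := nl.
have ip : lambda.-integrable setT (EFin \o p) := integrable_density pl'.
have iq : lambda.-integrable setT (EFin \o q) := integrable_density nl'.
have iw : lambda.-integrable setT (EFin \o density nu lambda) := integrable_density nul.
have ae : ae_eq lambda setT (EFin \o density nu lambda) ((EFin \o p) \- (EFin \o q))%E.
  apply: integral_ae_eq => //.
    by apply/(@measurable_int _ _ _ lambda); exact: integrableB.
  move=> A _ mA; rewrite integralB//; last 2 first.
  - exact: integrableS ip.
  - exact: integrableS iq.
  rewrite (EFin_density nul) (EFin_density pl') (EFin_density nl').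
  by rewrite -!Radon_Nikodym_integral// -charge_jordan.
have ifp := integrable_bmf_density pl' mD bf.
have ifq := integrable_bmf_density nl' mD bf.
have ifw := integrable_bmf_density nul mD bf.
rewrite cintegralE -(Rintegral_density pl mD bf) -(Rintegral_density nl mD bf).
rewrite -RintegralB// /Rintegral; congr fine; apply: ae_eq_integral => //.
- by apply: measurable_int (integrableB mD ifp ifq).
- by apply: measurable_int ifw.
- move: ae; apply: filterS => x /= /(_ Logic.I) [h] _.
  by rewrite -mulrBr; congr (EFin (_ * _)); rewrite h.
Qed.

End cintegral.

(** * Pointwise duality for the cost density *)

Section pointwise_duality.
Context {R : realType} {n : nat}.
Variables (delta : R) (r : R) (w : 'rV[R]_n) (z : R).
Hypothesis delta0 : 0 < delta.

(** As (b, c) varies, these linear functions of (r, w, z) have f_cost as supremum. *)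
Definition dual_integrand (b : 'I_n -> R) (c : R) : R :=
  \sum_(i < n) b i * w ord0 i + c * z
  - (\sum_(i < n) b i ^+ 2 + c ^+ 2 / delta ^+ 2) / 2 * r.

(** For positive r this is the inequality between arithmetic and geometric means, one
    coordinate at a time. *)
Lemma dual_integrand_le_f_cost b c :
  ((dual_integrand b c)%:E <= f_cost delta r w z)%E.
Proof.
rewrite /f_cost /dual_integrand; case: ifPn => [r0|_].
  rewrite lee_fin.
  have h i : b i * w ord0 i - b i ^+ 2 / 2 * r <= w ord0 i ^+ 2 / (2 * r).
    rewrite ler_pdivlMr ?mulr_gt0// -subr_ge0.
    rewrite (_ : _ - _ = (w ord0 i - b i * r) ^+ 2) ?sqr_ge0//; by field.
  have h' : c * z - c ^+ 2 / delta ^+ 2 / 2 * r <= delta ^+ 2 * z ^+ 2 / (2 * r).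
    rewrite ler_pdivlMr ?mulr_gt0// -subr_ge0.
    rewrite (_ : _ - _ = (delta * z - c / delta * r) ^+ 2) ?sqr_ge0//.
    by field; rewrite gt_eqF.
  have : \sum_(i < n) (b i * w ord0 i - b i ^+ 2 / 2 * r) <=
      \sum_(i < n) w ord0 i ^+ 2 / (2 * r) by apply: ler_sum.
  rewrite sumrB -!mulr_suml; move: h'; lra.
case: ifPn => [/and3P[/eqP -> /eqP -> /eqP ->]|_]; last exact: leey.
rewrite lee_fin !mulr0 subr0 addr0 big1// => i _; by rewrite mxE mulr0.
Qed.

Hypothesis r0 : 0 <= r.

Definition optimal_range (N : nat) : bool :=
  [forall i, `|w ord0 i| <= N%:R * r] && (`|z| <= N%:R * r).

(** Bounded choices of b for which the dual integrand increases to f_cost. For positive r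
    the maximiser is w / r, used as soon as N bounds it; for r = 0 and (w, z) nonzero the
    cost is infinite, and a vector of size N along w makes the dual integrand grow
    linearly in N. *)
Definition optimal_b (N : nat) (i : 'I_n) : R :=
  if 0 < r then (if optimal_range N then w ord0 i / r else 0)
  else N%:R * (w ord0 i / (1 + `|w ord0 i|)).

Definition optimal_c (N : nat) : R :=
  if 0 < r then (if optimal_range N then delta ^+ 2 * (z / r) else 0)
  else N%:R * (z / (1 + `|z|)).

Lemma frac_norm_le1 (x : R) : `|x / (1 + `|x|)| <= 1.
Proof.
have h : 0 < 1 + `|x| by rewrite ltr_wpDr.
by rewrite normrM normfV (gtr0_norm h) ler_pdivrMr// mul1r lerDr.
Qed.

Lemma optimal_b_le N i : `|optimal_b N i| <= N%:R.
Proof.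
rewrite /optimal_b; case: ifPn => [rp|_].
  case: ifPn => [/andP[/forallP/(_ i) h _]|_]; last by rewrite normr0.
  by rewrite normrM normfV (gtr0_norm rp) ler_pdivrMr.
by rewrite normrM ger0_norm// ler_piMr// frac_norm_le1.
Qed.

Lemma optimal_c_le N : `|optimal_c N| <= N%:R * (1 + delta ^+ 2).
Proof.
have d2 : 0 < delta ^+ 2 by rewrite exprn_gt0.
have N0 : 0 <= N%:R :> R by [].
rewrite /optimal_c; case: ifPn => [rp|_].
  case: ifPn => [/andP[_ h]|_]; last by rewrite normr0 mulr_ge0// ltW// ltr_wpDl.
  rewrite normrM (gtr0_norm d2) normrM normfV (gtr0_norm rp).
  have : `|z| / r <= N%:R by rewrite ler_pdivrMr.
  move=> /(ler_wpM2l (ltW d2)); nra.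
rewrite normrM ger0_norm//.
have : N%:R * `|z / (1 + `|z|)| <= N%:R by rewrite ler_piMr// frac_norm_le1.
by nra.
Qed.

Definition optimal_value N : R := dual_integrand (optimal_b N) (optimal_c N).

Let S : R := \sum_(i < n) w ord0 i ^+ 2.
Let s : R := \sum_(i < n) w ord0 i ^+ 2 / (1 + `|w ord0 i|) + z ^+ 2 / (1 + `|z|).

Let den0 (x : R) : 0 < 1 + `|x|.
Proof. by rewrite ltr_wpDr. Qed.

Let s_ge0 : 0 <= s.
Proof.
by rewrite addr_ge0 ?sumr_ge0// => *; rewrite divr_ge0 ?sqr_ge0// ltW.
Qed.

Lemma optimal_valueE N : optimal_value N =
  if 0 < r then (if optimal_range N then (S + delta ^+ 2 * z ^+ 2) / (2 * r) else 0)
  else N%:R * s.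
Proof.
rewrite /optimal_value /dual_integrand /optimal_b /optimal_c.
case: ifPn => [rp|rn].
  case: ifPn => _.
    have -> : \sum_(i < n) w ord0 i / r * w ord0 i = S / r.
      by rewrite /S mulr_suml; apply: eq_bigr => i _; rewrite mulrAC expr2.
    have -> : \sum_(i < n) (w ord0 i / r) ^+ 2 = S / r ^+ 2.
      by rewrite /S mulr_suml; apply: eq_bigr => i _; rewrite expr_div_n.
    by field; rewrite !gt_eqF.
  rewrite !big1; first by rewrite expr0n/= !mul0r !addr0 !mul0r subr0.
    by move=> i _; rewrite expr0n.
  by move=> i _; rewrite mul0r.
have -> : r = 0 by apply/eqP; rewrite eq_le r0 andbT leNgt.
rewrite mulr0 subr0 /s mulrDr mulr_sumr; congr (_ + _).
  by apply: eq_bigr => i _; rewrite expr2; field; rewrite gt_eqF.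
by rewrite expr2; field; rewrite gt_eqF.
Qed.

Let cost_ge0 : 0 < r -> 0 <= (S + delta ^+ 2 * z ^+ 2) / (2 * r).
Proof.
move=> rp; rewrite divr_ge0 ?mulr_ge0 ?addr_ge0//.
  by rewrite sumr_ge0// => i _; rewrite sqr_ge0.
by rewrite mulr_ge0// sqr_ge0.
Qed.

Lemma optimal_value_ge0 N : 0 <= optimal_value N.
Proof.
rewrite optimal_valueE; case: ifPn => [rp|_]; last by rewrite mulr_ge0.
by case: ifPn => // _; exact: cost_ge0.
Qed.

Lemma optimal_range_nd N N' : (N <= N')%N -> optimal_range N -> optimal_range N'.
Proof.
move=> NN /andP[/forallP h1 h2].
have h : N%:R * r <= N'%:R * r by rewrite ler_wpM2r// ler_nat.
by rewrite /optimal_range (le_trans h2 h) andbT; apply/forallP => i; exact: le_trans h.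
Qed.

(** This is what allows monotone convergence under the cost integral. *)
Lemma optimal_value_nd : {homo optimal_value : N N' / (N <= N')%N >-> N <= N'}.
Proof.
move=> N N' NN; rewrite !optimal_valueE; case: ifPn => [rp|_].
  case: ifPn => [h|_]; first by rewrite (optimal_range_nd NN h).
  by case: ifPn => // _; exact: cost_ge0.
by rewrite ler_wpM2r// ler_nat.
Qed.

Lemma optimal_value_cvg :
  (fun N => (optimal_value N)%:E) @ \oo --> f_cost delta r w z.
Proof.
rewrite /f_cost; case: ifPn => [rp|rn].
  have large (x : R) : \forall N \near \oo, `|x| <= N%:R * r.
    near=> k; rewrite -ler_pdivrMr// ltW//; near: k; exact: nbhs_infty_gtr.
  have largew : \forall N \near \oo, forall i : 'I_n, `|w ord0 i| <= N%:R * r.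
    by apply: filter_forall => j; exact: large.
  apply: cvg_near_cst; near=> N.
  rewrite optimal_valueE rp ifT//.
  apply/andP; split; last by near: N; exact: large.
  by apply/forallP; near: N; exact: largew.
have -> : r == 0 by rewrite eq_le r0 andbT leNgt.
rewrite /=; have vE N : optimal_value N = N%:R * s by rewrite optimal_valueE (negbTE rn).
under eq_fun do rewrite vE.
case: ifPn => [/andP[/eqP w0 /eqP z0]|wz].
  have -> : s = 0.
    rewrite /s z0 expr0n /= mul0r addr0 big1// => i _.
    by rewrite w0 mxE expr0n/= mul0r.
  by under eq_fun do rewrite mulr0; exact: cvg_cst.
have s0 : 0 < s.
  rewrite lt_neqAle s_ge0 andbT eq_sym; apply/negP => /eqP s0.
  move/negP: wz; apply; move: s0; rewrite /s => /eqP.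
  rewrite paddr_eq0; last 2 first.
  - by rewrite sumr_ge0// => *; rewrite divr_ge0 ?sqr_ge0// ltW.
  - by rewrite divr_ge0 ?sqr_ge0// ltW.
  rewrite psumr_eq0; last by move=> *; rewrite divr_ge0 ?sqr_ge0// ltW.
  move=> /andP[/allP hw]; rewrite mulf_eq0 sqrf_eq0 invr_eq0 (gt_eqF (den0 z)) orbF.
  move=> ->; rewrite andbT; apply/eqP/rowP => i; rewrite mxE.
  have := hw i (mem_index_enum i).
  by rewrite /= mulf_eq0 sqrf_eq0 invr_eq0 (gt_eqF (den0 _)) orbF => /eqP.
apply/cvgeyPge => A; near=> N; rewrite lee_fin -ler_pdivrMr// ltW//.
near: N; exact: nbhs_infty_gtr.
Unshelve. all: by end_near. Qed.

End pointwise_duality.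

(** * Dual lower bounds for the cost *)

Lemma measurable_inv {R : realType} : measurable_fun [set: R] (@GRing.inv R).
Proof.
have den (k : nat) (x : R) : 0 < x ^+ 2 + k.+1%:R^-1 by rewrite ltr_wpDl ?sqr_ge0.
apply: (@measurable_fun_cvg _ _ _ _
    (fun (k : nat) (x : R) => x * (x ^+ 2 + k.+1%:R^-1)^-1)) => [k|x _].
  apply: continuous_measurable_fun => x; apply: cvgM; first exact: cvg_id.
  apply: cvgV; first by rewrite gt_eqF.
  by apply: cvgD; [exact: exprn_continuous|exact: cvg_cst].
have [->|x0] := eqVneq x 0.
  by rewrite invr0; under eq_fun do rewrite mul0r; exact: cvg_cst.
rewrite [X in _ --> X](_ : _ = x * (x ^+ 2 + 0)^-1); last by field.
apply: cvgM; first exact: cvg_cst.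
apply: cvgV; first by rewrite addr0 expf_neq0.
by apply: cvgD; [exact: cvg_cst|exact: cvg_harmonic].
Qed.

Lemma measurable_row_eq0 {R : realType} {n : nat} d (X : measurableType d)
    (w : 'I_n -> X -> R) : (forall i, measurable_fun setT (w i)) ->
  measurable_fun setT (fun x => (\row_i w i x) == 0).
Proof.
move=> mw; rewrite (_ : (fun _ => _) = (fun x => \sum_(i < n) `|w i x| == 0)).
  apply: measurable_fun_eqr; last exact: measurable_cst.
  by apply: measurable_sum => i; exact: measurableT_comp.
apply/funext => x; rewrite psumr_eq0//; apply/eqP/allP => [w0 i _|h].
  by have /rowP/(_ i) := w0; rewrite !mxE => ->; rewrite /= normr0 eqxx.
apply/rowP => i; have := h i (mem_index_enum i).
by rewrite /= normr_eq0 !mxE => /eqP.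
Qed.

Lemma f_cost_ge0 {R : realType} n (delta r : R) (w : 'rV[R]_n) (z : R) :
  0 < delta -> (0 <= f_cost delta r w z)%E.
Proof.
move=> d0; apply: le_trans (dual_integrand_le_f_cost r w z d0 (fun=> 0) 0).
rewrite lee_fin /dual_integrand !big1 => [|i _|i _]; last 2 first.
- by rewrite expr0n.
- by rewrite mul0r.
by rewrite expr0n /= !mul0r !addr0 !mul0r subr0.
Qed.

Lemma le_measure_Rintegral d (X : measurableType d) (R : realType)
    (m1 : {measure set X -> \bar R}) (m2 : {finite_measure set X -> \bar R})
    (D : set X) (f : X -> R) :
  (forall A, measurable A -> (m1 A <= m2 A)%E) -> measurable D ->
  bounded_mfun setT f -> (forall x, 0 <= f x) ->
  \int[m1]_(x in D) f x <= \int[m2]_(x in D) f x.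
Proof.
move=> m12 mD bf f0; have bfD := bmfS measurableT (@subsetT _ D) bf.
have m1D : (m1 D < +oo)%E by rewrite (le_lt_trans (m12 D mD))// fin_lty.
rewrite /Rintegral fine_le//.
- by apply: integrable_fin_num => //; exact: bmf_integrable.
- by apply: integrable_fin_num => //; apply: bmf_integrable => //; exact: fin_lty.
- by apply: ge0_le_measure_integral => //; apply/measurable_EFinP; case: bf.
Qed.

Section cost_duality.
Context {R : realType} {n : nat}.
Local Notation T := (R * 'rV[R]_n)%type.
Variables (Omega : set 'rV[R]_n) (delta : R) (mu : path_triple R n).
Hypothesis delta0 : 0 < delta.
Local Notation K := (cylinder Omega).
Hypothesis mK : measurable K.
Local Notation lam := (dominant mu).

Lemma rho_dominated : rho mu `<< lam.
Proof.
apply/null_content_dominatesP => A mA; rewrite /= /dominant => /eqP.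
rewrite !padde_eq0 ?adde_ge0 ?sume_ge0 ?measure_ge0//.
by move=> /andP[/andP[/eqP rA0 _] _]; exact: rA0.
Qed.

Lemma total_variation_le_dominant_omega i A : measurable A ->
  (Defs.total_variation (omega mu i) A <= lam A)%E.
Proof.
move=> mA; rewrite /= /dominant (bigD1 i)//=.
rewrite addeAC addeCA leeDl// adde_ge0// ?adde_ge0//.
by apply: sume_ge0 => j _; exact: measure_ge0.
Qed.

Lemma total_variation_le_dominant_zeta A : measurable A ->
  (Defs.total_variation (zeta mu) A <= lam A)%E.
Proof.
move=> mA; rewrite /= /dominant leeDr// adde_ge0//.
by apply: sume_ge0 => j _; exact: measure_ge0.
Qed.

Lemma dominated_of_variation nu :
  (forall A, measurable A -> (Defs.total_variation nu A <= lam A)%E) ->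
  nu `<< lam.
Proof.
move=> h; apply/null_content_dominatesP => A mA A0.
have /abse_charge_variation : measurable A by [].
move=> /(_ _ nu _ _ (hahn_choice nu)) h1.
apply/eqP; rewrite -abse_eq0 eq_le abse_ge0 andbT -A0.
by apply: le_trans h1 _; exact: h.
Qed.

Lemma omega_dominated i : omega mu i `<< lam.
Proof.
by apply: dominated_of_variation => A mA; exact: total_variation_le_dominant_omega.
Qed.

Lemma zeta_dominated : zeta mu `<< lam.
Proof.
by apply: dominated_of_variation => A mA; exact: total_variation_le_dominant_zeta.
Qed.

(** The integral of the dual integrands for the fields b and c, expressed without any
    density. *)
Definition dual_value (b : 'I_n -> T -> R) (c : T -> R) : R :=
  \sum_(i < n) cintegral (omega mu i) K (b i) + cintegral (zeta mu) K c
  - (\int[rho mu]_(p in K)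
      (\sum_(i < n) b i p ^+ 2 + c p ^+ 2 / delta ^+ 2)) / 2.

Local Notation rd := (density (charge_of_finite_measure (rho mu)) lam).
Local Notation wd := (fun p => \row_i density (omega mu i) lam p).
Local Notation zd := (density (zeta mu) lam).

Lemma wfr_costE : wfr_cost Omega delta mu =
  (\int[lam]_(p in K) f_cost delta (rd p) (wd p) (zd p))%E.
Proof. by []. Qed.

Lemma bmf_quad (b : 'I_n -> T -> R) (c : T -> R) :
  (forall i, bounded_mfun K (b i)) -> bounded_mfun K c ->
  bounded_mfun K (fun p => \sum_(i < n) b i p ^+ 2 + c p ^+ 2 / delta ^+ 2).
Proof.
move=> bb bc; apply: bmfD.
  by apply: bmf_sum => i; exact: bmfX.
by apply: bmfM; [exact: bmfX|exact: bmf_cst].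
Qed.

Lemma integrable_dual_integrand (b : 'I_n -> T -> R) (c : T -> R) :
  (forall i, bounded_mfun K (b i)) -> bounded_mfun K c ->
  lam.-integrable K (EFin \o (fun p => dual_integrand delta (rd p) (wd p) (zd p) (b ^~ p) (c p)))
  /\ \int[lam]_(p in K) dual_integrand delta (rd p) (wd p) (zd p) (b ^~ p) (c p)
    = dual_value b c.
Proof.
move=> bb bc.
have bq := bmf_quad bb bc.
have bq2 : bounded_mfun K (fun p => (\sum_(i < n) b i p ^+ 2 + c p ^+ 2 / delta ^+ 2) / 2).
  by apply: bmfM => //; exact: bmf_cst.
have iw i := integrable_bmf_density (omega_dominated i) mK (bb i).
have iz := integrable_bmf_density zeta_dominated mK bc.
have ir := @integrable_bmf_density _ _ _ (charge_of_finite_measure (rho mu)) lam rho_dominated _ _ mK bq2.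
have isum : lam.-integrable K (EFin \o (fun p => \sum_(i < n) b i p * density (omega mu i) lam p)).
  apply: (eq_integrable mK (fun p => (\sum_(i < n) (b i p * density (omega mu i) lam p)%:E)%E)).
    by move=> p _ /=; rewrite sumEFin.
  by apply: integrable_sum => // i _; exact: iw.
have i12 : lam.-integrable K (EFin \o (fun p =>
    \sum_(i < n) b i p * density (omega mu i) lam p + c p * zd p)).
  by have := integrableD mK isum iz; apply: eq_integrable => // p _ /=; rewrite EFinD.
have E p : dual_integrand delta (rd p) (wd p) (zd p) (b ^~ p) (c p) =
   (\sum_(i < n) b i p * density (omega mu i) lam p + c p * zd p) -
   (\sum_(i < n) b i p ^+ 2 + c p ^+ 2 / delta ^+ 2) / 2 * rd p.
  rewrite /dual_integrand; congr (_ + _ - _).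
  by apply: eq_bigr => i _; rewrite mxE.
split.
  have := integrableB mK i12 ir; apply: eq_integrable => // p _.
  by rewrite /= E EFinB.
under eq_Rintegral do rewrite E.
rewrite RintegralB// RintegralD// Rintegral_sum// /dual_value.
congr (_ + _ - _).
- by apply: eq_bigr => i _; rewrite (cintegral_density (omega_dominated i)).
- by rewrite (cintegral_density zeta_dominated).
- rewrite (Rintegral_density rho_dominated mK bq2).
  under eq_Rintegral do rewrite mulrC.
  rewrite RintegralZl//; first by rewrite mulrC.
  by apply: bmf_integrable => //; exact: fin_lty.
Qed.

Lemma measurable_cost_integrand :
  measurable_fun setT (fun p => f_cost delta (rd p) (wd p) (zd p)).
Proof.
have mr : measurable_fun setT rd := @measurable_density _ _ _ (charge_of_finite_measure (rho mu)) lam rho_dominated.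
have mw i : measurable_fun setT (density (omega mu i) lam) := measurable_density (omega_dominated i).
have mz : measurable_fun setT zd := measurable_density zeta_dominated.
rewrite /f_cost; apply: measurable_fun_ifT => /=.
- by apply: measurable_fun_ltr.
- apply/measurable_EFinP; apply: measurable_funM.
  + apply: measurable_funD.
      apply: measurable_sum => i; apply: measurable_funX.
      by under eq_fun do rewrite mxE; exact: mw.
    by apply: measurable_funM => //; exact: measurable_funX.
  + by apply: (measurableT_comp measurable_inv); exact: measurable_funM.
- apply: measurable_fun_ifT => //=.
  apply: measurable_and; first exact: measurable_fun_eqr.
  apply: measurable_and; last exact: measurable_fun_eqr.
  exact: measurable_row_eq0.
Qed.

Lemma dual_le_cost (b : 'I_n -> T -> R) (c : T -> R) :
  (wfr_cost Omega delta mu < +oo)%E ->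
  (forall i, bounded_mfun K (b i)) -> bounded_mfun K c ->
  ((dual_value b c)%:E <= wfr_cost Omega delta mu)%E.
Proof.
move=> fin bb bc; have [id dE] := integrable_dual_integrand bb bc.
have iF : lam.-integrable K (fun p => f_cost delta (rd p) (wd p) (zd p)).
  apply/integrableP; split; first exact: measurable_funTS measurable_cost_integrand.
  rewrite (eq_integral (fun p => f_cost delta (rd p) (wd p) (zd p))).
    by move: fin; rewrite wfr_costE.
  by move=> p _; rewrite gee0_abs// f_cost_ge0.
rewrite -dE wfr_costE /Rintegral fineK; last exact: integrable_fin_num.
by apply: le_integral => // p _; exact: dual_integrand_le_f_cost.
Qed.

Lemma cintegral_dist_dominant nu (f g : T -> R) :
  (forall A, measurable A -> (Defs.total_variation nu A <= lam A)%E) ->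
  bounded_mfun setT f -> bounded_mfun setT g ->
  `|cintegral nu K f - cintegral nu K g| <= \int[lam]_(p in K) `|f p - g p|.
Proof.
move=> nul bf bg; have bfK := bmfS measurableT (@subsetT _ K) bf.
have bgK := bmfS measurableT (@subsetT _ K) bg.
rewrite (le_trans (cintegral_dist nu mK bfK bgK))//.
rewrite -Rintegral_measure_add//; last by apply: bmf_norm; exact: bmfB.
have h : forall A, measurable A ->
    (measure_add (jpos nu) (jneg nu) A <= lam A)%E.
  move=> A mA; apply: le_trans (nul A mA).
  by rewrite /= /measure_add /= /msum !big_ord_recr !big_ord0 /= add0e.
by apply: (le_measure_Rintegral h) => //; apply: bmf_norm; exact: bmfB.
Qed.

Section sufficient.
Variable E0 : R.
Hypothesis dualE0 : forall (b : 'I_n -> T -> R) (c : T -> R) (B : R),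
  (forall i, continuous (b i)) -> continuous c ->
  (forall i p, `|b i p| <= B) -> (forall p, `|c p| <= B) -> dual_value b c <= E0.

(** Fields that are only measurable are approximated by continuous ones with the same
    bounds, in the mean with respect to the measure that dominates rho, omega and zeta. *)
Lemma dual_value_le_bounded (b : 'I_n -> T -> R) (c : T -> R) (B : R) : 0 < B ->
  (forall i, measurable_fun setT (b i)) -> measurable_fun setT c ->
  (forall i p, `|b i p| <= B) -> (forall p, `|c p| <= B) -> dual_value b c <= E0.
Proof.
move=> B0 mb mc bB cB; apply/ler_addgt0Pr => e e0.
have d2 : 0 < delta ^+ 2 by rewrite exprn_gt0.
pose C := n%:R + 1 + B * (n%:R + 1 / delta ^+ 2).
have C0 : 0 < C.
  rewrite /C ltr_pwDl// ?ltr_wpDl// mulr_ge0 ?addr_ge0 ?divr_ge0// ltW//.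
have a0 : 0 < e / C by rewrite divr_gt0.
set a := e / C in a0.
have aE : C * a = e by rewrite /a mulrC divfK// gt_eqF.
have hb i := bounded_approximable lam mK B0 a0 (mb i) (bB i).
have [c' [cc' c'B hc']] := bounded_approximable lam mK B0 a0 mc cB.
pose b' i := sval (cid (hb i)).
have b'P i : [/\ continuous (b' i), (forall p, `|b' i p| <= B) &
  \int[lam]_(p in K) `|b i p - b' i p| <= a] := svalP (cid (hb i)).
have Hd : dual_value b' c' <= E0.
  by apply: (dualE0 (B := B)) => // i; have [] := b'P i.
have bb i : bounded_mfun setT (b i) by split => //; exists B.
have bc : bounded_mfun setT c by split => //; exists B.
have bb' i : bounded_mfun setT (b' i).
  by have [cb bB' _] := b'P i; exact: (@continuous_bmf _ _ _ B).
have bc' : bounded_mfun setT c' by exact: (@continuous_bmf _ _ _ B).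
have sK f : bounded_mfun setT f -> bounded_mfun K f.
  by apply: bmfS => //; exact: subsetT.
have h1 i : `|cintegral (omega mu i) K (b i) - cintegral (omega mu i) K (b' i)| <= a.
  have [_ _ h] := b'P i; apply: le_trans h; apply: cintegral_dist_dominant => //.
  by move=> A; exact: total_variation_le_dominant_omega.
have h2 : `|cintegral (zeta mu) K c - cintegral (zeta mu) K c'| <= a.
  apply: le_trans hc'; apply: cintegral_dist_dominant => //.
  by move=> A; exact: total_variation_le_dominant_zeta.
have rl A : measurable A -> (rho mu A <= lam A)%E.
  move=> mA; rewrite /= /dominant -addeA leeDl// adde_ge0//.
  by apply: sume_ge0 => j _; exact: measure_ge0.
have hq f g : bounded_mfun setT f -> bounded_mfun setT g ->
    (forall p, `|f p| <= B) -> (forall p, `|g p| <= B) ->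
    \int[lam]_(p in K) `|f p - g p| <= a ->
    \int[rho mu]_(p in K) (g p ^+ 2) - \int[rho mu]_(p in K) (f p ^+ 2) <= 2 * B * a.
  move=> bf bg fB gB fg; have bfg : bounded_mfun setT (fun p => `|f p - g p|).
    by apply: bmf_norm; exact: bmfB.
  have rK := fin_lty (rho mu) mK.
  rewrite -RintegralB//; try by apply: bmf_integrable => //; apply: sK; exact: bmfX.
  apply: (@le_trans _ _ (\int[rho mu]_(p in K) (2 * B * `|f p - g p|))).
    apply: le_Rintegral => //.
    - by apply: bmf_integrable => //; apply: sK; apply: bmfB; exact: bmfX.
    - by apply: bmf_integrable => //; apply: sK; exact: bmfZ.
    - move=> p _; rewrite subr_sqr mulrC.
      rewrite (le_trans (ler_norm _))// normrM distrC ler_wpM2r//.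
      by rewrite (le_trans (ler_normD _ _))//; have := fB p; have := gB p; lra.
  rewrite RintegralZl//; last by apply: bmf_integrable => //; exact: sK.
  rewrite ler_wpM2l//; first by rewrite mulr_ge0// ltW.
  by apply: le_trans fg; exact: le_measure_Rintegral.
have quadE (u : 'I_n -> T -> R) (v : T -> R) :
    (forall i, bounded_mfun setT (u i)) -> bounded_mfun setT v ->
    \int[rho mu]_(p in K) (\sum_(i < n) u i p ^+ 2 + v p ^+ 2 / delta ^+ 2) =
    \sum_(i < n) \int[rho mu]_(p in K) (u i p ^+ 2) +
      \int[rho mu]_(p in K) (v p ^+ 2) / delta ^+ 2.
  move=> bu bv; have rK := fin_lty (rho mu) mK.
  have iu i : (rho mu).-integrable K (EFin \o (fun p => u i p ^+ 2)).
    by apply: bmf_integrable => //; apply: sK; exact: bmfX.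
  have iv : (rho mu).-integrable K (EFin \o (fun p => v p ^+ 2)).
    by apply: bmf_integrable => //; apply: sK; exact: bmfX.
  rewrite RintegralD//; last 2 first.
  - by apply: bmf_integrable => //; apply: sK; apply: bmf_sum => i; exact: bmfX.
  - apply: bmf_integrable => //; apply: sK; apply: bmfM; last exact: bmf_cst.
    exact: bmfX.
  by rewrite Rintegral_sum// RintegralZr.
have h3 i := hq _ _ (bb i) (bb' i) (bB i) (let: And3 _ h _ := b'P i in h)
  (let: And3 _ _ h := b'P i in h).
have h4 := hq _ _ bc bc' cB c'B hc'.
have s1 : \sum_(i < n) cintegral (omega mu i) K (b i) -
    \sum_(i < n) cintegral (omega mu i) K (b' i) <= n%:R * a.
  rewrite -sumrB -[n in leRHS]card_ord mulr_natl -sumr_const.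
  by apply: ler_sum => i _; exact: le_trans (ler_norm _) (h1 i).
have s2 := le_trans (ler_norm _) h2.
have s3 : \sum_(i < n) \int[rho mu]_(p in K) (b' i p ^+ 2) -
    \sum_(i < n) \int[rho mu]_(p in K) (b i p ^+ 2) <= n%:R * (2 * B * a).
  rewrite -sumrB -[n in leRHS]card_ord mulr_natl -sumr_const.
  by apply: ler_sum => i _; exact: h3.
have s4 : (\int[rho mu]_(p in K) (c' p ^+ 2) - \int[rho mu]_(p in K) (c p ^+ 2))
    / delta ^+ 2 <= 2 * B * a / delta ^+ 2.
  by rewrite ler_pM2r ?invr_gt0.
move: Hd; rewrite /dual_value !quadE// -aE /C.
move: s1 s2 s3 s4.
set S1 := \sum_(i < n) cintegral _ _ (b i); set S1' := \sum_(i < n) cintegral _ _ (b' i).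
set S2 := \sum_(i < n) Rintegral _ _ (fun x => b i x ^+ 2).
set S2' := \sum_(i < n) Rintegral _ _ (fun x => b' i x ^+ 2).
lra.
Qed.

End sufficient.

End cost_duality.

(** * The cost as a supremum over continuous fields *)

Lemma measurable_forall d (X : measurableType d) (n : nat) (f : 'I_n -> X -> bool) :
  (forall i, measurable_fun setT (f i)) ->
  measurable_fun setT (fun x => [forall i, f i x]).
Proof.
move=> mf; apply: (measurable_fun_bool true).
rewrite setTI (_ : _ @^-1` _ = \bigcap_(i in [set: 'I_n]) (f i @^-1` [set true])).
  apply: fin_bigcap_measurable => [|i _]; first exact: finite_finset.
  by rewrite -[X in measurable X]setTI; exact: mf.
by apply/seteqP; split=> x /=; [move=> /forallP h i _; exact: h|move=> h; apply/forallP => i; exact: h].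
Qed.

Section cost_sufficient.
Context {R : realType} {n : nat}.
Local Notation T := (R * 'rV[R]_n)%type.
Variables (Omega : set 'rV[R]_n) (delta : R) (mu : path_triple R n).
Hypothesis delta0 : 0 < delta.
Local Notation K := (cylinder Omega).
Hypothesis mK : measurable K.
Local Notation lam := (dominant mu).
Local Notation rd := (density (charge_of_finite_measure (rho mu)) lam).
Local Notation wd := (fun p => \row_i density (omega mu i) lam p).
Local Notation zd := (density (zeta mu) lam).

Lemma density_rho_ge0 : ae_eq lam K rd (fun p => Num.max (rd p) 0).
Proof.
have := ae_eq_Radon_Nikodym_SigmaFinite (@rho_dominated _ _ mu) mK.
apply: filterS => p h Kp; have := h Kp.
rewrite -(@EFin_density _ _ _ (charge_of_finite_measure (rho mu)) lam (@rho_dominated _ _ mu)).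
have := Radon_Nikodym_SigmaFinite.f_ge0 (@rho_dominated _ _ mu) p.
by move=> /[swap] ->; rewrite lee_fin => h0; rewrite max_l.
Qed.

Variable E0 : R.
Hypothesis dualE0 : forall (b : 'I_n -> T -> R) (c : T -> R) (B : R),
  (forall i, continuous (b i)) -> continuous c ->
  (forall i p, `|b i p| <= B) -> (forall p, `|c p| <= B) ->
  dual_value Omega delta mu b c <= E0.

(** The truncated optimal fields are bounded and measurable, and their dual values
    increase to the cost. As a consequence the cost is lower semicontinuous: a dual value
    with continuous fields is continuous for weak convergence. *)
Lemma wfr_cost_le : (wfr_cost Omega delta mu <= E0%:E)%E.
Proof.
pose rp p := Num.max (rd p) 0.
have rp0 p : 0 <= rp p by rewrite le_max lexx orbT.
have mr : measurable_fun setT rd := @measurable_density _ _ _ (charge_of_finite_measure (rho mu)) lam (@rho_dominated _ _ mu).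
have mrp : measurable_fun setT rp by apply: measurable_maxr.
have mw i : measurable_fun setT (density (omega mu i) lam) := measurable_density (@omega_dominated _ _ mu i).
have mz : measurable_fun setT zd := measurable_density (@zeta_dominated _ _ mu).
pose bN N i p := optimal_b (rp p) (wd p) (zd p) N i.
pose cN N p := optimal_c delta (rp p) (wd p) (zd p) N.
have mpos : measurable_fun setT (fun p => 0 < rp p) by exact: measurable_fun_ltr.
have mrange N : measurable_fun setT (fun p => optimal_range (rp p) (wd p) (zd p) N).
  apply: measurable_and.
    apply: measurable_forall => i; apply: measurable_fun_ler.
      by under eq_fun do rewrite mxE; exact: measurableT_comp.
    exact: measurable_funM.
  apply: measurable_fun_ler; first exact: measurableT_comp.
  exact: measurable_funM.
have mfrac (f : T -> R) : measurable_fun setT f ->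
    measurable_fun setT (fun p => f p / (1 + `|f p|)).
  move=> mf; apply: measurable_funM => //; apply: (measurableT_comp measurable_inv).
  by apply: measurable_funD => //; exact: measurableT_comp.
have mquot (f : T -> R) : measurable_fun setT f ->
    measurable_fun setT (fun p => f p / rp p).
  by move=> mf; apply: measurable_funM => //; exact: (measurableT_comp measurable_inv).
have mb N i : measurable_fun setT (bN N i).
  rewrite /bN /optimal_b; under eq_fun do rewrite mxE.
  apply: measurable_fun_ifT => //.
    by apply: measurable_fun_ifT => //; exact: mquot.
  by apply: measurable_funM => //; exact: mfrac.
have mc N : measurable_fun setT (cN N).
  rewrite /cN /optimal_c; apply: measurable_fun_ifT => //.
    apply: measurable_fun_ifT => //.
    by apply: measurable_funM => //; exact: mquot.
  by apply: measurable_funM => //; exact: mfrac.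
pose B (N : nat) : R := N%:R * (1 + delta ^+ 2) + 1.
have d2 : 0 < delta ^+ 2 by rewrite exprn_gt0.
have NB N : N%:R * (1 + delta ^+ 2) <= B N by rewrite lerDl.
have B0 N : 0 < B N by rewrite ltr_wpDl// mulr_ge0// addr_ge0// ltW.
have bB N i p : `|bN N i p| <= B N.
  apply: le_trans (NB N); apply: (le_trans (optimal_b_le _ _ _ _ _)) => //.
  by rewrite ler_peMr// lerDl ltW.
have cB N p : `|cN N p| <= B N.
  by apply: le_trans (NB N); exact: optimal_c_le.
have dual_le N : dual_value Omega delta mu (bN N) (cN N) <= E0.
  by apply: (@dual_value_le_bounded _ _ _ delta mu delta0 mK E0 dualE0 (bN N) (cN N) (B N)).
have bb N i : bounded_mfun K (bN N i).
  by split; [exact: measurable_funTS|exists (B N)].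
have bc N : bounded_mfun K (cN N).
  by split; [exact: measurable_funTS|exists (B N)].
pose G N p := optimal_value delta (rp p) (wd p) (zd p) N.
have mG N : measurable_fun setT (G N).
  apply: (@measurable_funB _ _ _ _ (fun p => \sum_(i < n) bN N i p * (wd p) ord0 i + cN N p * zd p)
    (fun p => (\sum_(i < n) bN N i p ^+ 2 + cN N p ^+ 2 / delta ^+ 2) / 2 * rp p)).
    apply: measurable_funD; last by apply: measurable_funM; [exact: mc|exact: mz].
    apply: measurable_sum => i; apply: measurable_funM; first exact: mb.
    by under eq_fun do rewrite mxE; exact: mw.
  apply: measurable_funM => //; apply: measurable_funM => //.
  apply: measurable_funD.
    by apply: measurable_sum => i; apply: measurable_funX; exact: mb.
  by apply: measurable_funM => //; apply: measurable_funX; exact: mc.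
pose F p := f_cost delta (rp p) (wd p) (zd p).
have GF p : (fun N => (G N p)%:E) @ \oo --> F p by exact: optimal_value_cvg.
have mF : measurable_fun setT F.
  apply: (@emeasurable_fun_cvg _ _ _ _ (fun N p => (G N p)%:E)) => // N.
  exact/measurable_EFinP.
have -> : wfr_cost Omega delta mu = (\int[lam]_(p in K) F p)%E.
  rewrite wfr_costE; apply: ae_eq_integral => //.
  - by apply: measurable_funTS; exact: measurable_cost_integrand.
  - exact: measurable_funTS.
  - by have := density_rho_ge0; apply: filterS => p h Kp; rewrite /F /rp -h.
have GE N : (\int[lam]_(p in K) (G N p)%:E <= E0%:E)%E.
  have [id dE] := integrable_dual_integrand delta mu mK (bb N) (bc N).
  have -> : (\int[lam]_(p in K) (G N p)%:E = \int[lam]_(p in K)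
      (dual_integrand delta (rd p) (wd p) (zd p) ((bN N) ^~ p) (cN N p))%:E)%E.
    apply: ae_eq_integral => //.
    - by apply/measurable_EFinP; exact: measurable_funTS.
    - exact: measurable_int id.
    - have := density_rho_ge0; apply: filterS => p h Kp.
      by rewrite /G /optimal_value /dual_integrand [in RHS]h.
  rewrite -[leLHS]fineK; last exact: integrable_fin_num.
  by rewrite lee_fin; apply: le_trans (dual_le N); rewrite -dE.
have FE : (\int[lam]_(p in K) F p = limn (fun N => \int[lam]_(p in K) (G N p)%:E))%E.
  rewrite -monotone_convergence//.
  - by apply: eq_integral => p _; apply/esym/cvg_lim.
  - by move=> N; apply/measurable_EFinP; exact: measurable_funTS.
  - by move=> N p _; rewrite lee_fin optimal_value_ge0.
  - by move=> p _ N N' NN; rewrite lee_fin optimal_value_nd.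
rewrite FE; apply: lime_le; last by exact: nearW.
apply: ereal_nondecreasing_is_cvgn => N N' NN; apply: ge0_le_integral => //.
- by move=> p _; rewrite lee_fin optimal_value_ge0.
- by apply/measurable_EFinP; exact: measurable_funTS.
- by apply/measurable_EFinP; exact: measurable_funTS.
- by move=> p _; rewrite lee_fin optimal_value_nd.
Qed.

End cost_sufficient.

(** * Test functions of time *)

Section time_test_functions.
Context {R : realType} {n : nat}.
Local Notation T := (R * 'rV[R]_n)%type.
Local Notation leb := (@lebesgue_measure R).

Lemma differentiable_time (Phi : R -> R) (p : T) :
  (forall t, derivable Phi t 1) -> differentiable (fun q : T => Phi q.1) p.
Proof.
move=> dPhi; apply: (@differentiable_comp _ T R R fst Phi); last exact/derivable1_diffP.
have lf : linear (fst : T -> R) by move=> a u v.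
pose fM := GRing.isLinear.Build _ _ _ _ _ lf.
pose fL : {linear T -> R} := HB.pack (fst : T -> R) fM.
have -> : fst = fL :> (T -> R) by [].
by apply: linear_differentiable => q; exact: cvg_fst.
Qed.

Lemma derive_time (Phi : R -> R) (p v : T) :
  (forall t, derivable Phi t 1) ->
  'D_v (fun q : T => Phi q.1) p = v.1 * derive1 Phi p.1.
Proof.
move=> dPhi; have dP t : differentiable Phi t by exact/derivable1_diffP.
have -> : 'D_v (fun q : T => Phi q.1) p = 'D_(v.1) Phi p.1 by [].
rewrite deriveE// derive1E deriveE// -[v.1 in LHS]mulr1.
by rewrite -[_ * 1]/(v.1 *: (1 : R)) linearZ.
Qed.

(** A primitive of chi on [0, 1]. Away from [0, 1], chi is first cut off, which makes it
    integrable on the whole line without changing the derivative on [0, 1]. *)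
Lemma time_primitive (chi : R -> R) : continuous chi ->
  (forall t, 0 <= chi t <= 1) ->
  exists Phi : R -> R, [/\ (forall t, derivable Phi t 1), continuous (derive1 Phi),
    (forall t, t \in `[0, 1] -> derive1 Phi t = chi t),
    Phi 1 = 0 /\ Phi 0 = - \int[leb]_(t in `[0, 1]) chi t &
    (forall t, t \in `[0, 1] -> `|Phi t| <= \int[leb]_(t in `[0, 1]) chi t)].
Proof.
move=> cchi chi01.
pose cut (t : R) := Num.max 0 (Num.min 1 (2 - `|t|)).
have cut0 t : 0 <= cut t by rewrite le_max lexx.
have cut1 t : cut t <= 1 by rewrite ge_max ler01 ge_min lexx.
have ccut : continuous cut.
  move=> t; apply: (@continuous_max R R (cst 0) (fun t => Num.min 1 (2 - `|t|)) t).
    exact: cvg_cst.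
  apply: (@continuous_min R R (cst 1) (fun t => 2 - `|t|) t); first exact: cvg_cst.
  by apply: cvgB; [exact: cvg_cst|exact: norm_continuous].
pose f t := chi t * cut t.
have cf : continuous f by move=> t; apply: cvgM; [exact: cchi|exact: ccut].
have f0 t : 0 <= f t by rewrite mulr_ge0//; have /andP[] := chi01 t.
have mf : measurable_fun setT f by exact: continuous_measurable_fun.
have f1 t : f t <= 1.
  by have /andP[c0 c1] := chi01 t; rewrite (le_trans (ler_wpM2l c0 (cut1 t)))// mulr1.
have fsupp t : t \notin `[-2, 2] -> f t = 0.
  move=> tn; have : 2 - `|t| <= 0.
    move: tn; rewrite in_itv/= -ler_norml -ltNge; lra.
  by move=> h; rewrite /f /cut min_r ?max_l ?mulr0//; lra.
have fi : leb.-integrable setT (EFin \o f).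
  have i1 : leb.-integrable (`[-2, 2] : set R) (EFin \o f).
    apply: bmf_integrable => //.
      by rewrite /= lebesgue_measure_itv/=; case: ifP => _; rewrite ?ltry// -EFinB ltry.
    split; first exact: measurable_funTS.
    by exists 1 => t _; rewrite ger0_norm.
  move/integrable_mkcond : i1 => /(_ (measurable_itv _)).
  congr (integrable _ _ _); apply/funext => t; rewrite /patch.
  by case: ifPn => // tn; rewrite /= fsupp//; apply: contra tn; rewrite inE.
have fiD D : measurable D -> leb.-integrable D (EFin \o f).
  by move=> mD; apply: integrableS fi.
pose Psi t := \int[leb]_(s in `]-oo, t]%classic) f s.
have FTC t : derivable Psi t 1 /\ derive1 Psi t = f t.
  have tu : t < t + 1 by rewrite ltrDl.
  apply: (@continuous_FTC1 R f -oo%O t (t + 1) tu) => //.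
  - by apply: fiD; exact: measurable_itv.
  - by rewrite ltNyr.
  - exact: cf.
have dP t : derivable Psi t 1 := (FTC t).1.
have PE t := (FTC t).2.
pose Phi t := Psi t - Psi 1.
have dPhi t : derivable Phi t 1 by apply: derivableB; [exact: dP|exact: derivable_cst].
have PhiE t : derive1 Phi t = f t.
  rewrite derive1E deriveB//.
  by rewrite derive_cst subr0 -derive1E PE.
have cutE t : t \in `[0, 1] -> cut t = 1.
  rewrite in_itv/= => /andP[t0 t1]; rewrite /cut ger0_norm//.
  by rewrite min_l ?max_r//; lra.
have fE t : t \in `[0, 1] -> f t = chi t by move=> /cutE h; rewrite /f h mulr1.
have PsiB a b : a <= b -> Psi b - Psi a = \int[leb]_(s in `]a, b]) f s.
  move=> ab; rewrite /Psi Rintegral_itvB//; exact: fiD.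
have intE : \int[leb]_(s in `]0, 1]) f s = \int[leb]_(t in `[0, 1]) chi t.
  rewrite Rintegral_itv_obnd_cbnd; last exact: fiD.
  by apply: eq_Rintegral => t; rewrite inE => /fE.
exists Phi; split; first exact: dPhi.
- by move=> t; rewrite (_ : derive1 Phi = f); [exact: cf|exact/funext].
- by move=> t t01; rewrite PhiE fE.
- by split; [rewrite /Phi subrr|rewrite -intE -PsiB// opprB].
- move=> t; rewrite in_itv/= => /andP[t0 t1].
  have h1 : 0 <= Psi 1 - Psi t by rewrite PsiB//; exact: Rintegral_ge0.
  have h2 : 0 <= Psi t - Psi 0 by rewrite PsiB//; exact: Rintegral_ge0.
  by rewrite distrC ger0_norm// -intE -PsiB//; lra.
Qed.

End time_test_functions.

(** * Mass estimates from the continuity equation *)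

Lemma jpos_hahn d (X : measurableType d) (R : realType)
    (nu : {charge set X -> \bar R}) :
  exists P, measurable P /\ forall A, measurable A -> jpos nu A = nu (A `&` P).
Proof.
have [[mP _] _ _ _] := hahn_choice nu; exists (sval (cid (Hahn_decomposition nu))).
split => // A mA.
by rewrite /jpos /= jordan_posE cjordan_posE /crestr0 mem_set.
Qed.

Lemma jneg_hahn d (X : measurableType d) (R : realType)
    (nu : {charge set X -> \bar R}) :
  exists N, measurable N /\
    forall A, measurable A -> jneg nu A = (- nu (A `&` N))%E.
Proof.
have [_ [mN _] _ _] := hahn_choice nu.
exists (sval (cid (svalP (cid (Hahn_decomposition nu))))); split => // A mA.
by rewrite /jneg /= jordan_negE cjordan_negE /crestr0 mem_set.
Qed.

Section continuity_equation.
Context {R : realType} {n : nat}.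
Local Notation T := (R * 'rV[R]_n)%type.
Local Notation leb := (@lebesgue_measure R).
Variables (Omega : set 'rV[R]_n) (delta : R) (mu : path_triple R n).
Variables (rho0 rho1 : {finite_measure set 'rV[R]_n -> \bar R}).
Hypothesis delta0 : 0 < delta.
Local Notation K := (cylinder Omega).
Hypothesis mO : measurable Omega.

Lemma cintegral0 d (X : measurableType d) (nu : {charge set X -> \bar R}) D :
  cintegral nu D (cst 0) = 0.
Proof. by rewrite cintegralE /Rintegral !integral0_eq// subrr. Qed.

Lemma measurable_cylinder : measurable K.
Proof. by apply: measurableX => //; exact: measurable_itv. Qed.
Local Notation mK := measurable_cylinder.

Definition mass_on (nu : {charge set T -> \bar R}) (A : set T) : R :=
  fine (jpos nu A) + fine (jneg nu A).

Lemma mass_on_ge0 nu A : 0 <= mass_on nu A.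
Proof. by rewrite addr_ge0// fine_ge0. Qed.

Lemma cintegral_le (nu : {charge set T -> \bar R}) (f : T -> R) (c : R) :
  bounded_mfun K f -> (forall p, K p -> `|f p| <= c) ->
  `|cintegral nu K f| <= c * mass_on nu K.
Proof.
move=> bf fc; have b0 : bounded_mfun K (cst 0 : T -> R) by exact: bmf_cst.
have := cintegral_dist nu mK bf b0.
rewrite [X in _ - X](_ : _ = 0); last exact: cintegral0.
rewrite subr0 => /le_trans; apply; rewrite /mass_on mulrDr.
have le (m : {finite_measure set T -> \bar R}) : \int[m]_(p in K) `|f p - cst 0 p|
    <= c * fine (m K).
  rewrite -(Rintegral_cst _ mK); apply: le_Rintegral => //; first exact: mK.
  - by apply: bmf_integrable => //; [exact: mK|exact: fin_lty mK|apply: bmf_norm; exact: bmfB].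
  - by apply: bmf_integrable => //; [exact: mK|exact: fin_lty mK|exact: bmf_cst].
  - by move=> p Kp; rewrite subr0 fc.
by apply: lerD; exact: le.
Qed.

Hypothesis muCE : CE Omega rho0 rho1 mu.

(** The continuity equation is tested with a primitive of chi that vanishes at time 1. In
    absolute value this primitive is at most the integral of chi over [0, 1], which bounds
    the contributions of rho0 and of zeta. *)
Lemma CE_time_bound (chi : R -> R) : continuous chi ->
  (forall t, 0 <= chi t <= 1) ->
  \int[rho mu]_(p in K) chi p.1 <=
    (fine (rho0 Omega) + mass_on (zeta mu) K) * \int[leb]_(t in `[0, 1]) chi t.
Proof.
move=> cchi chi01; have [Phi [dPhi cPhi PhiE [Phi1 Phi0] Phic]] := time_primitive cchi chi01.
set c := \int[leb]_(t in `[0, 1]) chi t in Phi0 Phic *.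
pose phi (p : T) := Phi p.1.
have dphi p v : 'D_v phi p = v.1 * derive1 Phi p.1 by exact: derive_time.
have C1 : is_C1 phi.
  split=> [p|v]; first exact: differentiable_time.
  rewrite (_ : (fun p => _) = (fun p : T => v.1 * derive1 Phi p.1)); last exact/funext.
  move=> p; apply: cvgM; first exact: cvg_cst.
  by apply: continuous_comp; [exact: cvg_fst|exact: cPhi].
have bphi : bounded_mfun K phi.
  apply: (@continuous_bmf _ _ _ c) => //; first exact: mK.
    by move=> p; apply/differentiable_continuous/differentiable_time.
  by move=> p [p1 _]; exact: Phic.
have [_ _ _ /(_ phi C1)] := muCE.
rewrite (@eq_Rintegral _ _ _ _ _ (fun p => chi p.1)); last first.
  by move=> p; rewrite inE => -[p1 _]; rewrite /dt dphi mul1r PhiE.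
rewrite big1 => [|i _]; last first.
  rewrite (@eq_cintegral _ _ _ _ _ _ (cst 0)).
    exact: cintegral0.
  by move=> p _; rewrite /dx dphi mul0r.
rewrite addr0 /phi/= Phi1 Phi0 !Rintegral_cst// mul0r sub0r mulNr opprK => E.
have := cintegral_le (zeta mu) bphi (fun p Kp => Phic _ Kp.1).
rewrite ler_norml => /andP[+ _]; rewrite mulrDl.
move: E; rewrite /phi; lra.
Qed.

Section finite_cost.
Variable E : R.
Hypothesis costE : (wfr_cost Omega delta mu <= E%:E)%E.

Lemma dual_le_cost_fine (b : 'I_n -> T -> R) (c : T -> R) :
  (forall i, bounded_mfun K (b i)) -> bounded_mfun K c ->
  dual_value Omega delta mu b c <= E.
Proof.
move=> bb bc; rewrite -lee_fin; apply: le_trans costE.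
apply: dual_le_cost => //; first exact: mK.
by rewrite (le_lt_trans costE)// ltry.
Qed.

(** What the cost bound gives when it is tested with s times an indicator. *)
Definition quadratically_dominated (nu : {charge set T -> \bar R}) (a : R) : Prop :=
  forall (A : set T) (s : R), measurable A ->
    s * fine (nu (A `&` K)) <= E + s ^+ 2 * a * fine (rho mu (A `&` K)).

Lemma indic_sqr (A : set T) p : (\1_A p : R) ^+ 2 = \1_A p.
Proof. by rewrite indicE; case: (_ \in _); rewrite ?expr1n ?expr0n. Qed.

Lemma zeta_quadratically_dominated :
  quadratically_dominated (zeta mu) ((2 * delta ^+ 2)^-1).
Proof.
move=> A s mA; have bA : bounded_mfun K (\1_A : T -> R) by exact: bmf_indic.
have bs : bounded_mfun K (fun p => s * \1_A p) by exact: bmfZ.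
have := @dual_le_cost_fine (fun _ => cst 0) _ (fun i => bmf_cst _ _) bs.
rewrite /dual_value big1 => [|i _]; last exact: cintegral0.
rewrite add0r (cintegralZ _ mK)// (cintegral_indic _ mK)//.
rewrite (@eq_Rintegral _ _ _ _ _ (fun p => s ^+ 2 / delta ^+ 2 * \1_A p)); last first.
  move=> p _; rewrite big1 => [|i _]; last by rewrite /= expr0n.
  by rewrite add0r exprMn indic_sqr mulrAC.
rewrite RintegralZl//; [|exact: mK|]; last first.
  by apply: bmf_integrable => //; [exact: mK|exact: fin_lty mK].
rewrite (Rintegral_indic _ mK)// => h.
have -> : s ^+ 2 * (2 * delta ^+ 2)^-1 = s ^+ 2 / delta ^+ 2 / 2.
  by field; rewrite gt_eqF.
lra.
Qed.

Lemma omega_quadratically_dominated i :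
  quadratically_dominated (omega mu i) 2^-1.
Proof.
move=> A s mA; have bA : bounded_mfun K (\1_A : T -> R) by exact: bmf_indic.
pose b (j : 'I_n) : T -> R := if j == i then fun p => s * \1_A p else cst 0.
have bb j : bounded_mfun K (b j).
  by rewrite /b; case: ifP => _; [exact: bmfZ|exact: bmf_cst].
have := @dual_le_cost_fine b (cst 0) bb (bmf_cst _ _).
rewrite /dual_value (bigD1 i)//= big1 => [|j ji]; last first.
  by rewrite /b (negbTE ji); exact: cintegral0.
rewrite {1}/b eqxx cintegral0 !addr0 (cintegralZ _ mK)// (cintegral_indic _ mK)//.
rewrite (@eq_Rintegral _ _ _ _ _ (fun p => s ^+ 2 * \1_A p)); last first.
  move=> p _; rewrite (bigD1 i)//= big1 => [|j ji]; last by rewrite /b (negbTE ji) expr0n.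
  by rewrite /b eqxx expr0n/= mul0r !addr0 exprMn indic_sqr.
rewrite RintegralZl//; [|exact: mK|]; last first.
  by apply: bmf_integrable => //; [exact: mK|exact: fin_lty mK].
rewrite (Rintegral_indic _ mK)//; lra.
Qed.

(** Add the bounds for the two sets of a Hahn decomposition, with opposite signs of s. *)
Lemma mass_on_le (nu : {charge set T -> \bar R}) (a s : R) :
  0 <= a -> 0 < s -> quadratically_dominated nu a ->
  mass_on nu K <= 2 * E / s + 2 * s * a * fine (rho mu K).
Proof.
move=> a0 s0 h; have [P [mP PE]] := jpos_hahn nu; have [N [mN NE]] := jneg_hahn nu.
have := h P s mP; have := h N (- s) mN.
have rle A : measurable A -> fine (rho mu (A `&` K)) <= fine (rho mu K).
  move=> mA; apply: le_fine_measure; [|exact: mK|exact: subIsetr].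
  by apply: measurableI => //; exact: mK.
have := rle _ mP; have := rle _ mN; rewrite sqrrN.
rewrite /mass_on PE ?NE; [|exact: mK..].
have fN : fine (- nu (K `&` N)) = - fine (nu (K `&` N)) by case: (nu _) => //=; rewrite oppr0.
rewrite fN ![_ `&` K]setIC.
set x := fine (nu (K `&` N)); set y := fine (nu (K `&` P)).
set r := fine (rho mu K); set r1 := fine (rho _ _); set r2 := fine (rho _ _).
move=> h1 h2 h3 h4.
have sa : 0 <= s ^+ 2 * a by rewrite mulr_ge0// sqr_ge0.
have h5 := ler_wpM2l sa h1; have h6 := ler_wpM2l sa h2.
rewrite (_ : _ + _ * r = (2 * E + 2 * (s ^+ 2 * a * r)) / s); last by field; rewrite gt_eqF.
rewrite ler_pdivlMr//; lra.
Qed.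

(** On a set of rho-measure zero the bound holds for all multiples s of the indicator, so
    that nu vanishes on all its subsets. *)
Lemma jordan_null (nu : {charge set T -> \bar R}) (a : R) (A : set T) :
  quadratically_dominated nu a -> measurable A -> rho mu (A `&` K) = 0%E ->
  jpos nu (A `&` K) = 0%E /\ jneg nu (A `&` K) = 0%E.
Proof.
move=> h mA rA0.
have nul B : measurable B -> nu (B `&` (A `&` K)) = 0%E.
  move=> mB; have mBAK : measurable (B `&` (A `&` K)).
    by do 2 apply: measurableI => //; exact: mK.
  rewrite -[LHS]fineK; last exact: fin_num_measure.
  congr EFin; have hs s : s * fine (nu (B `&` (A `&` K))) <= E.
    have := h _ s (measurableI _ _ mB mA).
    rewrite -setIA (_ : rho mu _ = 0%E) ?mulr0 ?addr0//.
    apply/eqP; rewrite eq_le measure_ge0 andbT -rA0; apply: le_measure; rewrite ?inE//.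
    by apply: measurableI => //; exact: mK.
  apply/eqP; apply: contraT => x0.
  have := hs ((E + 1) / fine (nu (B `&` (A `&` K)))); rewrite divfK//.
  by rewrite gerDl leNgt ltr01.
have mAK : measurable (A `&` K) by apply: measurableI => //; exact: mK.
have [P [mP PE]] := jpos_hahn nu; have [N [mN NE]] := jneg_hahn nu.
by rewrite PE// NE// ![A `&` K `&` _]setIC !nul// oppe0.
Qed.

Lemma rho_mass_le : fine (rho mu K) <= fine (rho0 Omega) + mass_on (zeta mu) K.
Proof.
have := @CE_time_bound (cst 1) (fun t => cvg_cst _) _.
have l1 : fine (leb (`[0, 1]%classic : set R)) = 1.
  by rewrite lebesgue_measure_itv/= lte_fin ltr01 -EFinB subr0.
rewrite (Rintegral_cst _ mK) Rintegral_cst; last exact: measurable_itv.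
rewrite l1 !mul1r mulr1; apply => t; by rewrite /= ler01 lexx.
Qed.

(** With s of order delta ^+ 2, the cost bounds the mass of zeta by half of the mass of
    rho plus a constant, and the continuity equation bounds the mass of rho by that of
    zeta plus a constant: together they bound both. *)
Lemma mass_bounds :
  [/\ fine (rho mu K) <= 2 * (fine (rho0 Omega) + 4 * E / delta ^+ 2),
    mass_on (zeta mu) K <= fine (rho0 Omega) + 8 * E / delta ^+ 2 &
    forall i, mass_on (omega mu i) K <= 2 * E + fine (rho mu K)].
Proof.
have d2 : 0 < delta ^+ 2 by rewrite exprn_gt0.
(* For this value of s the coefficient of the mass of rho in the bound on zeta
   is 1 / 2. *)
have d20 : 0 < delta ^+ 2 / 2 by rewrite divr_gt0.
have a0 : 0 <= (2 * delta ^+ 2)^-1 by rewrite invr_ge0 mulr_ge0// ltW.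
have hz := mass_on_le a0 d20 zeta_quadratically_dominated.
have e1 : 2 * E / (delta ^+ 2 / 2) = 4 * E / delta ^+ 2 by field; rewrite gt_eqF.
have e2 : 2 * (delta ^+ 2 / 2) * (2 * delta ^+ 2)^-1 = 2^-1.
  by field; rewrite gt_eqF.
rewrite e1 e2 in hz; have hr := rho_mass_le.
set x := E / delta ^+ 2.
have x4 : 4 * E / delta ^+ 2 = 4 * x by rewrite /x mulrA.
have x8 : 8 * E / delta ^+ 2 = 8 * x by rewrite /x mulrA.
rewrite x4 in hz *; rewrite x8; split; [lra|lra|move=> i].
have := mass_on_le _ ltr01 (omega_quadratically_dominated i).
by rewrite invr_ge0 => /(_ (ler0n _ _)); rewrite divr1 mulr1 divff// mul1r.
Qed.

End finite_cost.

End continuity_equation.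

(** * Null sets of times *)

Lemma jordan_carried d (X : measurableType d) (R : realType)
    (nu : {charge set X -> \bar R}) (A : set X) :
  nu.-null_set A -> (jpos nu).-null_set A /\ (jneg nu).-null_set A.
Proof.
have [P [mP PE]] := jpos_hahn nu; have [Q [mQ QE]] := jneg_hahn nu.
move=> nuA; split => B mB BA; [rewrite PE//|rewrite QE// nuA ?oppe0//].
- by apply: nuA; [exact: measurableI|move=> p [/BA]].
- exact: measurableI.
- by move=> p [/BA].
Qed.

Section time_marginals.
Context {R : realType} {n : nat}.
Local Notation T := (R * 'rV[R]_n)%type.
Local Notation leb := (@lebesgue_measure R).
Variables (Omega : set 'rV[R]_n) (delta : R) (mu : path_triple R n).
Variables (rho0 rho1 : {finite_measure set 'rV[R]_n -> \bar R}).
Hypothesis delta0 : 0 < delta.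
Local Notation K := (cylinder Omega).
Hypothesis mO : measurable Omega.
Hypothesis muCE : CE Omega rho0 rho1 mu.
Let mK : measurable K := measurable_cylinder mO.

Definition null_in_time (nu : {measure set T -> \bar R}) : Prop :=
  forall N : set R, measurable N -> leb N = 0%E -> nu (N `*` setT) = 0%E.

Lemma measurable_flatten : measurable_fun setT (fun t : R => (t, 0) : T).
Proof. exact: measurable_pair2. Qed.

Lemma lebesgue_unit_lty : (leb `[0%R, 1%R]%classic < +oo)%E.
Proof. by rewrite lebesgue_measure_itv/= lte_fin ltr01 -EFinB ltry. Qed.

Lemma continuous_flatten (phi : T -> R) : continuous phi ->
  continuous (fun t : R => phi (t, 0)).
Proof.
move=> cphi t; apply: (@continuous_comp _ _ _ (fun t : R => (t, 0) : T)); last exact: cphi.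
have h1 : (fun t : R => t) x @[x --> t] --> t by exact: cvg_id.
have h2 : (0 : 'rV[R]_n) @[x --> t] --> (0 : 'rV[R]_n) by exact: cvg_cst.
exact: (cvg_pair h1 h2).
Qed.

(** The time marginal of rho is at most a multiple of Lebesgue measure: continuous
    functions of time suffice to see this. Times are viewed as points of space-time, where
    the comparison of measures is available. *)
Lemma rho_null_in_time : null_in_time (rho mu).
Proof.
move=> N mN N0.
have mI : measurable (`[0, 1]%classic : set R) by exact: measurable_itv.
have mf : measurable_fun setT (fun p : T => (p.1, 0) : T).
  by apply: (measurableT_comp measurable_flatten); exact: measurable_fst.
pose m1 : {finite_measure set T -> \bar R} :=
  @image_measure _ _ _ _ _ (rho mu) _ _ mK (fin_lty (rho mu) mK) mf.
pose m2 : {finite_measure set T -> \bar R} :=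
  @image_measure _ _ _ _ _ leb _ _ mI lebesgue_unit_lty measurable_flatten.
have c0 : 0 <= fine (rho0 Omega) + mass_on (zeta mu) K.
  by rewrite addr_ge0 ?mass_on_ge0 ?fine_ge0.
have mNT : measurable (N `*` setT : set T) by exact: measurableX.
have := @le_measure_continuous _ _ m1 m2 setT _ measurableT c0 _ _ mNT.
rewrite setIT (_ : m2 (N `*` setT) = 0%E); last first.
  rewrite /m2 /= /image_measure; apply/eqP; rewrite eq_le measure_ge0 andbT -N0.
  by apply: le_measure; rewrite ?inE//; [apply: measurableI => //;
    rewrite -[X in measurable X]setTI; exact: measurable_flatten|move=> t [[]]].
rewrite /= mulr0 => h.
have {}h : fine (m1 (N `*` setT)) <= 0.
  apply: h => phi cphi phi01.
  have bphi : bounded_mfun setT phi.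
    apply: (@continuous_bmf _ _ _ 1) => // p _; have /andP[? ?] := phi01 p.
    by rewrite ger0_norm.
  rewrite !Rintegral_image_measure//.
  exact: (CE_time_bound mO muCE (continuous_flatten cphi) (fun t => phi01 (t, 0))).
rewrite (measure_carried mK) //; last by have [] := muCE.
have -> : rho mu (N `*` setT `&` K) = m1 (N `*` setT).
  have e : N `*` setT `&` K = (fun p : T => (p.1, 0) : T) @^-1` (N `*` setT) `&` K.
    by apply/seteqP; split => p [[? ?] ?].
  by rewrite e.
rewrite -[LHS]fineK ?fin_num_measure//; congr EFin.
by apply/eqP; rewrite eq_le h fine_ge0.
Qed.

Lemma jordan_null_in_time (nu : {charge set T -> \bar R}) (E a : R) :
  nu.-null_set (~` K) -> quadratically_dominated Omega mu E nu a ->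
  null_in_time (jpos nu) /\ null_in_time (jneg nu).
Proof.
move=> nuK h.
have null N : measurable N -> leb N = 0%E ->
    jpos nu (N `*` setT) = 0%E /\ jneg nu (N `*` setT) = 0%E.
  move=> mN N0; have mNT : measurable (N `*` setT : set T) by exact: measurableX.
  have r0 : rho mu (N `*` setT `&` K) = 0%E.
    apply/eqP; rewrite eq_le measure_ge0 andbT -(rho_null_in_time mN N0).
    by apply: le_measure; rewrite ?inE//; exact: measurableI.
  have [j1 j2] := jordan_null mO h mNT r0.
  have [pK qK] := jordan_carried nuK.
  by rewrite (measure_carried mK pK mNT) (measure_carried mK qK mNT).
by split => N mN N0; have [] := null N mN N0.
Qed.

End time_marginals.

(** * Densities in time of the masses of cells *)

Lemma ae_forall_countable d (X : measurableType d) (R : realType) (I : countType)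
    (mu : {measure set X -> \bar R}) (P : I -> X -> Prop) :
  (forall w, {ae mu, forall x, P w x}) -> {ae mu, forall x, forall w, P w x}.
Proof.
move=> h; pose Q k x := if unpickle k is Some w then P w x else True.
have : {ae mu, forall x, forall k, Q k x}.
  apply: (@ae_foralln _ _ _ mu Q) => k; rewrite /Q.
  by case: (unpickle k) => [w|]; [exact: h|exact: aeW].
by apply: filterS => x hx w; have := hx (pickle w); rewrite /Q pickleK.
Qed.

Lemma ae_eq_integrable d (X : measurableType d) (R : realType)
    (mu : {measure set X -> \bar R}) (D : set X) (f g : X -> \bar R) :
  measurable D -> measurable_fun D g -> ae_eq mu D f g ->
  mu.-integrable D f -> mu.-integrable D g.
Proof.
move=> mD mg fg /integrableP[mf fi]; apply/integrableP; split=> //.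
have mf' : measurable_fun D (abse \o f) by exact: measurableT_comp.
have mg' : measurable_fun D (abse \o g) by exact: measurableT_comp.
have fg' : ae_eq mu D (abse \o g) (abse \o f).
  by apply: filterS fg => x fg Dx /=; rewrite fg.
by rewrite (ae_eq_integral _ _ mD mg' mf' fg').
Qed.

Section integrable_complements.
Context d (X : measurableType d) (R : realType) (mu : {measure set X -> \bar R}).
Variable D : set X.
Hypothesis mD : measurable D.

Lemma integrable_Rsum (I : Type) (s : seq I) (P : pred I) (f : I -> X -> R) :
  (forall i, mu.-integrable D (EFin \o f i)) ->
  mu.-integrable D (EFin \o (fun x => \sum_(i <- s | P i) f i x)).
Proof.
move=> fi; apply: (eq_integrable mD (fun x => (\sum_(i <- s | P i) (f i x)%:E)%E)).
  by move=> x _ /=; rewrite sumEFin.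
by apply: integrable_sum => // k _; exact: fi.
Qed.

Lemma Rintegral_dist_le (f g h : X -> R) :
  mu.-integrable D (EFin \o f) -> mu.-integrable D (EFin \o g) ->
  mu.-integrable D (EFin \o h) -> (forall x, D x -> `|f x - g x| <= h x) ->
  `|\int[mu]_(x in D) f x - \int[mu]_(x in D) g x| <= \int[mu]_(x in D) h x.
Proof.
move=> fi gi hi fgh; have fgi : mu.-integrable D (EFin \o (fun x => f x - g x)).
  by have := integrableB mD fi gi.
rewrite -RintegralB// (le_trans (le_normr_Rintegral _ _))//.
by apply: le_Rintegral => //; have := integrable_abse fgi.
Qed.

End integrable_complements.

Section sections.
Context d1 d2 (X : measurableType d1) (Y : measurableType d2) (R : realType).
Variables (m1 : {sigma_finite_measure set X -> \bar R}).
Variables (m2 : {sigma_finite_measure set Y -> \bar R}).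
Variable Z : set (X * Y).
Hypotheses (mZ : measurable Z) (Zfin : ((m1 \x m2)%E Z < +oo)%E).
Hypothesis Zsec : forall t, (m2 (xsection Z t) < +oo)%E.

(** Fubini's theorem on a region of finite measure with sections of finite measure. *)
Lemma Rintegral_sections (F : X * Y -> R) : bounded_mfun setT F ->
  m1.-integrable setT
    (EFin \o (fun t => \int[m2]_(s in xsection Z t) F (t, s))) /\
  \int[m1]_t (\int[m2]_(s in xsection Z t) F (t, s)) =
  \int[(m1 \x m2)%E]_(p in Z) F p.
Proof.
move=> bF; have bFZ : bounded_mfun Z F by exact: bmfS bF.
have i1 : (m1 \x m2)%E.-integrable Z (EFin \o F) by exact: bmf_integrable.
have i2 := (integrable_mkcond _ mZ).1 i1.
have secE t : fubini_F m2 ((EFin \o F) \_ Z) t =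
    (\int[m2]_(s in xsection Z t) (F (t, s))%:E)%E.
  rewrite /fubini_F [RHS]integral_mkcond; apply: eq_integral => s _.
  rewrite /patch; congr (if _ then _ else _).
  by apply/idP/idP; rewrite !inE /xsection /= ?inE.
have FE : fubini_F m2 ((EFin \o F) \_ Z) =
    EFin \o (fun t => \int[m2]_(s in xsection Z t) F (t, s)).
  apply/funext => t; rewrite secE /= /Rintegral fineK//.
  have mX : measurable (xsection Z t) by exact: measurable_xsection.
  apply: integrable_fin_num => //; apply: (bmf_integrable mX (Zsec t)).
  case: bF => mF [C FC]; split; last by exists C => s _; exact: FC.
  by apply: measurable_funTS; apply: (measurableT_comp mF); exact: measurable_pair1.
split; first by rewrite -FE; exact: integrable_fubini_F.
rewrite [in LHS]/Rintegral.
have -> : (\int[m1]_t (\int[m2]_(s in xsection Z t) F (t, s))%:E)%E =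
    (\int[m1]_t fubini_F m2 ((EFin \o F) \_ Z) t)%E by rewrite FE.
by rewrite (integral12_prod_meas1 i2) /Rintegral [in RHS]integral_mkcond.
Qed.

End sections.

Section time_weights.
Context {R : realType} {n : nat}.
Local Notation E := 'rV[R]_n.
Local Notation T := (R * E)%type.
Local Notation BR := (measurableTypeR R).
Local Notation leb := (@lebesgue_measure R).
Variable M : R.
Hypothesis M0 : 0 < M.
Variable rho : {finite_measure set T -> \bar R}.
Hypothesis rho_time : null_in_time rho.
Local Notation Box := (@box R n M).
Let mB : measurable Box := measurable_box M0.

Let mfst : measurable_fun setT (fst : T -> BR). Proof. exact: measurable_fst. Qed.

Definition cell_time (w : seq bool) : {finite_measure set BR -> \bar R} :=
  @image_measure _ _ _ _ _ rho _ _ (measurable_cell_box M0 w)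
    (fin_lty rho (measurable_cell_box M0 w)) mfst.

Lemma cell_time_dominated w : cell_time w `<< leb.
Proof.
move=> N; rewrite /null_set => hN A mA AN.
rewrite /cell_time /= /image_measure; apply/eqP.
rewrite eq_le measure_ge0 andbT -(rho_time mA (hN _ mA AN)).
apply: le_measure; rewrite ?inE//; last by move=> p [].
  apply: measurableI; last exact: measurable_cell_box.
  by rewrite -[X in measurable X]setTI; exact: mfst.
exact: measurableX.
Qed.

Definition cell_density w : R -> R :=
  density (charge_of_finite_measure (cell_time w)) leb.

Lemma measurable_cell_density w : measurable_fun setT (cell_density w).
Proof. exact (@measurable_density _ _ _ (charge_of_finite_measure (cell_time w)) leb (cell_time_dominated w)). Qed.

Lemma cell_density_ge0 w : {ae leb, forall t, 0 <= cell_density w t}.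
Proof.
have := ae_eq_Radon_Nikodym_SigmaFinite (cell_time_dominated w) measurableT.
apply: filterS => t h; have := h Logic.I.
rewrite -(@EFin_density _ _ _ (charge_of_finite_measure (cell_time w)) leb (cell_time_dominated w)).
have := Radon_Nikodym_SigmaFinite.f_ge0 (cell_time_dominated w) t.
by move=> /[swap] ->; rewrite lee_fin.
Qed.

Lemma cell_density_rcons w : {ae leb, forall t, cell_density w t =
  cell_density (rcons w false) t + cell_density (rcons w true) t}.
Proof.
have iD v : leb.-integrable setT (EFin \o cell_density v).
  exact (@integrable_density _ _ _ (charge_of_finite_measure (cell_time v)) leb (cell_time_dominated v)).
have ED v A : measurable A -> (\int[leb]_(t in A) (cell_density v t)%:E)%E = cell_time v A.
  move=> mA; transitivity (charge_of_finite_measure (cell_time v) A); last by [].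
  rewrite (Radon_Nikodym_integral (nu := charge_of_finite_measure (cell_time v)) (cell_time_dominated v) mA).
  by rewrite -(@EFin_density _ _ _ (charge_of_finite_measure (cell_time v)) leb (cell_time_dominated v)).
have i2 : leb.-integrable setT (EFin \o (fun t => cell_density (rcons w false) t + cell_density (rcons w true) t)).
  by have := integrableD measurableT (iD (rcons w false)) (iD (rcons w true)).
have : ae_eq leb setT (EFin \o cell_density w)
    (EFin \o (fun t => cell_density (rcons w false) t + cell_density (rcons w true) t)).
  apply: integral_ae_eq => //.
    exact: measurable_int i2.
  move=> A _ mA; rewrite [LHS](ED _ _ mA).
  transitivity (\int[leb]_(t in A) ((cell_density (rcons w false) t)%:E + (cell_density (rcons w true) t)%:E))%E; last by [].
  rewrite integralD//; last 2 first.
  - by apply: integrableS (iD _).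
  - by apply: integrableS (iD _).
  rewrite !ED//= /image_measure cell_rcons setIUr measureU//.
  - apply: measurableI; last exact: measurable_cell_box.
    by rewrite -[X in measurable X]setTI; exact: mfst.
  - apply: measurableI; last exact: measurable_cell_box.
    by rewrite -[X in measurable X]setTI; exact: mfst.
  - by rewrite setIACA cell_rcons_disj setI0.
by apply: filterS => t /(_ Logic.I) [].
Qed.

(** The times at which the densities of the cells form a consistent family of weights;
    almost all times are good, as there are countably many words. *)
Definition good_times : set R := [set t | forall w, 0 <= cell_density w t /\
  cell_density w t = cell_density (rcons w false) t + cell_density (rcons w true) t].

Lemma ae_good_times : {ae leb, forall t, good_times t}.
Proof.
apply: ae_forall_countable => w.
have h1 := cell_density_ge0 w; have h2 := cell_density_rcons w.
exact (@filterS2 _ _ (ae_filter_ringOfSetsType leb) _ _ _ (fun t a b => conj a b) h1 h2).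
Qed.

Lemma measurable_good_times : measurable good_times.
Proof.
have mc := measurable_cell_density.
rewrite (_ : good_times = \bigcap_w ([set t | 0 <= cell_density w t] `&`
  [set t | cell_density w t = cell_density (rcons w false) t + cell_density (rcons w true) t])); last first.
  by apply/seteqP; split => t h w; [move=> _; exact: h|exact: h].
rewrite -[X in measurable X]setCK setC_bigcap; apply: measurableC.
apply: countable_bigcupT_measurable => // w; apply/measurableC/measurableI.
  rewrite -[X in measurable X]setTI (_ : mkset _ = (fun t => 0 <= cell_density w t) @^-1` [set true])//.
  by apply: measurable_fun_ler => //.
rewrite (_ : mkset _ = (fun t => cell_density w t == cell_density (rcons w false) t + cell_density (rcons w true) t) @^-1` [set true]).
  rewrite -[X in measurable X]setTI.
  by apply: measurable_fun_eqr => //; exact: measurable_funD.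
by apply/seteqP; split => t /= /eqP.
Qed.

(** Set to 0 at the other times, so that consistency and nonnegativity hold everywhere. *)
Definition weight (t : R) (w : seq bool) : R := cell_density w t * \1_good_times t.

Lemma weightE t w : weight t w = if t \in good_times then cell_density w t else 0.
Proof. by rewrite /weight indicE; case: ifP => _; rewrite ?mulr1 ?mulr0. Qed.

Lemma weight_ge0 t w : 0 <= weight t w.
Proof. by rewrite weightE; case: ifPn => // /set_mem/(_ w)[]. Qed.

Lemma weight_rcons t w :
  weight t w = weight t (rcons w false) + weight t (rcons w true).
Proof. by rewrite !weightE; case: ifPn => [/set_mem/(_ w)[]|_]//; rewrite addr0. Qed.

Lemma measurable_weight w : measurable_fun setT (weight ^~ w).
Proof.
apply: measurable_funM; first exact: measurable_cell_density.
by apply: measurable_indic; exact: measurable_good_times.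
Qed.

Lemma Rintegral_weight (psi : R -> R) w : bounded_mfun setT psi ->
  leb.-integrable setT (EFin \o (fun t => psi t * weight t w)) /\
  \int[leb]_t (psi t * weight t w) =
  \int[rho]_(p in cell M w `&` Box) psi p.1.
Proof.
move=> bpsi; have i1 : leb.-integrable setT (EFin \o (fun t => psi t * cell_density w t)).
  exact (@integrable_bmf_density _ _ _ (charge_of_finite_measure (cell_time w)) leb
    (cell_time_dominated w) _ _ measurableT bpsi).
have ae : ae_eq leb setT (EFin \o (fun t => psi t * cell_density w t))
    (EFin \o (fun t => psi t * weight t w)).
  apply: (@filterS _ _ (ae_filter_ringOfSetsType leb) _ _ _ ae_good_times) => t gt _ /=.
  by rewrite weightE mem_set.
have m2 : measurable_fun setT (EFin \o (fun t => psi t * weight t w)).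
  apply/measurable_EFinP/measurable_funM; [by case: bpsi|exact: measurable_weight].
have i2 : leb.-integrable setT (EFin \o (fun t => psi t * weight t w)).
  exact (@ae_eq_integrable _ _ _ leb setT _ _ measurableT m2 ae i1).
split=> //; transitivity (\int[leb]_t (psi t * cell_density w t)).
  by rewrite /Rintegral; congr fine; apply/esym/ae_eq_integral => //; exact: measurable_int i1.
rewrite [LHS](Rintegral_density (cell_time_dominated w) measurableT bpsi).
by rewrite /cell_time Rintegral_image_measure.
Qed.

End time_weights.

(** * Disintegration of nonnegative measures *)

Section time_kernel.
Context {R : realType} {n : nat}.
Local Notation E := 'rV[R]_n.
Local Notation T := (R * E)%type.
Local Notation BR := (measurableTypeR R).
Local Notation leb := (@lebesgue_measure R).
Local Notation leb2 := (leb \x leb)%E.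

(** Disintegrations into nonnegative measures, with Fubini's formula as last clause. *)
Definition time_kernel (Omega : set E) (rho : {finite_measure set T -> \bar R})
    (kappa : R -> {finite_measure set E -> \bar R}) : Prop :=
  [/\ (forall t, (kappa t).-null_set (~` Omega)),
    (forall A : set T, measurable A ->
      measurable_fun setT (fun t : R => kappa t (xsection A t))),
    (forall A : set T, measurable A ->
      (\int[leb]_(t in `[0%R, 1%R]) kappa t (xsection A t) = rho A)%E) &
    forall g : T -> R, bounded_mfun setT g ->
      leb.-integrable `[0%R, 1%R]
        (EFin \o (fun t => \int[kappa t]_(x in Omega) g (t, x))) /\
      \int[leb]_(t in `[0, 1]) \int[kappa t]_(x in Omega) g (t, x) =
      \int[rho]_(p in cylinder Omega) g p].

Variable M : R.
Hypothesis M0 : 0 < M.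
Variable Omega : set E.
Hypothesis mO : measurable Omega.
Variable rho : {finite_measure set T -> \bar R}.
Hypothesis rho_time : null_in_time rho.
Local Notation K := (cylinder Omega).
Hypothesis rhoK : rho.-null_set (~` K).
Local Notation Box := (@box R n M).
Hypothesis KB : K `<=` Box.
Let mB : measurable Box := measurable_box M0.
Let mK : measurable K := measurable_cylinder mO.

Let m := weight M0 rho.
Let m_ge0 t w : 0 <= m t w := weight_ge0 M0 rho t w.
Let m_rcons t w : m t w = m t (rcons w false) + m t (rcons w true) :=
  weight_rcons M0 rho t w.
Let m_meas w : measurable_fun setT (m ^~ w) := measurable_weight M0 rho_time w.

Let rp : R * R -> T := random_point M m.
Let mrp : measurable_fun setT rp := measurable_random_point M0 m_meas.

Definition undergraph : set (R * R) := itree m [::].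
Local Notation Z0 := undergraph.

Let mZ0 : measurable Z0 := measurable_itree m_meas [::].

Let xsec_Z0 t : xsection Z0 t = `[0, m t [::][%classic.
Proof. by apply/seteqP; split => s; rewrite /xsection /= inE /undergraph itree_nil. Qed.

Let Z (I : set R) : set (R * R) := Z0 `&` (I `*` setT).

Let mZ I : measurable I -> measurable (Z I).
Proof. by move=> mI; apply: measurableI => //; exact: measurableX. Qed.

Let leb_I t : leb `[0, m t [::][%classic = (m t [::])%:E.
Proof.
rewrite lebesgue_measure_itv/= lte_fin; case: ltP => [|h].
  by rewrite -EFinB/= subr0.
by congr EFin; apply/eqP; rewrite eq_le h m_ge0.
Qed.

Let Z0_fin : (leb2 Z0 < +oo)%E.
Proof.
rewrite /product_measure1.
have b1 : bounded_mfun setT (cst 1 : R -> R) by exact: bmf_cst.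
have [i1 _] := Rintegral_weight M0 rho_time [::] b1.
have -> : (\int[leb]_t (leb \o xsection Z0) t =
    \int[leb]_t (EFin \o (fun t => cst 1 t * m t [::])%R) t)%E.
  by apply: eq_integral => t _ /=; rewrite xsec_Z0 leb_I mul1r.
rewrite -ge0_fin_numE; first by apply: integrable_fin_num.
by apply: integral_ge0 => t _ /=; rewrite mul1r lee_fin m_ge0.
Qed.

Let Z_fin I : measurable I -> (leb2 (Z I) < +oo)%E.
Proof.
move=> mI; apply: le_lt_trans Z0_fin; apply: le_measure; rewrite ?inE//.
  exact: mZ.
exact: subIsetl.
Qed.

Let Z_sec I t : measurable I -> (leb (xsection (Z I) t) < +oo)%E.
Proof.
move=> mI; apply: le_lt_trans (lebesgue_I_lty m t).
rewrite -xsec_Z0; apply: le_measure; rewrite ?inE//.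
- by apply: measurable_xsection; exact: mZ.
- by apply: measurable_xsection.
- by move=> s; rewrite /xsection /= !inE => -[].
Qed.

Let mid : measurable_fun setT (id : T -> T). Proof. exact: measurable_id. Qed.

Let mstrip (I : set R) : measurable I -> measurable (I `*` setT : set T).
Proof. by move=> mI; exact: measurableX. Qed.

Let rho_strip (I : set R) (mI : measurable I) : {finite_measure set T -> \bar R} :=
  @image_measure _ _ _ _ _ rho _ _ (mstrip mI) (fin_lty rho (mstrip mI)) mid.

(** Both sides are close to the same Riemann sum over cells: the masses of the cells under
    rho restricted to the strip are the integrals over I of the weights. *)
Let Rintegral_strip I (mI : measurable I) (phi : T -> R) : continuous phi ->
  \int[leb2]_(p in Z I) phi (rp p) = \int[rho_strip mI]_(p in Box) phi p.
Proof.
move=> cphi; apply/eqP; rewrite -subr_eq0 -normr_le0; apply/ler_addgt0Pr => e e0.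
rewrite add0r; pose c := fine (rho Box); have c0 : 0 <= c by exact: fine_ge0.
have a0 : 0 < e / (2 * c + 1) by rewrite divr_gt0//; lra.
set a := e / (2 * c + 1) in a0.
have aE : 2 * (a * c) + a = e by rewrite /a; field; lra.
have [J hJ] := word_close_ex M0 cphi a0.
have h1 := Rintegral_cells M0 (fin_lty (rho_strip mI) mB) cphi hJ.
have cI : fine (rho_strip mI Box) <= c.
  apply: fine_le; rewrite ?fin_num_measure//.
  by apply: le_measure; rewrite ?inE//; apply: measurableI => //; exact: mstrip.
have bphi : bounded_mfun setT (phi \o rp).
  have [mphi [C phiC]] := continuous_bmf_box M0 cphi.
  split; last by exists C => p _; apply: phiC; exact: point_of_bits_box.
  apply: (measurableT_comp _ mrp); exact: continuous_measurable_prod.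
have [i2 <-] := @Rintegral_sections _ _ BR BR _ leb leb _ (mZ mI) (Z_fin mI) (fun t => Z_sec t mI) _ bphi.
pose h t := \int[leb]_(s in xsection (Z I) t) (phi \o rp) (t, s).
have bI : bounded_mfun setT (\1_I : R -> R) by exact: bmf_indic.
pose S t := \sum_(w : J.-tuple bool) phi (word_point M w) * (\1_I t * m t w).
have hS t : `|h t - S t| <= a * (1 * m t [::]).
  rewrite mul1r /h /S; have [tI|tI] := pselect (I t).
    have -> : xsection (Z I) t = `[0, m t [::][%classic.
      rewrite -xsec_Z0; apply/seteqP; split => s; rewrite /xsection /= !inE; first by case.
      by split.
    rewrite [X in `|_ - X|](_ : _ = \sum_(w : J.-tuple bool) phi (word_point M w) * m t w).
      exact: Rintegral_random_point.
    by apply: eq_bigr => w _; rewrite indicE mem_set// mul1r.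
  have -> : xsection (Z I) t = set0.
    by apply/seteqP; split => // s; rewrite /xsection /= inE => -[_ []].
  rewrite Rintegral_set0 big1; first by rewrite subrr normr0 (mulr_ge0 (ltW a0)).
  by move=> w _; rewrite indicE memNset// mul0r mulr0.
have iw w := (Rintegral_weight M0 rho_time w bI).1.
have iw' (w : J.-tuple bool) : leb.-integrable setT
    (EFin \o (fun t => phi (word_point M w) * (\1_I t * m t w))).
  by have := integrableZl measurableT (phi (word_point M w)) (iw w).
have iS : leb.-integrable setT (EFin \o S).
  exact (@integrable_Rsum _ _ _ leb setT measurableT _ _ _ _ iw').
have SE : \int[leb]_t S t = \sum_(w : J.-tuple bool)
    phi (word_point M w) * fine (rho_strip mI (cell M w `&` Box)).
  rewrite (@Rintegral_sum _ _ _ leb setT measurableT _ _ _ _ iw').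
  apply: eq_bigr => w _; rewrite RintegralZl//; congr (_ * _).
  rewrite (Rintegral_weight M0 rho_time w bI).2.
  transitivity (\int[rho]_(p in cell M w `&` Box) \1_(I `*` setT) p).
    by apply: eq_Rintegral => p _; rewrite !indicE; congr (nat_of_bool _)%:R;
      apply/idP/idP; rewrite !inE /=; [move=> ?; split|case].
  rewrite Rintegral_indic; [by rewrite setIC|exact: measurable_cell_box|exact: mstrip].
have hE : `|\int[leb]_t h t - \int[leb]_t S t| <= a * c.
  have b1 : bounded_mfun setT (cst 1 : R -> R) by exact: bmf_cst.
  have [i1 E1] := Rintegral_weight M0 rho_time [::] b1.
  have i3 : leb.-integrable setT (EFin \o (fun t => a * (cst 1 t * m t [::]))).
    by have := integrableZl measurableT a i1.
  have -> : a * c = \int[leb]_t (a * (cst 1 t * m t [::])).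
    by rewrite RintegralZl// E1 Rintegral_cst ?mul1r ?cell_nil//; exact: measurable_cell_box.
  exact (@Rintegral_dist_le _ _ _ leb setT measurableT _ _ _ i2 iS i3 (fun t _ => hS t)).
move: h1; rewrite -SE; have h5 := ler_wpM2l (ltW a0) cI.
move: hE; rewrite -/h; set i1 := Rintegral _ _ _; set i3 := Rintegral _ _ _.
set i4 := Rintegral _ _ _; rewrite !ler_norml => /andP[h6 h7] /andP[h8 h9].
by apply/andP; split; lra.
Qed.

Let law_strip I (mI : measurable I) A : measurable A ->
  leb2 (rp @^-1` A `&` Z I) = rho (A `&` I `*` setT).
Proof.
move=> mA.
pose m1 : {finite_measure set T -> \bar R} :=
  @image_measure _ _ _ _ _ leb2 _ _ (mZ mI) (Z_fin mI) mrp.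
have -> : leb2 (rp @^-1` A `&` Z I) = m1 A by [].
have -> : rho (A `&` I `*` setT) = rho_strip mI A by [].
apply: (@eq_measure_continuous _ _ m1 (rho_strip mI) Box) => //.
- move=> C mC CB; rewrite /m1 /= /image_measure (_ : _ `&` _ = set0) ?measure0//.
  apply/seteqP; split => // p [/CB + _]; apply; exact: point_of_bits_box.
- move=> C mC CB; rewrite /rho_strip /= /image_measure; apply/eqP.
  rewrite eq_le measure_ge0 andbT -(rhoK mC); last by move=> p /CB + /KB.
  by apply: le_measure; rewrite ?inE//; apply: measurableI => //; exact: mstrip.
- move=> phi cphi _; rewrite -Rintegral_strip//.
  apply: Rintegral_image_measure => //; first by move=> p _; exact: point_of_bits_box.
  exact: continuous_bmf_box.
Qed.

Let law A : measurable A -> leb2 (rp @^-1` A `&` Z0) = rho A.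
Proof.
move=> mA; have := law_strip measurableT mA.
by rewrite /Z !setXTT !setIT.
Qed.

(** The random point drawn at time t lies over time t: otherwise a rational number would
    separate the two times, and two disjoint sets of times would have a common point. *)
Let no_drift : {ae leb2, forall p, Z0 p -> (rp p).1 = p.1}.
Proof.
pose L (q : rat) : set R := [set t | t < ratr q].
pose U (q : rat) : set R := [set t | ratr q <= t].
have mL q : measurable (L q).
  by rewrite (_ : L q = `]-oo, ratr q[%classic)//; apply/seteqP; split => t; rewrite /= in_itv.
have mU q : measurable (U q).
  by rewrite (_ : U q = `[ratr q, +oo[%classic)//; apply/seteqP; split => t; rewrite /= in_itv/= andbT.
have null (I J : set R) (mI : measurable I) (mJ : measurable J) : I `&` J = set0 ->
    leb2 (rp @^-1` (J `*` setT) `&` Z I) = 0%E.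
  move=> IJ; rewrite law_strip//; last exact: measurableX.
  rewrite (_ : _ `&` _ = set0) ?measure0//; apply/seteqP; split => // p [[Jp _] [Ip _]].
  by suff : (I `&` J) p.1 by rewrite IJ.
have LU q : L q `&` U q = set0.
  by apply/seteqP; split => // t [/=]; rewrite /L /U /=; lra.
have UL q : U q `&` L q = set0 by rewrite setIC.
have mpre J I : measurable J -> measurable I -> measurable (rp @^-1` (J `*` setT) `&` Z I).
  move=> mJ mI; apply: measurableI; last exact: mZ.
  by rewrite -[X in measurable X]setTI; apply: mrp => //; exact: measurableX.
pose bad q := (rp @^-1` (U q `*` setT) `&` Z (L q)) `|`
  (rp @^-1` (L q `*` setT) `&` Z (U q)).
have bad0 q : {ae leb2, forall p, ~ bad q p}.
  exists (bad q); split; last by move=> p /= /contrapT.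
  - by apply: measurableU; exact: mpre.
  - apply: null_set_setU.
    + exact: mpre.
    + exact: mpre.
    + by apply: null; [exact: mL|exact: mU|exact: LU].
    + by apply: null; [exact: mU|exact: mL|exact: UL].
have := ae_forall_countable bad0.
apply: (@filterS _ _ (ae_filter_ringOfSetsType leb2)) => p nbad Zp.
apply/eqP; apply: contraT; rewrite neq_lt => /orP[h|h]; exfalso.
  have [q /=] := rat_in_itvoo h; rewrite in_itv/= => /andP[h1 h2].
  by apply: (nbad q); right; split => //; split => //; split=> //; rewrite /U /= ltW.
have [q /=] := rat_in_itvoo h; rewrite in_itv/= => /andP[h1 h2].
by apply: (nbad q); left; split => //; split => //; rewrite /U /= ltW.
Qed.

Let Z1 : set (R * R) := Z0 `&` (rp @^-1` K `&` [set p | (rp p).1 = p.1]).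

Let mZ1 : measurable Z1.
Proof.
apply: measurableI => //; apply: measurableI.
  by rewrite -[X in measurable X]setTI; exact: mrp.
rewrite (_ : mkset _ = (fun p => (rp p).1 == p.1) @^-1` [set true]); last first.
  by apply/seteqP; split => p /= /eqP.
rewrite -[X in measurable X]setTI; apply: measurable_fun_eqr => //.
by apply: (measurableT_comp _ mrp); exact: measurable_fst.
Qed.

Let law1 A : measurable A -> leb2 (rp @^-1` A `&` Z1) = rho A.
Proof.
move=> mA; have mrpA B : measurable B -> measurable (rp @^-1` B).
  by move=> mB'; rewrite -[X in measurable X]setTI; exact: mrp.
have mAK : measurable (A `&` K) by exact: measurableI.
rewrite (measure_carried mK rhoK mA) -law//.
have [N [mN N0 sN]] := no_drift.
apply/eqP; rewrite eq_le; apply/andP; split.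
  apply: le_measure; rewrite ?inE.
  - by apply: measurableI => //; exact: mrpA.
  - by apply: measurableI => //; exact: mrpA.
  - by move=> p [Ap [Zp [Kp _]]].
rewrite -[leRHS](measureU0 (B := N)) //; last by apply: measurableI => //; exact: mrpA.
apply: le_measure; rewrite ?inE.
- by apply: measurableI => //; exact: mrpA.
- by apply: measurableU => //; apply: measurableI => //; exact: mrpA.
- move=> p [[Ap Kp] Zp]; have [e|ne] := pselect ((rp p).1 = p.1); first by left.
  by right; apply: sN => /= h; apply: ne; exact: h.
Qed.

Let Z1_fin : (leb2 Z1 < +oo)%E.
Proof.
apply: le_lt_trans Z0_fin; apply: le_measure; rewrite ?inE//.
exact: subIsetl.
Qed.

Let mZ1t t : measurable (xsection Z1 t). Proof. exact: measurable_xsection. Qed.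

Let Z1_sec t : (leb (xsection Z1 t) < +oo)%E.
Proof.
apply: le_lt_trans (lebesgue_I_lty m t); rewrite -xsec_Z0.
apply: le_measure; rewrite ?inE//.
- exact: measurable_xsection.
- exact: measurable_xsection.
- by move=> s; rewrite /xsection /= !inE => -[].
Qed.

Let mY t : measurable_fun setT (fun s : R => (rp (t, s)).2).
Proof.
apply: (measurableT_comp (f := snd)); first exact: measurable_snd.
by apply: (measurableT_comp mrp); exact: measurable_pair1.
Qed.

(** The law of the space component of the random point drawn at time t. The parameters
    that give a point with another time, or outside the cylinder, are dropped; they form a
    null set, and without them the measure is carried by Omega at every time. *)
Definition kernel_of (t : R) : {finite_measure set E -> \bar R} :=
  @image_measure _ _ _ _ _ leb _ _ (mZ1t t) (Z1_sec t) (mY t).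

Lemma time_kernel_exists : time_kernel Omega rho kernel_of.
Proof.
have Z1E t s : xsection Z1 t s -> (t, (rp (t, s)).2) = rp (t, s) /\ K (rp (t, s)).
  rewrite /xsection /= inE => -[_ [Kp e]]; split=> //.
  have {}e : (rp (t, s)).1 = t := e.
  by rewrite [RHS]surjective_pairing e.
have Z1_01 t : t \notin (`[0%R, 1%R]%classic : set R) -> xsection Z1 t = set0.
  move=> nt; apply/seteqP; split => // s Zs; have [_ [K1 _]] := Z1E _ _ Zs.
  by move/negP: nt; apply; rewrite inE; move: Zs; rewrite /xsection /= inE => -[_ [_ /= <-]].
have secE A t : kernel_of t (xsection A t) = (leb \o xsection (rp @^-1` A `&` Z1)) t.
  rewrite /kernel_of /= /image_measure; congr (leb _); apply/seteqP; split => s.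
    move=> [/= + Zs]; have [e _] := Z1E _ _ Zs.
    by rewrite /xsection /= !inE e => ?; split => //; move: Zs; rewrite /xsection /= inE.
  rewrite {1}/xsection /= inE => -[/= As Zs].
  have Zs' : xsection Z1 t s by rewrite /xsection /= inE.
  by split => //; have [e _] := Z1E _ _ Zs'; rewrite /xsection /= inE e.
have mrpA B : measurable B -> measurable (rp @^-1` B `&` Z1).
  by move=> mB'; apply: measurableI => //; rewrite -[X in measurable X]setTI; exact: mrp.
split.
- move=> t A mA AO; rewrite /kernel_of /= /image_measure (_ : _ `&` _ = set0) ?measure0//.
  by apply/seteqP; split => // s [/AO /= nO /Z1E[_ []]].
- move=> A mA.
  rewrite (_ : (fun t => _) = leb \o xsection (rp @^-1` A `&` Z1)); last by apply/funext => t; exact: secE.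
  by apply: measurable_fun_xsection; exact: mrpA.
- move=> A mA; rewrite -(law1 mA) /product_measure1 [LHS]integral_mkcond.
  apply: eq_integral => t _; rewrite /patch; case: ifPn => [_|].
    exact: secE.
  by move=> nt; rewrite -secE /kernel_of /= /image_measure Z1_01 ?setI0 ?measure0.
- move=> g bg.
  have brp : bounded_mfun setT (g \o rp).
    case: bg => mg [C gC]; split; first exact: measurableT_comp.
    by exists C => p _; exact: gC.
  have [i1 E1] := @Rintegral_sections _ _ BR BR _ leb leb _ mZ1 Z1_fin Z1_sec _ brp.
  have kE t : \int[kernel_of t]_(x in Omega) g (t, x) =
      \int[leb]_(s in xsection Z1 t) (g \o rp) (t, s).
    rewrite (@Rintegral_image_measure _ _ _ _ _ leb _ _ (mZ1t t) (Z1_sec t) (mY t) Omega (fun x => g (t, x)))//.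
    + by apply: eq_Rintegral => s; rewrite inE => /Z1E[e _] /=; rewrite e.
    + by move=> s /Z1E[_ []].
    + case: bg => mg [C gC]; split; last by exists C => x _; exact: gC.
      apply: measurable_funTS; apply: (measurableT_comp mg); exact: measurable_pair1.
  have -> : (fun t => \int[kernel_of t]_(x in Omega) g (t, x)) =
      (fun t => \int[leb]_(s in xsection Z1 t) (g \o rp) (t, s)) by exact/funext.
  split; first by apply: integrableS i1.
  have -> : \int[leb]_(t in `[0, 1]) \int[leb]_(s in xsection Z1 t) (g \o rp) (t, s) =
      \int[leb]_t \int[leb]_(s in xsection Z1 t) (g \o rp) (t, s).
    rewrite [LHS]Rintegral_mkcond; apply: eq_Rintegral => t _; rewrite /patch.
    by case: ifPn => // nt; rewrite Z1_01 ?Rintegral_set0.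
  rewrite E1.
  pose rho' : {finite_measure set T -> \bar R} :=
    @image_measure _ _ _ _ _ leb2 _ _ mZ1 Z1_fin mrp.
  transitivity (\int[rho']_(p in K) g p).
    rewrite (@Rintegral_image_measure _ _ _ _ _ leb2 _ _ mZ1 Z1_fin mrp K g)//.
    + by move=> p [_ []].
    + exact: bmfS bg.
  rewrite /Rintegral; congr fine; apply: eq_measure_integral => A mA _; exact: law1.
Qed.

End time_kernel.

(** * Disintegration of charges *)

Section disintegration.
Context {R : realType} {n : nat}.
Local Notation E := 'rV[R]_n.
Local Notation T := (R * E)%type.
Local Notation BR := (measurableTypeR R).
Local Notation leb := (@lebesgue_measure R).
Local Notation I01 := (`[0%R, 1%R]%classic : set R).

Lemma xsection_strip (I : set R) (B : set E) t :
  xsection (I `*` B) t = if t \in I then B else set0.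
Proof.
apply/seteqP; split => x; rewrite /xsection /= inE /=.
  by move=> [/mem_set -> ].
by case: ifPn => // /set_mem ? ?.
Qed.

Lemma xsection_full (F : R -> set E -> \bar R) (B : set E) :
  (fun t => F t (xsection (setT `*` B) t)) = (fun t => F t B).
Proof. by apply/funext => t; rewrite xsection_strip in_setT. Qed.

(** Restricting to a strip localises the integral in time. *)
Lemma integral_strip (F : R -> set E -> \bar R) (I : set R) (B : set E) :
  (forall t, F t set0 = 0%E) -> I `<=` I01 ->
  (\int[leb]_(t in I01) F t (xsection (I `*` B) t) = \int[leb]_(t in I) F t B)%E.
Proof.
move=> F0 I1; rewrite [LHS]integral_mkcond [RHS]integral_mkcond.
apply: eq_integral => t _; rewrite /patch xsection_strip.
case: (boolP (t \in I)) => [tI|_]; first by rewrite mem_set//; apply: I1; rewrite -inE.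
by rewrite F0; case: ifP.
Qed.

Variable M : R.
Hypothesis M0 : 0 < M.
Variable Omega : set E.
Hypothesis mO : measurable Omega.
Local Notation K := (cylinder Omega).
Hypothesis KB : K `<=` @box R n M.
Let mB : measurable (@box R n M) := measurable_box M0.
Let mK : measurable K := measurable_cylinder mO.
Let mI01 : measurable I01. Proof. exact: measurable_itv. Qed.

Section kernel_facts.
Variables (rho : {finite_measure set T -> \bar R}).
Variable kappa : R -> {finite_measure set E -> \bar R}.
Hypothesis kk : time_kernel Omega rho kappa.

Lemma kernel_measurable B : measurable B -> measurable_fun setT (fun t : R => kappa t B).
Proof.
move=> mB'; have [_ mk _ _] := kk.
have := mk (setT `*` B) (measurableX measurableT mB').
by rewrite (xsection_full (fun t B => kappa t B)).
Qed.

Lemma kernel_integrable A : measurable A ->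
  leb.-integrable I01 (fun t => kappa t (xsection A t)).
Proof.
move=> mA; have [_ mk ik _] := kk; apply/integrableP; split.
  by apply: measurable_funTS; exact: mk.
have -> : (\int[leb]_(t in I01) `|kappa t (xsection A t)| =
    \int[leb]_(t in I01) kappa t (xsection A t))%E.
  by apply: eq_integral => t _; rewrite gee0_abs.
by rewrite ik// fin_lty.
Qed.

Lemma kernel_strip_integrable B : measurable B -> leb.-integrable I01 (fun t => kappa t B).
Proof.
move=> mB'; have := kernel_integrable (measurableX (@measurableT _ R) mB').
by rewrite (xsection_full (fun t B => kappa t B)).
Qed.

Lemma kernel_strip I B : measurable I -> I `<=` I01 -> measurable B ->
  (\int[leb]_(t in I) kappa t B = rho (I `*` B))%E.
Proof.
move=> mI I1 mB'; have [_ _ ik _] := kk.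
rewrite -ik; last exact: measurableX.
by rewrite (@integral_strip (fun t B => kappa t B)).
Qed.

End kernel_facts.

Variable nu : {charge set T -> \bar R}.
Hypothesis nuK : nu.-null_set (~` K).
Variables alpha beta : R -> {finite_measure set E -> \bar R}.
Hypothesis ka : time_kernel Omega (jpos nu) alpha.
Hypothesis kb : time_kernel Omega (jneg nu) beta.

Definition kernel_diff (t : R) : {charge set E -> \bar R} :=
  cadd (charge_of_finite_measure (alpha t))
    (cscale (-1) (charge_of_finite_measure (beta t))).

Lemma kernel_diffE t B : kernel_diff t B = (alpha t B - beta t B)%E.
Proof. by rewrite /kernel_diff /= /cadd /= /cscale /= mulN1e. Qed.

Lemma disintegrates_kernel_diff : disintegrates Omega nu kernel_diff.
Proof.
have kE X : (fun t => kernel_diff t (X t)) = (fun t => alpha t (X t) - beta t (X t))%E.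
  by apply/funext => t; exact: kernel_diffE.
split.
- move=> t _ A mA AO; rewrite kernel_diffE.
  have [a0 _ _ _] := ka; have [b0 _ _ _] := kb.
  by rewrite (a0 t A mA AO) (b0 t A mA AO) sube0.
- move=> B mB'; rewrite (kE (fun=> B)).
  apply: measurable_funTS; apply: emeasurable_funB.
    exact: (kernel_measurable ka).
  exact: (kernel_measurable kb).
- move=> A mA; have ia := kernel_integrable ka mA; have ib := kernel_integrable kb mA.
  rewrite (kE (fun t => xsection A t)); split; first exact: integrableB.
  have [_ _ ea _] := ka; have [_ _ eb _] := kb.
  by rewrite integralB// ea// eb// charge_jordan.
Qed.

Section uniqueness.
Variable nut : R -> {charge set E -> \bar R}.
Hypothesis dnu : disintegrates Omega nu nut.

(** Over every set I of times both sides integrate to nu (I `*` B). *)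
Lemma disintegration_ae_eq B : measurable B ->
  {ae leb, forall t, I01 t -> nut t B = (alpha t B - beta t B)%E}.
Proof.
move=> mB'; have [_ mnut inu] := dnu.
have ia := kernel_strip_integrable ka mB'; have ib := kernel_strip_integrable kb mB'.
have i1 : leb.-integrable I01 (fun t => nut t B).
  have [+ _] := inu _ (measurableX (@measurableT _ R) mB').
  by rewrite (xsection_full (fun t B => nut t B)).
have i2 : leb.-integrable I01 (fun t => alpha t B - beta t B)%E by exact: integrableB.
apply: (@integral_ae_eq _ _ _ leb I01 mI01 _ _ i1); first exact: measurable_int i2.
move=> I I1 mI; rewrite integralB//; last 2 first.
- exact: integrableS ia.
- exact: integrableS ib.
rewrite (kernel_strip ka)// (kernel_strip kb)//.
have mIB : measurable (I `*` B) by exact: measurableX.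
rewrite -charge_jordan//; have [_ ->] := inu _ mIB.
by rewrite (@integral_strip (fun t B => nut t B))// => t; rewrite charge0.
Qed.

(** Cells are countably many and determine a nonnegative measure, so that one null set of
    times serves for all Borel sets. As cells compare nonnegative measures, the negative
    parts are moved to the other side of the equation. *)
Lemma disintegration_unique : {ae leb, forall t, I01 t ->
  forall A, measurable A -> nut t A = (alpha t A - beta t A)%E}.
Proof.
have [nO _ _] := dnu.
have mf : measurable_fun setT (fun x : E => (0, x) : T) by exact: measurable_pair1.
(* Space is embedded in space-time at time 0, so as to use its cells. *)
pose Bw w := (fun x : E => (0, x) : T) @^-1` (cell M w `&` @box R n M).
have mBw w : measurable (Bw w).
  by rewrite -[X in measurable X]setTI; apply: mf => //; exact: measurable_cell_box.
have := ae_forall_countable (fun w => disintegration_ae_eq (mBw w)).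
apply: (@filterS _ _ (ae_filter_ringOfSetsType leb)) => t h It A mA.
have [jp jn] := jordan_carried (nO t It).
have [a0 _ _ _] := ka; have [b0 _ _ _] := kb.
have fin (m m' : {finite_measure set E -> \bar R}) : (measure_add m m' setT < +oo)%E.
  by rewrite /measure_add /= /msum 2!big_ord_recr big_ord0/= add0e lte_add_pinfty ?fin_lty.
have addE (m m' : {finite_measure set E -> \bar R}) C :
    measure_add m m' C = (m C + m' C)%E.
  by rewrite /measure_add /= /msum 2!big_ord_recr big_ord0/= add0e.
pose m1 : {finite_measure set T -> \bar R} :=
  @image_measure _ _ _ _ _ (measure_add (jpos (nut t)) (beta t)) _ _ measurableT (fin _ _) mf.
pose m2 : {finite_measure set T -> \bar R} :=
  @image_measure _ _ _ _ _ (measure_add (alpha t) (jneg (nut t))) _ _ measurableT (fin _ _) mf.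
have OB x : Omega x -> @box R n M (0, x).
  by move=> Ox; apply: KB; split => //=; rewrite in_itv/= lexx ler01.
have null (m m' : {finite_measure set E -> \bar R}) C :
    m.-null_set (~` Omega) -> m'.-null_set (~` Omega) -> measurable C ->
    C `<=` ~` @box R n M ->
    measure_add m m' ((fun x : E => (0, x) : T) @^-1` C `&` setT) = 0%E.
  move=> n1 n2 mC CB; rewrite addE.
  have mC' : measurable ((fun x : E => (0, x) : T) @^-1` C `&` setT) by rewrite setIC; apply: (mf).
  have sC : (fun x : E => (0, x) : T) @^-1` C `&` setT `<=` ~` Omega.
    by move=> x [/CB + _] Ox; apply; exact: OB.
  by rewrite n1// n2// adde0.
have swap C : measurable C -> (nut t C = alpha t C - beta t C)%E <->
    measure_add (jpos (nut t)) (beta t) C = measure_add (alpha t) (jneg (nut t)) C.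
  move=> mC; rewrite !addE charge_jordan//.
  have f1 : jpos (nut t) C \is a fin_num by rewrite fin_num_measure.
  have f2 : jneg (nut t) C \is a fin_num by rewrite fin_num_measure.
  have f3 : alpha t C \is a fin_num by rewrite fin_num_measure.
  have f4 : beta t C \is a fin_num by rewrite fin_num_measure.
  rewrite -(fineK f1) -(fineK f2) -(fineK f3) -(fineK f4) -!EFinB -!EFinD.
  by split => -[e]; congr EFin; lra.
apply/swap => //.
have E12 : m1 (setT `*` A) = m2 (setT `*` A).
  apply: (@eq_measure_cells _ _ M M0 m1 m2); last exact: measurableX.
  - by move=> C mC CB; rewrite /m1; apply: null.
  - by move=> C mC CB; rewrite /m2; apply: null.
  - move=> w; rewrite /m1 /m2 /= /image_measure setIT.
    by apply/swap; [exact: mBw|exact: h].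
have pre : (fun x : E => (0, x) : T) @^-1` (setT `*` A) `&` setT = A.
  by apply/seteqP; split => x; [move=> [[]]|move=> Ax; split].
by move: E12; rewrite /m1 /m2 /= /image_measure pre.
Qed.

Lemma disintegration_cintegral : {ae leb, forall t, I01 t ->
  forall f, bounded_mfun Omega f -> cintegral (nut t) Omega f =
    \int[alpha t]_(x in Omega) f x - \int[beta t]_(x in Omega) f x}.
Proof.
have := disintegration_unique.
apply: (@filterS _ _ (ae_filter_ringOfSetsType leb)) => t h It f bf.
by apply: cintegral_diff => //; exact: h.
Qed.

End uniqueness.

End disintegration.

(** * Functions of time tested against continuous functions *)

Section nonnegative_tests.
Context {R : realType}.
Local Notation T := (R * 'rV[R]_0)%type.
Local Notation BR := (measurableTypeR R).
Local Notation leb := (@lebesgue_measure R).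
Local Notation leb2 := (leb \x leb)%E.

(** The image of plane Lebesgue measure on the region under the graph of p. The space
    component of space-time is trivial here. *)
Lemma measure_of_density (p : R -> R) : measurable_fun setT p ->
  (forall t, 0 <= p t) -> leb.-integrable setT (EFin \o p) ->
  exists m : {finite_measure set T -> \bar R}, forall phi : T -> R,
    bounded_mfun setT phi -> \int[m]_q phi q = \int[leb]_t (phi (t, 0) * p t).
Proof.
move=> mp p0 ip; pose D : set (R * R) := [set q | 0 <= q.2 < p q.1].
have mD : measurable D.
  rewrite (_ : D = (fun q : R * R => (0 <= q.2) && (q.2 < p q.1)) @^-1` [set true]); last by apply/seteqP; split.
  rewrite -[X in measurable X]setTI; apply: measurable_and => //.
    by apply: measurable_fun_ler => //; exact: measurable_snd.
  apply: measurable_fun_ltr; first exact: measurable_snd.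
  by apply: (measurableT_comp mp); exact: measurable_fst.
have secD t : xsection D t = `[0, p t[%classic.
  by apply/seteqP; split => s; rewrite /xsection /= inE /D /= in_itv.
have lebD t : leb (xsection D t) = (p t)%:E.
  rewrite secD lebesgue_measure_itv/= lte_fin; case: ltP => [|h].
    by rewrite -EFinB/= subr0.
  by congr EFin; apply/eqP; rewrite eq_le h p0.
have Dsec t : (leb (xsection D t) < +oo)%E by rewrite lebD ltry.
have Dfin : (leb2 D < +oo)%E.
  rewrite /product_measure1.
  have -> : (\int[leb]_t (leb \o xsection D) t = \int[leb]_t (EFin \o p) t)%E.
    by apply: eq_integral => t _; exact: lebD.
  rewrite -ge0_fin_numE; first by apply: integrable_fin_num.
  by apply: integral_ge0 => t _; rewrite lee_fin.
have mf : measurable_fun setT (fun q : R * R => (q.1, 0) : T).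
  by apply: (measurableT_comp measurable_flatten); exact: measurable_fst.
exists (@image_measure _ _ _ _ _ leb2 _ _ mD Dfin mf) => phi bphi.
rewrite (@Rintegral_image_measure _ _ _ _ _ leb2 _ _ mD Dfin mf setT phi)//.
have bF : bounded_mfun setT (fun q : R * R => phi (q.1, 0)).
  by case: bphi => mphi [C phiC]; split; [exact: measurableT_comp|exists C => q _; exact: phiC].
have [_ <-] := @Rintegral_sections _ _ BR BR _ leb leb _ mD Dfin Dsec _ bF.
apply: eq_Rintegral => t _ /=; rewrite Rintegral_cst; last exact: measurable_xsection.
by congr (_ * _); exact (congr1 fine (lebD t)).
Qed.

(** The measures with densities the negative and the positive part of g are comparable,
    and on the set where g is negative the second one vanishes. *)
Lemma ae_ge0_of_tests (g : R -> R) : leb.-integrable setT (EFin \o g) ->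
  (forall psi : R -> R, continuous psi -> (forall t, 0 <= psi t <= 1) ->
    0 <= \int[leb]_t (psi t * g t)) ->
  {ae leb, forall t, 0 <= g t}.
Proof.
move=> ig test; have mg : measurable_fun setT g.
  by apply/measurable_EFinP; exact: measurable_int ig.
pose gp (t : R) : R := Num.max (g t) 0; pose gn (t : R) : R := Num.max (- g t) 0.
have gE t : g t = gp t - gn t.
  by rewrite /gp /gn; case: (leP (g t) 0) => h; [rewrite max_l|rewrite max_r]; lra.
have gp0 t : 0 <= gp t by rewrite le_max lexx orbT.
have gn0 t : 0 <= gn t by rewrite le_max lexx orbT.
have mgp : measurable_fun setT gp by exact: measurable_maxr.
have mgn : measurable_fun setT gn by apply: measurable_maxr => //; exact: measurableT_comp.
have dom (h : R -> R) : measurable_fun setT h -> (forall t, 0 <= h t <= `|g t|) ->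
    leb.-integrable setT (EFin \o h).
  move=> mh hg; apply: le_integrable ig => //; first exact/measurable_EFinP.
  by move=> t _ /=; rewrite lee_fin; have /andP[h0 h1] := hg t; rewrite ger0_norm.
have igp : leb.-integrable setT (EFin \o gp).
  apply: dom => // t; rewrite gp0 /gp ge_max normr_ge0 andbT; exact: ler_norm.
have ign : leb.-integrable setT (EFin \o gn).
  apply: dom => // t; rewrite gn0 /gn ge_max normr_ge0 andbT -normrN; exact: ler_norm.
have [m1 m1E] := measure_of_density mgn gn0 ign.
have [m2 m2E] := measure_of_density mgp gp0 igp.
have m12 (phi : T -> R) : continuous phi -> (forall q, 0 <= phi q <= 1) ->
    \int[m1]_q phi q <= 1 * \int[m2]_q phi q.
  move=> cphi phi01.
  have bphi : bounded_mfun setT phi.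
    apply: (@continuous_bmf _ _ _ 1) => // q _; have /andP[? ?] := phi01 q.
    by rewrite ger0_norm.
  rewrite mul1r m1E// m2E//; pose psi t := phi (t, 0 : 'rV[R]_0).
  have cpsi : continuous psi by exact: continuous_flatten.
  have psi01 t : 0 <= psi t <= 1 by exact: phi01.
  have mpsi : measurable_fun setT psi by exact: continuous_measurable_fun.
  have ipsi (h : R -> R) : measurable_fun setT h -> (forall t, 0 <= h t <= `|g t|) ->
      leb.-integrable setT (EFin \o (fun t => psi t * h t)).
    move=> mh hg; apply: dom; first exact: measurable_funM.
    move=> t; have /andP[a0 a1] := psi01 t; have /andP[b0 b1] := hg t.
    by rewrite mulr_ge0//= (le_trans _ b1)// ler_piMl.
  have i1 : leb.-integrable setT (EFin \o (fun t => psi t * gn t)).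
    apply: ipsi => // t; rewrite gn0 /gn ge_max normr_ge0 andbT -normrN; exact: ler_norm.
  have i2 : leb.-integrable setT (EFin \o (fun t => psi t * gp t)).
    apply: ipsi => // t; rewrite gp0 /gp ge_max normr_ge0 andbT; exact: ler_norm.
  rewrite -subr_ge0 -(RintegralB measurableT i2 i1).
  have -> : \int[leb]_t (psi t * gp t - psi t * gn t) = \int[leb]_t (psi t * g t).
    by apply: eq_Rintegral => t _; rewrite -mulrBr -gE.
  exact: test.
pose N : set R := [set t | g t < 0].
have mN : measurable N.
  rewrite (_ : N = (fun t => g t < 0) @^-1` [set true])// -[X in measurable X]setTI.
  by apply: measurable_fun_ltr.
have mNT : measurable (N `*` setT : set T) by exact: measurableX.
have := le_measure_continuous measurableT ler01 m12 mNT.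
have indE (m : {finite_measure set T -> \bar R}) :
    fine (m (N `*` setT `&` setT)) = \int[m]_q \1_(N `*` setT) q.
  by rewrite Rintegral_indic.
have indN t : \1_(N `*` (setT : set 'rV[R]_0)) (t, 0) = (g t < 0)%R%:R :> R.
  rewrite indicE; congr (nat_of_bool _)%:R; apply/idP/idP; first by rewrite inE => -[].
  by move=> gt; rewrite inE; split.
have bN : bounded_mfun setT (\1_(N `*` setT) : T -> R) by exact: bmf_indic.
rewrite !indE m1E// m2E// mul1r.
have -> : \int[leb]_t (\1_(N `*` (setT : set 'rV[R]_0)) (t, 0) * gp t) = 0.
  rewrite /Rintegral integral0_eq// => t _; rewrite indN /gp.
  by case: ltP => h; rewrite ?mul0r ?mul1r//= max_r ?mulr0// ltW.
have -> : \int[leb]_t (\1_(N `*` (setT : set 'rV[R]_0)) (t, 0) * gn t) = \int[leb]_t gn t.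
  apply: eq_Rintegral => t _; rewrite indN /gn.
  by case: ltP => h; rewrite ?mul0r ?mul1r//= max_r//; lra.
move=> h0; have gn_int0 : (\int[leb]_t `|(gn t)%:E| = 0)%E.
  have -> : (\int[leb]_t `|(gn t)%:E| = \int[leb]_t (gn t)%:E)%E.
    by apply: eq_integral => t _; rewrite gee0_abs ?lee_fin.
  rewrite -[LHS]fineK; last by apply: integrable_fin_num.
  congr EFin; apply/eqP; rewrite eq_le h0 /=.
  by apply: fine_ge0; apply: integral_ge0 => t _; rewrite lee_fin.
have mgn' : measurable_fun setT (EFin \o gn) by exact/measurable_EFinP.
have := (ae_eq_integral_abs leb measurableT mgn').1 gn_int0.
apply: (@filterS _ _ (ae_filter_ringOfSetsType leb)) => t /(_ Logic.I) [h].
by rewrite gE h subr0.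
Qed.

End nonnegative_tests.

(** * Profiles of constraints *)

Section constraint.
Context {R : realType} {n : nat}.
Local Notation E := 'rV[R]_n.
Local Notation T := (R * E)%type.
Local Notation leb := (@lebesgue_measure R).
Local Notation I01 := (`[0%R, 1%R]%classic : set R).
Variable M : R.
Hypothesis M0 : 0 < M.
Variable Omega : set E.
Hypothesis mO : measurable Omega.
Local Notation K := (cylinder Omega).
Hypothesis KB : K `<=` @box R n M.
Let mK : measurable K := measurable_cylinder mO.
Let mI01 : measurable I01. Proof. exact: measurable_itv. Qed.

(** Both Jordan parts must ignore null sets of times for nu to disintegrate in time. *)
Definition time_regular (nu : {charge set T -> \bar R}) : Prop :=
  [/\ nu.-null_set (~` K), null_in_time (jpos nu) & null_in_time (jneg nu)].

Lemma time_regular_measure (m : {finite_measure set T -> \bar R}) :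
  m.-null_set (~` K) -> null_in_time m ->
  time_regular (charge_of_finite_measure m).
Proof.
move=> mK0 mt; split=> [//| |] N mN N0.
  have [P [mP PE]] := jpos_hahn (charge_of_finite_measure m).
  have mNT : measurable (N `*` setT : set T) by exact: measurableX.
  have le0 : (m (N `*` setT `&` P) <= 0)%E.
    rewrite -(mt N mN N0); apply: le_measure; rewrite ?inE//; exact: measurableI.
  have le1 : (jpos (charge_of_finite_measure m) (N `*` setT) <= 0)%E.
    by rewrite (PE _ mNT).
  by apply/eqP; rewrite eq_le measure_ge0 andbT; exact le1.
have [P [mP PE]] := jneg_hahn (charge_of_finite_measure m).
have mNT : measurable (N `*` setT : set T) by exact: measurableX.
have ge0 : (0 <= m (N `*` setT `&` P))%E by exact: measure_ge0.
have le0 : (- m (N `*` setT `&` P) <= 0)%E by rewrite oppe_le0.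
have le1 : (jneg (charge_of_finite_measure m) (N `*` setT) <= 0)%E.
  by rewrite (PE _ mNT).
by apply/eqP; rewrite eq_le measure_ge0 andbT; exact le1.
Qed.

Section one_charge.
Variable nu : {charge set T -> \bar R}.
Hypothesis nur : time_regular nu.

Lemma time_kernels_exist : exists alpha beta : R -> {finite_measure set E -> \bar R},
  time_kernel Omega (jpos nu) alpha /\ time_kernel Omega (jneg nu) beta.
Proof.
have [nK tp tn] := nur; have [pK qK] := jordan_carried nK.
by exists (kernel_of M0 mO tp), (kernel_of M0 mO tn); split; exact: time_kernel_exists.
Qed.

Lemma disintegrates_exists : exists nut, disintegrates Omega nu nut.
Proof.
have [alpha [beta [ka kb]]] := time_kernels_exist.
by exists (kernel_diff alpha beta); exact: disintegrates_kernel_diff.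
Qed.

(** Up to a null set of times, slicewise integrals do not depend on the disintegration;
    their integrals against functions of time are integrals against nu. *)
Lemma slice_profile (g : T -> R) : bounded_mfun setT g ->
  exists h : R -> R, [/\ leb.-integrable I01 (EFin \o h),
    (forall psi : R -> R, bounded_mfun setT psi ->
      leb.-integrable I01 (EFin \o (fun t => psi t * h t)) /\
      \int[leb]_(t in I01) (psi t * h t) = cintegral nu K (fun p => psi p.1 * g p)) &
    forall nut, disintegrates Omega nu nut ->
      {ae leb, forall t, I01 t -> forall G : T -> R, {in K, G =1 g} ->
        cintegral (nut t) Omega (fun x => G (t, x)) = h t}].
Proof.
move=> bg; have [alpha [beta [ka kb]]] := time_kernels_exist.
have [nK _ _] := nur.
pose h t := \int[alpha t]_(x in Omega) g (t, x) - \int[beta t]_(x in Omega) g (t, x).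
have bslice (g' : T -> R) t : bounded_mfun setT g' -> bounded_mfun Omega (fun x => g' (t, x)).
  move=> [mg [C gC]]; split; last by exists C => x _; exact: gC.
  by apply: measurable_funTS; apply: (measurableT_comp mg); exact: measurable_pair1.
have tests (psi : R -> R) : bounded_mfun setT psi ->
    leb.-integrable I01 (EFin \o (fun t => psi t * h t)) /\
    \int[leb]_(t in I01) (psi t * h t) = cintegral nu K (fun p => psi p.1 * g p).
  move=> bpsi; have bpg : bounded_mfun setT (fun p : T => psi p.1 * g p).
    apply: bmfM => //; case: bpsi => mpsi [C psiC]; split; last by exists C => p _; exact: psiC.
    by apply: (measurableT_comp mpsi); exact: measurable_fst.
  have [_ _ _ fa] := ka; have [_ _ _ fb] := kb.
  have [ia ea] := fa _ bpg; have [ib eb] := fb _ bpg.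
  have e t : psi t * h t = \int[alpha t]_(x in Omega) (psi t * g (t, x)) -
      \int[beta t]_(x in Omega) (psi t * g (t, x)).
    rewrite !RintegralZl//.
    - by rewrite -mulrBr.
    - by apply: bmf_integrable => //; [exact: fin_lty|exact: bslice].
    - by apply: bmf_integrable => //; [exact: fin_lty|exact: bslice].
  have -> : (fun t => psi t * h t) = (fun t => \int[alpha t]_(x in Omega) (psi t * g (t, x)) -
      \int[beta t]_(x in Omega) (psi t * g (t, x))) by exact/funext.
  split; first by have := @integrableB _ _ _ leb I01 mI01 _ _ ia ib.
  by rewrite (@RintegralB _ _ _ leb I01 _ _ mI01 ia ib) ea eb.
exists h; split => //.
  have b1 : bounded_mfun setT (cst 1 : R -> R) by exact: bmf_cst.
  have [i1 _] := tests _ b1; move: i1.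
  by have -> : (fun t => cst 1 t * h t) = h by apply/funext => t; rewrite mul1r.
move=> nut dnu; have := disintegration_cintegral M0 mO KB ka kb dnu.
apply: (@filterS _ _ (ae_filter_ringOfSetsType leb)) => t ht It G Gg.
transitivity (cintegral (nut t) Omega (fun x => g (t, x))).
  by apply: eq_cintegral => x; rewrite inE => Ox; apply: Gg; rewrite inE; split.
exact (ht It _ (bslice g t bg)).
Qed.

End one_charge.

Definition time_regular_path (mu : path_triple R n) : Prop :=
  [/\ (rho mu).-null_set (~` K), null_in_time (rho mu),
    (forall i, time_regular (omega mu i)) & time_regular (zeta mu)].

(** The left-hand side of the constraint, integrated in time against psi. *)
Definition pairing (mu : path_triple R n) (g0 : T -> R) (g1 : 'I_n -> T -> R)
    (g2 : T -> R) (psi : R -> R) : R :=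
  \int[rho mu]_(p in K) (psi p.1 * g0 p)
  + \sum_(i < n) cintegral (omega mu i) K (fun p => psi p.1 * g1 i p)
  + cintegral (zeta mu) K (fun p => psi p.1 * g2 p).

(** A constraint on the slices becomes a relation between f and a function of time that
    does not involve the disintegrations. *)
Lemma constraint_profile (mu : path_triple R n) (G : T -> R * E * R)
    (g0 : T -> R) (g1 : 'I_n -> T -> R) (g2 : T -> R) :
  time_regular_path mu -> bounded_mfun setT g0 ->
  (forall i, bounded_mfun setT (g1 i)) -> bounded_mfun setT g2 ->
  (forall p, K p -> (G p).1.1 = g0 p) ->
  (forall i p, K p -> (G p).1.2 ord0 i = g1 i p) ->
  (forall p, K p -> (G p).2 = g2 p) ->
  exists h : R -> R, [/\ leb.-integrable I01 (EFin \o h),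
    (forall psi : R -> R, bounded_mfun setT psi ->
      leb.-integrable I01 (EFin \o (fun t => psi t * h t)) /\
      \int[leb]_(t in I01) (psi t * h t) = pairing mu g0 g1 g2 psi) &
    forall (rel : R -> R -> Prop) (f : R -> R),
      affine_constraint rel Omega G f mu <->
      {ae leb, forall t, I01 t -> rel (h t) (f t)}].
Proof.
move=> [rK rt wr zr] b0 b1 b2 G0 G1 G2.
have rr := time_regular_measure rK rt.
have [h0 [i0 t0 u0]] := slice_profile rr b0.
have h1P i := slice_profile (wr i) (b1 i).
pose h1 i := sval (cid (h1P i)).
have h1E i := svalP (cid (h1P i)); rewrite -/(h1 _) in h1E.
have [h2 [i2 t2 u2]] := slice_profile zr b2.
pose h t := h0 t + \sum_(i < n) h1 i t + h2 t.
have tests (psi : R -> R) : bounded_mfun setT psi ->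
    leb.-integrable I01 (EFin \o (fun t => psi t * h t)) /\
    \int[leb]_(t in I01) (psi t * h t) = pairing mu g0 g1 g2 psi.
  move=> bpsi; have [j0 e0] := t0 _ bpsi; have [j2 e2] := t2 _ bpsi.
  have j1 i : leb.-integrable I01 (EFin \o (fun t => psi t * h1 i t)).
    by have [_ t1 _] := h1E i; have [] := t1 _ bpsi.
  have js : leb.-integrable I01 (EFin \o (fun t => \sum_(i < n) (psi t * h1 i t))).
    exact (@integrable_Rsum _ _ _ leb I01 mI01 _ _ _ _ j1).
  have j01 : leb.-integrable I01 (EFin \o (fun t => psi t * h0 t + \sum_(i < n) (psi t * h1 i t))).
    by have := @integrableD _ _ _ leb I01 mI01 _ _ j0 js.
  have -> : (fun t => psi t * h t) = (fun t => psi t * h0 t + \sum_(i < n) (psi t * h1 i t) + psi t * h2 t).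
    by apply/funext => t; rewrite /h !mulrDr mulr_sumr.
  split; first by have := @integrableD _ _ _ leb I01 mI01 _ _ j01 j2.
  rewrite (@RintegralD _ _ _ leb I01 _ _ mI01 j01 j2) (@RintegralD _ _ _ leb I01 _ _ mI01 j0 js) e0 e2 /pairing.
  rewrite (@Rintegral_sum _ _ _ leb I01 mI01 _ _ _ _ j1).
  congr (_ + _ + _); last first.
    by apply: eq_bigr => i _; have [_ t1 _] := h1E i; have [] := t1 _ bpsi.
  rewrite cintegral_finite_measure//.
  apply: (@bmfS _ _ _ K setT) => //.
  apply: bmfM => //; case: bpsi => mpsi [C psiC]; split; last by exists C => p _; exact: psiC.
  by apply: (measurableT_comp mpsi); exact: measurable_fst.
exists h; split => //.
  have bc1 : bounded_mfun setT (cst 1 : R -> R) by exact: bmf_cst.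
  have [i1 _] := tests _ bc1; move: i1.
  by have -> : (fun t => cst 1 t * h t) = h by apply/funext => t; rewrite mul1r.
have FF := ae_filter_ringOfSetsType leb.
have sums rhot omegat zetat :
    disintegrates Omega (charge_of_finite_measure (rho mu)) rhot ->
    (forall i, disintegrates Omega (omega mu i) (omegat i)) ->
    disintegrates Omega (zeta mu) zetat ->
    {ae leb, forall t, I01 t ->
      cintegral (rhot t) Omega (fun x => (G (t, x)).1.1)
      + \sum_(i < n) cintegral (omegat i t) Omega (fun x => (G (t, x)).1.2 ord0 i)
      + cintegral (zetat t) Omega (fun x => (G (t, x)).2) = h t}.
  move=> dr dw dz; have a0 := u0 _ dr; have a2 := u2 _ dz.
  have a1 : {ae leb, forall t, forall i, I01 t -> forall G' : T -> R, {in K, G' =1 g1 i} ->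
      cintegral (omegat i t) Omega (fun x => G' (t, x)) = h1 i t}.
    by apply: ae_forall_countable => i; have [_ _ u1] := h1E i; exact: u1.
  apply: (@filterS3 _ _ FF _ _ _ _ _ a0 a1 a2) => t c0 c1 c2 It.
  rewrite (c0 It (fun p => (G p).1.1)); last by move=> p; rewrite inE => /G0.
  rewrite (c2 It (fun p => (G p).2)); last by move=> p; rewrite inE => /G2.
  congr (_ + _ + _); apply: eq_bigr => i _.
  by rewrite (c1 i It (fun p => (G p).1.2 ord0 i))// => p; rewrite inE => /(G1 i).
move=> rel f; split.
  move=> [rhot [omegat [zetat [dr dw dz]]]] ae1.
  apply: (@filterS2 _ _ FF _ _ _ _ (sums _ _ _ dr dw dz) ae1) => t e r It.
  by rewrite -(e It); exact: r.
move=> ae1; have [rhot dr] := disintegrates_exists rr.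
have [zetat dz] := disintegrates_exists zr.
have wP i := disintegrates_exists (wr i).
pose omegat i := sval (cid (wP i)).
have dw i : disintegrates Omega (omega mu i) (omegat i) := svalP (cid (wP i)).
exists rhot, omegat, zetat; split => //.
apply: (@filterS2 _ _ FF _ _ _ _ (sums _ _ _ dr dw dz) ae1) => t e r It.
by rewrite (e It); exact: r.
Qed.

End constraint.

(** * Constraints in integrated form *)

Section integrated_constraints.
Context {R : realType}.
Local Notation leb := (@lebesgue_measure R).
Local Notation I01 := (`[0%R, 1%R]%classic : set R).
Let mI01 : measurable I01. Proof. exact: measurable_itv. Qed.

Definition unit_test (psi : R -> R) : Prop :=
  continuous psi /\ forall t, 0 <= psi t <= 1.

Lemma unit_test_bmf psi : unit_test psi -> bounded_mfun setT psi.
Proof.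
move=> [cpsi psi01]; split; first exact: continuous_measurable_fun.
by exists 1 => t _; have /andP[? ?] := psi01 t; rewrite ger0_norm.
Qed.

Lemma integrable_test psi (h : R -> R) : unit_test psi ->
  leb.-integrable I01 (EFin \o h) ->
  leb.-integrable I01 (EFin \o (fun t => psi t * h t)).
Proof.
move=> up ih; have [mpsi _] := unit_test_bmf up.
have mh : measurable_fun I01 h by apply/measurable_EFinP; exact: measurable_int ih.
apply: (@le_integrable _ _ _ leb I01 mI01 _ _ _ _ ih).
  apply/measurable_EFinP; apply: measurable_funM => //; exact: measurable_funTS.
move=> t _ /=; rewrite lee_fin normrM; have [_ /(_ t)/andP[p0 p1]] := up.
by rewrite (ger0_norm p0) ler_piMl.
Qed.

Lemma ae_le_tests (h f : R -> R) :
  leb.-integrable I01 (EFin \o h) -> leb.-integrable I01 (EFin \o f) ->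
  {ae leb, forall t, I01 t -> h t <= f t} <->
  forall psi, unit_test psi ->
    \int[leb]_(t in I01) (psi t * h t) <= \int[leb]_(t in I01) (psi t * f t).
Proof.
move=> ih jf; split=> [hf psi up|tests].
  have i1 := integrable_test up ih; have i2 := integrable_test up jf.
  rewrite -subr_ge0 -(@RintegralB _ _ _ leb I01 _ _ mI01 i2 i1).
  have i3 : leb.-integrable I01 (EFin \o (fun t => psi t * f t - psi t * h t)).
    by have := @integrableB _ _ _ leb I01 mI01 _ _ i2 i1.
  have mk : measurable_fun I01 (fun t => psi t * f t - psi t * h t).
    by apply/measurable_EFinP; exact: measurable_int i3.
  have -> : \int[leb]_(t in I01) (psi t * f t - psi t * h t) =
      \int[leb]_(t in I01) Num.max (psi t * f t - psi t * h t) 0.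
    rewrite /Rintegral; congr fine; apply: ae_eq_integral => //.
    - exact: measurable_int i3.
    - by apply/measurable_EFinP; exact: measurable_maxr.
    - apply: (@filterS _ _ (ae_filter_ringOfSetsType leb) _ _ _ hf) => t le It.
      have [_ /(_ t)/andP[p0 p1]] := up.
      by rewrite max_l// -mulrBr mulr_ge0// subr_ge0 le.
  by apply: Rintegral_ge0 => t _; rewrite le_max lexx orbT.
have ig : leb.-integrable I01 (EFin \o (fun t => f t - h t)).
  by have := @integrableB _ _ _ leb I01 mI01 _ _ jf ih.
pose g : R -> R := (fun t => f t - h t) \_ I01.
have ig' : leb.-integrable setT (EFin \o g).
  have := (@integrable_mkcond _ _ _ leb I01 _ mI01).1 ig; rewrite (_ : _ \_ _ = EFin \o g)//.
  by apply/funext => t; rewrite /patch /g /patch /=; case: ifP.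
have : {ae leb, forall t, 0 <= g t}.
  apply: ae_ge0_of_tests => // psi cpsi psi01; have up : unit_test psi by [].
  have -> : \int[leb]_t (psi t * g t) = \int[leb]_(t in I01) (psi t * f t - psi t * h t).
    rewrite [RHS]Rintegral_mkcond; apply: eq_Rintegral => t _.
    by rewrite /g /patch; case: ifP => _; rewrite ?mulr0// mulrBr.
  rewrite (@RintegralB _ _ _ leb I01 _ _ mI01 (integrable_test up jf) (integrable_test up ih)).
  by rewrite subr_ge0 tests.
apply: (@filterS _ _ (ae_filter_ringOfSetsType leb)) => t + It.
by rewrite /g /patch mem_set// subr_ge0.
Qed.

Context {n : nat}.
Local Notation E := 'rV[R]_n.
Local Notation T := (R * E)%type.
Variable M : R.
Hypothesis M0 : 0 < M.
Variable Omega : set E.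
Hypothesis mO : measurable Omega.
Local Notation K := (cylinder Omega).
Hypothesis KB : K `<=` @box R n M.

Section path.
Variable mu : path_triple R n.
Hypothesis mur : time_regular_path Omega mu.
Variables (G : T -> R * E * R) (f : R -> R).
Hypothesis fi : leb.-integrable I01 (EFin \o f).
Variables (g0 : T -> R) (g1 : 'I_n -> T -> R) (g2 : T -> R).
Hypotheses (b0 : bounded_mfun setT g0) (b1 : forall i, bounded_mfun setT (g1 i))
  (b2 : bounded_mfun setT g2).
Hypotheses (G0 : forall p, K p -> (G p).1.1 = g0 p)
  (G1 : forall i p, K p -> (G p).1.2 ord0 i = g1 i p)
  (G2 : forall p, K p -> (G p).2 = g2 p).

(** In this form the constraint passes to weak limits, provided that the coefficients
    are continuous. *)
Lemma affine_ineqP : affine_ineq Omega G f mu <->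
  forall psi, unit_test psi ->
    pairing Omega mu g0 g1 g2 psi <= \int[leb]_(t in I01) (psi t * f t).
Proof.
have [h [ih tests rels]] := constraint_profile M0 mO KB mur b0 b1 b2 G0 G1 G2.
rewrite /affine_ineq; apply: (iff_trans (rels _ _)).
apply: (iff_trans (ae_le_tests ih fi)); split => le psi up;
  have [_ e] := tests _ (unit_test_bmf up); [rewrite -e|rewrite e]; exact: le.
Qed.

Lemma affine_eqP : affine_eq Omega G f mu <->
  forall psi, unit_test psi ->
    pairing Omega mu g0 g1 g2 psi = \int[leb]_(t in I01) (psi t * f t).
Proof.
have [h [ih tests rels]] := constraint_profile M0 mO KB mur b0 b1 b2 G0 G1 G2.
rewrite /affine_eq; apply: (iff_trans (rels _ _)).
have FF := ae_filter_ringOfSetsType leb.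
split=> [hf psi up|eqs].
  have [_ <-] := tests _ (unit_test_bmf up).
  apply/eqP; rewrite eq_le; apply/andP; split.
    apply: (ae_le_tests ih fi).1 => //.
    by apply: (@filterS _ _ FF _ _ _ hf) => t /[apply] ->.
  apply: (ae_le_tests fi ih).1 => //.
  by apply: (@filterS _ _ FF _ _ _ hf) => t /[apply] ->.
have le1 : {ae leb, forall t, I01 t -> h t <= f t}.
  apply/(ae_le_tests ih fi) => psi up; have [_ ->] := tests _ (unit_test_bmf up).
  by rewrite eqs.
have le2 : {ae leb, forall t, I01 t -> f t <= h t}.
  apply/(ae_le_tests fi ih) => psi up; have [_ ->] := tests _ (unit_test_bmf up).
  by rewrite eqs.
apply: (@filterS2 _ _ FF _ _ _ _ le1 le2) => t l1 l2 It.
by apply/eqP; rewrite eq_le l1// l2.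
Qed.

End path.

End integrated_constraints.

(** * Weak convergence of paths *)

Section weak_convergence.
Context {R : realType} {n : nat}.
Local Notation E := 'rV[R]_n.
Local Notation T := (R * E)%type.
Local Notation leb := (@lebesgue_measure R).

Lemma compact_sub_box (K : set T) : compact K -> exists2 M : R, 0 < M & K `<=` box M.
Proof.
move=> cK; have [N [Nr hN]] := compact_bounded cK.
exists (Num.max (N + 1) 1); first by rewrite lt_max ltr01 orbT.
move=> [t x] Kp; have pM : `|((t, x) : T)| <= Num.max (N + 1) 1.
  by apply: hN => //; rewrite lt_max ltrDl ltr01.
have [h1 h2] : `|t| <= Num.max (N + 1) 1 /\ `|x| <= Num.max (N + 1) 1.
  by move: pM; rewrite prod_normE /= ge_max => /andP.
split=> // k; exact: (le_trans (row_coord_le_norm x k)).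
Qed.

Lemma compact_closed_product (K : set T) : compact K -> closed K.
Proof. by apply: compact_closed; exact: (@norm_hausdorff _ T). Qed.

Lemma extend_continuous (K : set T) (g : T -> R) : compact K ->
  {within K, continuous g} ->
  exists g' : T -> R, [/\ continuous g', bounded_mfun setT g' & forall p, K p -> g p = g' p].
Proof.
move=> cK cg; have [N [Nr hN]] := compact_bounded (continuous_compact cg cK).
pose B := Num.max (N + 1) 1.
have B0 : 0 < B by rewrite /B lt_max ltr01 orbT.
have gB p : K p -> `|g p| <= B.
  by move=> Kp; apply: hN; [rewrite /B lt_max ltrDl ltr01|exists p].
have nT : normal_space T by exact: pseudometric_normal.
have [g' [gg' cg' g'B]] := continuous_bounded_extension nT (compact_closed_product cK) B0 cg gB.
exists g'; split => //; first exact: (@continuous_bmf _ _ _ B).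
by move=> p Kp; apply: gg'; rewrite inE.
Qed.

Variable M : R.
Hypothesis M0 : 0 < M.
Variable K : set T.
Hypothesis cK : closed K.
Hypothesis KB : K `<=` box M.
Let mK : measurable K := closed_measurable_prod cK.

(** The Jordan parts converge separately; their limits need not be the Jordan parts of the
    limit, but their difference is all that matters. *)
Lemma charge_weak_limit (U : set_system nat) (nu_ : nat -> {charge set T -> \bar R})
    (C : R) : UltraFilter U ->
  (forall k, (nu_ k).-null_set (~` K)) -> (forall k, mass_on (nu_ k) K <= C) ->
  exists nu : {charge set T -> \bar R}, nu.-null_set (~` K) /\
    forall phi : T -> R, continuous phi ->
      (fun k => cintegral (nu_ k) K phi) @ U --> cintegral nu K phi.
Proof.
move=> UU nuK nuC.
have pC k : fine (jpos (nu_ k) K) <= C.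
  by apply: le_trans (nuC k); rewrite lerDl fine_ge0.
have nC k : fine (jneg (nu_ k) K) <= C.
  by apply: le_trans (nuC k); rewrite lerDr fine_ge0.
have [m1 [m1K m1E]] := weak_limit M0 UU cK KB (fun k => (jordan_carried (nuK k)).1) pC.
have [m2 [m2K m2E]] := weak_limit M0 UU cK KB (fun k => (jordan_carried (nuK k)).2) nC.
pose nu : {charge set T -> \bar R} :=
  cadd (charge_of_finite_measure m1) (cscale (-1) (charge_of_finite_measure m2)).
have nuE A : nu A = (m1 A - m2 A)%E.
  by rewrite /nu /= /cadd /= /cscale /= mulN1e.
exists nu; split=> [A mA AK|phi cphi].
  by rewrite nuE (m1K A mA AK) (m2K A mA AK) sube0.
have bphi : bounded_mfun K phi.
  by apply: (bmfS (measurable_box M0) KB); exact: continuous_bmf_box.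
rewrite (cintegral_diff mK bphi (fun A _ => nuE A)).
by apply: cvgB; [exact: m1E|exact: m2E].
Qed.

End weak_convergence.

Section path_convergence.
Context {R : realType} {n : nat}.
Local Notation E := 'rV[R]_n.
Local Notation T := (R * E)%type.
Local Notation leb := (@lebesgue_measure R).
Variable Omega : set E.
Hypothesis cO : compact Omega.
Local Notation K := (cylinder Omega).

Lemma cylinder_compact : compact K.
Proof. by apply: compact_setX => //; exact: segment_compact. Qed.

(** A constraint only sees its coefficients on the cylinder, a compact set from which
    continuous functions extend. *)
Lemma extend_constraint (G : T -> R * E * R) : {within K, continuous G} ->
  exists (g0 : T -> R) (g1 : 'I_n -> T -> R) (g2 : T -> R), [/\
    [/\ continuous g0, (forall i, continuous (g1 i)) & continuous g2],
    [/\ bounded_mfun setT g0, (forall i, bounded_mfun setT (g1 i)) &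
        bounded_mfun setT g2] &
    [/\ (forall p, K p -> (G p).1.1 = g0 p),
        (forall i p, K p -> (G p).1.2 ord0 i = g1 i p) &
        (forall p, K p -> (G p).2 = g2 p)]].
Proof.
move=> cG; have ext (c : R * E * R -> R) : continuous c ->
    exists g' : T -> R, [/\ continuous g', bounded_mfun setT g' &
      forall p, K p -> c (G p) = g' p].
  move=> cc; apply: (@extend_continuous _ _ K (fun p => c (G p))); first exact: cylinder_compact.
  move=> p; exact: (continuous_comp (cG p) (cc (G p))).
have cfst : continuous (fun q : R * E * R => q.1) by move=> q; exact: cvg_fst.
have cfst' : continuous (fun r : R * E => r.1) by move=> r; exact: cvg_fst.
have csnd' : continuous (fun r : R * E => r.2) by move=> r; exact: cvg_snd.
have c1 : continuous (fun q : R * E * R => q.1.1).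
  by move=> q; exact: (continuous_comp (cfst q) (cfst' q.1)).
have c2 : continuous (fun q : R * E * R => q.2) by move=> q; exact: cvg_snd.
have c3 (i : 'I_n) : continuous (fun q : R * E * R => q.1.2 ord0 i).
  have ccoord : continuous (fun x : E => x ord0 i) by exact: coord_continuous.
  have cc : continuous (fun r : R * E => r.2 ord0 i).
    by move=> r; exact: (continuous_comp (csnd' r) (ccoord r.2)).
  by move=> q; exact: (continuous_comp (cfst q) (cc q.1)).
have [g0 [a0 b0 e0]] := ext _ c1; have [g2 [a2 b2 e2]] := ext _ c2.
have ext1 i := ext _ (c3 i); pose g1 i := sval (cid (ext1 i)).
have g1P i := svalP (cid (ext1 i)).
by exists g0, g1, g2; split; split => // i; have [] := g1P i.
Qed.

Lemma compact_measurable_mx : measurable Omega.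
Proof.
rewrite -(setCK Omega); apply: measurableC; apply: measurable_open_mx.
by apply: closed_openC; apply: compact_closed => //; exact: norm_hausdorff.
Qed.

Let cK : closed K. Proof. exact: compact_closed_product cylinder_compact. Qed.
Let mK : measurable K := closed_measurable_prod cK.

Definition path_cvg (U : set_system nat) (mu_ : nat -> path_triple R n)
    (mu : path_triple R n) : Prop :=
  [/\ (forall phi : T -> R, continuous phi ->
        (fun k => \int[rho (mu_ k)]_(p in K) phi p) @ U --> \int[rho mu]_(p in K) phi p),
      (forall (i : 'I_n) (phi : T -> R), continuous phi ->
        (fun k => cintegral (omega (mu_ k) i) K phi) @ U --> cintegral (omega mu i) K phi) &
      (forall phi : T -> R, continuous phi ->
        (fun k => cintegral (zeta (mu_ k)) K phi) @ U --> cintegral (zeta mu) K phi)].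

Variables (U : set_system nat) (mu_ : nat -> path_triple R n).
Hypothesis UU : UltraFilter U.

Lemma path_compactness (C : R) :
  (forall k, carried_by K (rho (mu_ k))) ->
  (forall k i, carried_by K (omega (mu_ k) i)) ->
  (forall k, carried_by K (zeta (mu_ k))) ->
  (forall k, fine (rho (mu_ k) K) <= C) ->
  (forall k i, mass_on (omega (mu_ k) i) K <= C) ->
  (forall k, mass_on (zeta (mu_ k)) K <= C) ->
  exists mu : path_triple R n, [/\ carried_by K (rho mu),
    (forall i, carried_by K (omega mu i)), carried_by K (zeta mu) & path_cvg U mu_ mu].
Proof.
move=> rK wK zK rC wC zC; have [M M0 KB] := compact_sub_box cylinder_compact.
have [r [r1 r2]] := weak_limit M0 UU cK KB rK rC.
have [z [z1 z2]] := charge_weak_limit M0 cK KB UU zK zC.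
have wP i := charge_weak_limit M0 cK KB UU (wK^~ i) (wC^~ i).
pose w i := sval (cid (wP i)); have wE i := svalP (cid (wP i)).
by exists (PathTriple r w z); split => // [i|]; [|split => // i]; have [] := wE i.
Qed.

Variable mu : path_triple R n.
Hypothesis mumu : path_cvg U mu_ mu.

Lemma CE_closed (rho0 rho1 : {finite_measure set E -> \bar R}) :
  carried_by K (rho mu) -> (forall i, carried_by K (omega mu i)) ->
  carried_by K (zeta mu) -> (forall k, CE Omega rho0 rho1 (mu_ k)) ->
  CE Omega rho0 rho1 mu.
Proof.
move=> r1 w1 z1 ce; split => // phi [dphi cphi].
have cphi0 : continuous phi by move=> p; exact/differentiable_continuous.
have [cr cw cz] := mumu.
have lim : (fun k => \int[rho (mu_ k)]_(p in K) dt phi p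
    + \sum_(i < n) cintegral (omega (mu_ k) i) K (dx i phi)
    + cintegral (zeta (mu_ k)) K phi) @ U -->
    \int[rho mu]_(p in K) dt phi p
    + \sum_(i < n) cintegral (omega mu i) K (dx i phi)
    + cintegral (zeta mu) K phi.
  apply: cvgD; last exact: cz; apply: cvgD; first by apply: cr; exact: cphi.
  by apply: cvg_finite_sum => i; apply: cw; exact: cphi.
rewrite -(cvg_lim (@Rhausdorff R) lim); apply: (cvg_lim (@Rhausdorff R)).
rewrite (_ : (fun k => _) = fun=> \int[rho1]_(x in Omega) phi (1, x)
          - \int[rho0]_(x in Omega) phi (0, x)); first exact: cvg_cst.
by apply/funext => k; have [_ _ _ /(_ phi)] := ce k; apply.
Qed.

Lemma pairing_cvg (g0 : T -> R) (g1 : 'I_n -> T -> R) (g2 : T -> R) (psi : R -> R) :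
  continuous g0 -> (forall i, continuous (g1 i)) -> continuous g2 ->
  continuous psi ->
  (fun k => pairing Omega (mu_ k) g0 g1 g2 psi) @ U --> pairing Omega mu g0 g1 g2 psi.
Proof.
move=> c0 c1 c2 cpsi; have [cr cw cz] := mumu.
have cmul (g : T -> R) : continuous g -> continuous (fun p : T => psi p.1 * g p).
  move=> cg p; apply: cvgM; last exact: cg.
  by apply: continuous_comp; [exact: cvg_fst|exact: cpsi].
apply: cvgD; last by apply: cz; exact: cmul.
apply: cvgD; first by apply: cr; exact: cmul.
by apply: cvg_finite_sum => i; apply: cw; exact: cmul.
Qed.

Lemma dual_value_cvg (delta : R) (b : 'I_n -> T -> R) (c : T -> R) :
  (forall i, continuous (b i)) -> continuous c ->
  (fun k => dual_value Omega delta (mu_ k) b c) @ U --> dual_value Omega delta mu b c.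
Proof.
move=> cb cc; have [cr cw cz] := mumu.
apply: cvgB; first apply: cvgD; last 2 first.
- exact: cz.
- apply: cvgM; last exact: cvg_cst.
  apply: cr => p; apply: cvgD.
    by apply: cvg_finite_sum => i; apply: cvgM; exact: cb.
  by apply: cvgM; [apply: cvgM; exact: cc|exact: cvg_cst].
by apply: cvg_finite_sum => i; apply: cw; exact: cb.
Qed.

End path_convergence.

(** * Existence of an optimal path *)

Section existence.
Context {R : realType} {n : nat}.
Local Notation E := 'rV[R]_n.
Local Notation T := (R * E)%type.
Local Notation leb := (@lebesgue_measure R).
Variables (Omega : set E) (delta : R).
Hypothesis cO : compact Omega.
Hypothesis delta0 : 0 < delta.
Local Notation K := (cylinder Omega).
Variables (rho0 rho1 : {finite_measure set E -> \bar R}).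

Let mO : measurable Omega := compact_measurable_mx cO.

Lemma wfr_cost_ge0 (mu : path_triple R n) : (0 <= wfr_cost Omega delta mu)%E.
Proof. by rewrite wfr_costE; apply: integral_ge0 => p _; exact: f_cost_ge0. Qed.

Lemma finite_cost_time_regular (mu : path_triple R n) (e : R) :
  CE Omega rho0 rho1 mu -> (wfr_cost Omega delta mu <= e%:E)%E ->
  time_regular_path Omega mu.
Proof.
move=> muCE cost_e; have [rK wK zK _] := muCE; split; first exact: rK.
- exact: (rho_null_in_time mO muCE).
- move=> i; have [np nq] := jordan_null_in_time mO muCE (wK i)
    (omega_quadratically_dominated delta0 mO cost_e i).
  by split; first exact: wK.
- have [np nq] := jordan_null_in_time mO muCE zK
    (zeta_quadratically_dominated delta0 mO cost_e).
  by split; first exact: zK.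
Qed.

Lemma mass_bound (e : R) : 0 <= e -> exists C : R, forall mu : path_triple R n,
  CE Omega rho0 rho1 mu -> (wfr_cost Omega delta mu <= e%:E)%E ->
  [/\ fine (rho mu K) <= C, (forall i, mass_on (omega mu i) K <= C) &
    mass_on (zeta mu) K <= C].
Proof.
move=> e0; pose x := e / delta ^+ 2.
have x0 : 0 <= x by rewrite divr_ge0// sqr_ge0.
have m0 : 0 <= fine (rho0 Omega) by exact: fine_ge0.
exists (2 * e + 2 * (fine (rho0 Omega) + 4 * x)) => mu muCE cost_e.
have [] := mass_bounds delta0 mO muCE cost_e.
rewrite -!mulrA -/x => h1 h2 h3.
have h4 : 2 * (fine (rho0 Omega) + 4 * x) <= 2 * e + 2 * (fine (rho0 Omega) + 4 * x) by lra.
split => [|i|]; [exact: le_trans h1 h4|have := h3 i; lra|lra].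
Qed.

End existence.

Theorem theorem3p4 (R : realType) (n : nat) (Omega : set 'rV[R]_n)
    (delta : R) (d d' : nat)
    (rho0 rho1 : {finite_measure set 'rV[R]_n -> \bar R})
    (H : 'I_d -> R * 'rV[R]_n -> R * 'rV[R]_n * R) (F : 'I_d -> R -> R)
    (Omega_compact : compact Omega) (Omega_C1 : has_C1_boundary Omega)
    (delta_gt0 : 0 < delta) (d'_le_d : (d' <= d)%N)
    (rho0_Omega : carried_by Omega rho0) (rho1_Omega : carried_by Omega rho1)
    (H_cont : forall i, {within cylinder Omega, continuous (H i)})
    (F_cont : forall i, {within `[0, 1], continuous (F i)})
    (feasible : exists mu : path_triple R n,
       CE_constrained Omega d' H F rho0 rho1 mu /\
       (wfr_cost Omega delta mu < +oo)%E) :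
  exists mu_opt : path_triple R n,
    CE_constrained Omega d' H F rho0 rho1 mu_opt /\
    wfr_cost Omega delta mu_opt =
    ereal_inf [set wfr_cost Omega delta mu
              | mu in CE_constrained Omega d' H F rho0 rho1].
Proof.
have mO := compact_measurable_mx Omega_compact.
have cK := cylinder_compact Omega_compact.
have [M M0 KB] := compact_sub_box cK.
set S := [set _ | _ in _].
have [mu0 [mu0S mu0fin]] := feasible.
have S_ge0 : (0 <= ereal_inf S)%E.
  by apply: le_ereal_inf_tmp => _ [mu _ <-]; exact: wfr_cost_ge0.
have S_fin : ereal_inf S \is a fin_num.
  rewrite ge0_fin_numE//; apply: le_lt_trans mu0fin.
  by apply: ereal_inf_lbound; exists mu0.
pose e := fine (ereal_inf S).
have eE : ereal_inf S = e%:E by rewrite fineK.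
have e0 : 0 <= e by exact: fine_ge0.
(* By feasibility the infimum is finite, so that it can be approached. *)
have minP k : exists mu, CE_constrained Omega d' H F rho0 rho1 mu /\
    (wfr_cost Omega delta mu <= (e + k.+1%:R^-1)%:E)%E.
  have k0 : (0 : R) < k.+1%:R^-1 by rewrite invr_gt0 ltr0n.
  have [_ [mu muS <-] lt] := lb_ereal_inf_adherent k0 S_fin.
  by exists mu; split => //; rewrite ltW// EFinD -eE.
pose mu_ k := sval (cid (minP k)).
have mu_S k : CE_constrained Omega d' H F rho0 rho1 (mu_ k) := (svalP (cid (minP k))).1.
have mu_e k : (wfr_cost Omega delta (mu_ k) <= (e + k.+1%:R^-1)%:E)%E :=
  (svalP (cid (minP k))).2.
have mu_CE k : CE Omega rho0 rho1 (mu_ k) by have [] := mu_S k.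
have mu_e1 k : (wfr_cost Omega delta (mu_ k) <= (e + 1)%:E)%E.
  apply: le_trans (mu_e k) _; rewrite lee_fin lerD2l invf_le1 ?ltr0n//.
  by rewrite ler1n.
(* Limits are taken along an ultrafilter, which spares the extraction of
   subsequences for each of the n + 2 components. *)
have [U [UU oU]] := @ultraFilterLemma nat \oo _.
have [C massC] := mass_bound Omega_compact delta_gt0 rho0 rho1 (addr_ge0 e0 ler01).
have [mu [rK wK zK mumu]] : exists mu, [/\ carried_by (cylinder Omega) (rho mu),
    (forall i, carried_by (cylinder Omega) (omega mu i)),
    carried_by (cylinder Omega) (zeta mu) & path_cvg Omega U mu_ mu].
  apply: (@path_compactness _ _ _ Omega_compact U mu_ UU C).
  - by move=> k; have [] := mu_CE k.
  - by move=> k i; have [] := mu_CE k.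
  - by move=> k; have [] := mu_CE k.
  - by move=> k; have [] := massC _ (mu_CE k) (mu_e1 k).
  - by move=> k i; have [_ + _] := massC _ (mu_CE k) (mu_e1 k); exact.
  - by move=> k; have [] := massC _ (mu_CE k) (mu_e1 k).
have muCE : CE Omega rho0 rho1 mu := CE_closed UU mumu rK wK zK mu_CE.
(* Lower semicontinuity: the dual values of mu are limits of dual values of
   mu_ k, and these are at most e + 1 / (k + 1). *)
have mu_cost : (wfr_cost Omega delta mu <= e%:E)%E.
  apply: (@wfr_cost_le _ _ _ _ _ delta_gt0 (measurable_cylinder mO)) => b c B cb cc bB cB.
  have lim := @dual_value_cvg _ _ _ _ _ UU _ mumu delta _ _ cb cc.
  have lim_e : (fun k => e + k.+1%:R^-1) @ U --> e.
    rewrite -[e in X in _ --> X]addr0; apply: cvgD; first exact: cvg_cst.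
    by move=> A /cvg_harmonic A0; exact: oU.
  apply: ler_cvg_to lim lim_e _; apply: nearW => k.
  have bmf (g : R * 'rV[R]_n -> R) : continuous g -> (forall p, `|g p| <= B) ->
      bounded_mfun (cylinder Omega) g.
    move=> cg gB; apply: (@continuous_bmf _ _ _ B) => //; exact: measurable_cylinder.
  apply: (dual_le_cost_fine delta_gt0 mO (mu_e k)); last exact: bmf.
  by move=> i; exact: bmf.
have reg : time_regular_path Omega mu.
  exact: finite_cost_time_regular muCE mu_cost.
have reg_ k : time_regular_path Omega (mu_ k).
  exact: finite_cost_time_regular (mu_CE k) (mu_e k).
(* The constraints on mu_ k, integrated in time, are relations between weakly
   continuous functionals. *)
have muS : CE_constrained Omega d' H F rho0 rho1 mu.
  have Fi i : lebesgue_measure.-integrable `[0%R, 1%R] (EFin \o F i).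
    by apply: continuous_compact_integrable => //; exact: segment_compact.
  split => // i hi; have [g0 [g1 [g2 [[c0 c1 c2] [b0 b1 b2] [E0 E1 E2]]]]] :=
    extend_constraint Omega_compact (H_cont i).
    have P mu' (r : time_regular_path Omega mu') := affine_ineqP M0 mO KB r (Fi i) b0 b1 b2 E0 E1 E2.
    apply/(P _ reg) => psi up.
    have lim := pairing_cvg UU mumu c0 c1 c2 up.1.
    apply: ler_cvg_to lim (cvg_cst _) _; apply: nearW => k.
    have [_ cons _] := mu_S k; exact ((P _ (reg_ k)).1 (cons i hi) psi up).
  have P mu' (r : time_regular_path Omega mu') := affine_eqP M0 mO KB r (Fi i) b0 b1 b2 E0 E1 E2.
  apply/(P _ reg) => psi up.
  have lim := pairing_cvg UU mumu c0 c1 c2 up.1.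
  rewrite -(cvg_lim (@Rhausdorff R) lim); apply: (cvg_lim (@Rhausdorff R)).
  rewrite (_ : (fun k => _) = fun=> \int[lebesgue_measure]_(t in `[0, 1]) (psi t * F i t)).
    exact: cvg_cst.
  apply/funext => k; have [_ _ cons] := mu_S k.
  exact ((P _ (reg_ k)).1 (cons i hi) psi up).
exists mu; split => //; apply/eqP; rewrite eq_le; apply/andP; split.
  by rewrite eE.
by apply: ereal_inf_lbound; exists mu.
Qed.
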